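(* Let $\mu$ be a non-atomic self-similar measure on $\mathbb{R}$. Let $d\geq 2$ and assume that for every $\varepsilon>0$ there exist $p>1$ and $C>0$ such that for all $R>1$, $$\int_{B(R)}\big|\widehat{V_{d-1}\mu}(\xi)\big|^p\,d\xi\leq CR^{\varepsilon},$$ where $B(R)$ is the ball of radius $R$ around $0$ in $\mathbb{R}^{d-1}$. Let $g:U\to\mathbb{R}^{d-1}$ be a map defined on an open neighborhood $U$ of $\mathrm{supp}(\mu)$ such that $Q(x)=(x,g(x))$ is either a non-trapped real analytic curve, or a $C^{d+1}$ non-degenerate curve. Let $\nu=Q\mu$ be the pushforward of $\mu$ to the graph of $g$. Then there exists $\gamma=\gamma(\mu,g)>0$ such that for every $\xi=(\theta,\zeta)\in\mathbb{R}\times\mathbb{R}^{d-1}$ with $\zeta\neq\mathbf{0}$, $$|\hat\nu(\xi)|\ll\|\zeta\|^{-\gamma}.$$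
   Context: A self-similar measure on $\mathbb{R}$ is a Borel probability measure $\mu$ such that $\mu=\sum_{i=1}^n \mathbf{p}_i\, f_i\mu$ for some strictly positive probability vector $\mathbf{p}=(\mathbf{p}_1,\dots,\mathbf{p}_n)$ and affine maps $f_i:\mathbb{R}\to\mathbb{R}$ with $|f_i'|\in(0,1)$, where $f_i\mu$ denotes the pushforward of $\mu$ by $f_i$. The moment curve is $V_k(x)=(x,x^2,\dots,x^k)\in\mathbb{R}^k$ for $k\ge 1$ (so $V_1(x)=x$), and $V_k\mu$ is the pushforward of $\mu$ by $V_k$. Let $U\subseteq\mathbb{R}$ be open. A $C^{d+1}$ curve $Q:U\to\mathbb{R}^d$ is non-degenerate if $\det[Q^{(1)}(x)\,Q^{(2)}(x)\cdots Q^{(d)}(x)]\neq 0$ for all $x\in U$. A real analytic curve $Q:U\to\mathbb{R}^d$ is non-trapped if this determinant has at most finitely many zeros in any compact interval contained in $U$. The Fourier transform is $\hat\nu(\xi)=\int e^{2\pi i\langle \xi,x\rangle}\,d\nu(x)$, and $\|\cdot\|$ is the max norm. $A\ll B$ means $|A|\leq CB$ for a constant $C\geq1$ that may depend on $\mu$, $d$ and $g$ (but not on $\xi$). *)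

(* Defs.v *)
From HB Require Import structures.
From mathcomp Require Import all_boot all_order all_algebra.
From mathcomp Require Import all_classical all_reals all_analysis.
From mathcomp Require Import measurable_realfun.
From mathcomp Require Import complex.

Set Implicit Arguments.
Unset Strict Implicit.
Unset Printing Implicit Defensive.

Import Order.TTheory GRing.Theory Num.Theory.
Import numFieldNormedType.Exports.

Local Open Scope classical_set_scope.
Local Open Scope ring_scope.

(* The Borel sigma-algebra of R^n, generated by the coordinates as the library
   does for n.-tuple. *)
Definition rV_display : measure_display. Proof. exact. Qed.

Section measurable_rV.
Variables (R : realType) (n : nat).

Let coord (i : 'I_n) (v : 'rV[R]_n) : R := v ord0 i.

Let rV_set0 : g_sigma_preimage coord set0.
Proof. exact: sigma_algebra0. Qed.

Let rV_setC A : g_sigma_preimage coord A -> g_sigma_preimage coord (~` A).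
Proof. exact: sigma_algebraC. Qed.

Let rV_bigcup (F : _^nat) : (forall i, g_sigma_preimage coord (F i)) ->
  g_sigma_preimage coord (\bigcup_i (F i)).
Proof. exact: sigma_algebra_bigcup. Qed.

HB.instance Definition _ := @isMeasurable.Build rV_display
  'rV[R]_n (g_sigma_preimage coord) rV_set0 rV_setC rV_bigcup.

End measurable_rV.

Lemma measurable_coord (R : realType) n (i : 'I_n) :
  measurable_fun [set: 'rV[R]_n] (fun v : 'rV[R]_n => v ord0 i).
Proof.
move=> _ Y mY; rewrite setTI; apply: sub_sigma_algebra => /=.
rewrite -bigcup_seq/=; exists i => /=; first by rewrite mem_index_enum.
by exists Y => //; rewrite setTI.
Qed.

Lemma measurable_fun_rV d (T : measurableType d) (R : realType) n
    (f : T -> 'rV[R]_n) :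
  (forall i, measurable_fun [set: T] (fun x => f x ord0 i)) ->
  measurable_fun [set: T] f.
Proof.
move=> mf.
have : g_sigma_preimage (fun (i : 'I_n) x => f x ord0 i) `<=` measurable.
  apply: smallest_sub; first exact: sigma_algebra_measurable.
  case: n f mf => [|n] f mf; first by rewrite big_ord0.
  rewrite -bigcup_mkord_ord; apply: bigcup_sub => i Ii.
  by move=> A [B mB <-]; exact: mf.
have -> : g_sigma_preimage (fun (i : 'I_n) x => f x ord0 i) =
    preimage_set_system setT f (@measurable _ 'rV[R]_n).
  exact: (g_sigma_preimage_comp (fun (i : 'I_n) (v : 'rV[R]_n) => v ord0 i) f).
by move=> prefS _ A mA; apply: prefS; exists A.
Qed.

(* Lebesgue measure on R^n, as the iterated product of the one on R. *)
Section lebesgue_rV_succ.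
Variables (R : realType) (n : nat).
Variable nu : {sigma_finite_measure set 'rV[R]_n -> \bar R}.

Definition rV_cons (p : measurableTypeR R * 'rV[R]_n) : 'rV[R]_n.+1 :=
  row_mx (p.1)%:M p.2.

Lemma measurable_rV_cons : measurable_fun setT rV_cons.
Proof.
apply: measurable_fun_rV => i; rewrite /rV_cons.
rewrite (_ : (fun _ => _) = fun p : measurableTypeR R * 'rV[R]_n =>
    match fintype.split (i : 'I_(1 + n)) with
    | inl _ => p.1 | inr k => p.2 ord0 k end); last first.
  apply/funext => p; rewrite mxE.
  by case: (fintype.split _) => k //; rewrite mxE (ord1 k).
case: (fintype.split (i : 'I_(1 + n))) => k; first exact: measurable_fst.
apply: (measurableT_comp (@measurable_coord R n k)); exact: measurable_snd.
Qed.

Definition lebesgue_rV_succ : set 'rV[R]_n.+1 -> \bar R :=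
  pushforward (lebesgue_measure \x nu)%E rV_cons.

Let lebesgue_rV_succ0 : lebesgue_rV_succ set0 = 0%E.
Proof. by rewrite /lebesgue_rV_succ /pushforward preimage_set0 measure0. Qed.

Let lebesgue_rV_succ_ge0 A : (0 <= lebesgue_rV_succ A)%E.
Proof. by rewrite /lebesgue_rV_succ /pushforward; exact: measure_ge0. Qed.

Let lebesgue_rV_succ_sigma_additive : semi_sigma_additive lebesgue_rV_succ.
Proof.
move=> F mF tF mUF; rewrite /lebesgue_rV_succ /pushforward preimage_bigcup.
apply: measure_semi_sigma_additive.
- by move=> k; rewrite -[X in measurable X]setTI; exact: measurable_rV_cons.
- apply/trivIsetP => /= i j _ _ ij; rewrite -preimage_setI.
  by move/trivIsetP : tF => /(_ _ _ _ _ ij) ->//; rewrite preimage_set0.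
- by rewrite -preimage_bigcup -[X in measurable X]setTI;
    exact: measurable_rV_cons.
Qed.

HB.instance Definition _ := isMeasure.Build _ _ _ lebesgue_rV_succ
  lebesgue_rV_succ0 lebesgue_rV_succ_ge0 lebesgue_rV_succ_sigma_additive.

Let lebesgue_rV_succ_sigma_finite : sigma_finite setT lebesgue_rV_succ.
Proof.
have /sigma_finiteP[F [FT ndF Foo]] := sigma_finiteT (@lebesgue_measure R).
have /sigma_finiteP[G [GT ndG Goo]] := sigma_finiteT nu.
pose uncons (v : 'rV[R]_n.+1) : measurableTypeR R * 'rV[R]_n :=
  (v ord0 ord0, \row_(i < n) v ord0 (lift ord0 i)).
have consK : cancel rV_cons uncons.
  move=> [x v]; rewrite /uncons /rV_cons /=; congr pair.
    have -> : ord0 = lshift n (ord0 : 'I_1) :> 'I_(1 + n) by exact/val_inj.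
    by apply: etrans (row_mxEl _ _ _ _) _; rewrite mxE.
  apply/rowP => i; rewrite mxE.
  have -> : lift ord0 i = rshift 1 i :> 'I_(1 + n) by exact/val_inj.
  exact: row_mxEr.
have muncons : measurable_fun setT uncons.
  apply/measurable_fun_pairP; split; first exact: measurable_coord.
  apply: measurable_fun_rV => i.
  rewrite (_ : (fun _ => _) = fun v : 'rV[R]_n.+1 => v ord0 (lift ord0 i)).
    exact: measurable_coord.
  by apply/funext => v; rewrite /= mxE.
exists (fun k => uncons @^-1` (F k `*` G k)).
  apply/seteqP; split=> // v _.
  have [k1 _ Fk1] : (\bigcup_k F k) (uncons v).1 by rewrite -FT.
  have [k2 _ Gk2] : (\bigcup_k G k) (uncons v).2 by rewrite -GT.
  exists (maxn k1 k2) => //; split.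
    by move: Fk1; exact/subsetPset/ndF/leq_maxl.
  by move: Gk2; exact/subsetPset/ndG/leq_maxr.
move=> k; have [mFk Fk] := Foo k; have [mGk Gk] := Goo k; split.
  by rewrite -[X in measurable X]setTI; apply: muncons => //;
    exact: measurableX.
rewrite /lebesgue_rV_succ /pushforward -comp_preimage.
rewrite (_ : uncons \o rV_cons = id); last first.
  by apply/funext => p; exact: consK.
by rewrite preimage_id product_measure1E// lte_mul_pinfty// ge0_fin_numE.
Qed.

HB.instance Definition _ := Measure_isSigmaFinite.Build _ _ _ lebesgue_rV_succ
  lebesgue_rV_succ_sigma_finite.

End lebesgue_rV_succ.

Fixpoint lebesgue_rV (R : realType) (n : nat) :
    {sigma_finite_measure set 'rV[R]_n -> \bar R} :=
  match n with
  | 0 => \d_(0 : 'rV[R]_0)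
  | n'.+1 => lebesgue_rV_succ (lebesgue_rV R n')
  end.

Definition self_similar (R : realType)
    (mu : probability (measurableTypeR R) R) : Prop :=
  exists (n : nat) (p r t : 'I_n -> R),
    [/\ forall i, 0 < p i, \sum_(i < n) p i = 1,
        forall i, 0 < `|r i| < 1 &
        forall A : set (measurableTypeR R), measurable A ->
          mu A = (\sum_(i < n) (p i)%:E *
            pushforward mu
              (fun x : R => (r i * x + t i)%R : measurableTypeR R) A)%E].

Definition non_atomic (R : realType)
    (mu : probability (measurableTypeR R) R) : Prop :=
  forall x : R, mu [set x] = 0%E.

Definition msupport (R : realType) (mu : probability (measurableTypeR R) R) :
    set R :=
  [set x | forall V : set R, open V -> V x -> (0 < mu V)%E].

Definition dotp (R : realType) (n : nat) (u v : 'rV[R]_n) : R :=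
  \sum_(i < n) u ord0 i * v ord0 i.

(* The real and imaginary parts of the integral of exp(2 i pi <xi, x>). *)
Definition fourier (R : realType) (n : nat) (nu : set 'rV[R]_n -> \bar R)
    (xi : 'rV[R]_n) : R[i] :=
  Complex
    (fine (\int[nu]_x (cos (2 * pi * dotp xi x))%:E))
    (fine (\int[nu]_x (sin (2 * pi * dotp xi x))%:E)).

Definition moment_curve (R : realType) (k : nat) (x : measurableTypeR R) :
  'rV[R]_k := \row_(i < k) x ^+ i.+1.

Lemma measurable_moment_curve (R : realType) (k : nat) :
  measurable_fun setT (@moment_curve R k).
Proof.
apply: measurable_fun_rV => i.
rewrite (_ : (fun _ => _) = fun x : R => x ^+ i.+1).
  by apply: measurable_funX; exact: measurable_id.
by apply/funext => x; rewrite mxE.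
Qed.

(* Curves U -> R^n are represented by total functions whose values outside U
   are irrelevant; their restriction by zero is used for pushforwards. *)
Lemma measurable_curve (R : realType) (n : nat) (U : set R)
    (Q : R -> 'rV[R]_n) : open U -> {in U, continuous Q} ->
  measurable_fun [set: measurableTypeR R] (Q \_ U).
Proof.
move=> oU cQ; apply: measurable_fun_rV => i.
rewrite (_ : (fun _ => _) = (fun x => Q x ord0 i) \_ U); last first.
  by apply/funext => x; rewrite /patch; case: ifP => //; rewrite mxE.
apply/measurable_restrict => //; first exact: open_measurable.
rewrite setTI; apply: open_continuous_measurable_fun => // x xU.
apply: (@continuous_comp _ _ _ Q (fun v : 'rV[R]_n => v ord0 i)).
  exact: cQ.
exact: coord_continuous.
Qed.

Section curves.
Variables (R : realType) (n : nat) (U : set R) (Q : R -> 'rV[R]_n).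

(* Continuity of the lower derivatives follows from their derivability. *)
Definition curve_Ck (k : nat) : Prop :=
  (forall j x, (j < k)%N -> U x -> derivable (derive1n j Q) x 1) /\
  (forall x, U x -> {for x, continuous (derive1n k Q)}).

Definition curve_analytic : Prop :=
  forall x0, U x0 -> exists (a : nat -> 'rV[R]_n) (r : R), 0 < r /\
    forall x, `|x - x0| < r ->
      series (fun j => (x - x0) ^+ j *: a j) @ \oo --> Q x.

Definition curve_det (x : R) : R :=
  \det (\matrix_(i < n, j < n) (derive1n j.+1 Q x) ord0 i).

Definition nondegenerate_curve : Prop :=
  curve_Ck n.+1 /\ forall x, U x -> curve_det x != 0.

Definition non_trapped_curve : Prop :=
  curve_analytic /\
  forall a b : R, `[a, b] `<=` U ->
    finite_set [set x | `[a, b]%classic x /\ curve_det x = 0].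

End curves.

Definition graph_curve (R : realType) (m : nat) (g : R -> 'rV[R]_m) (x : R) :
  'rV[R]_(1 + m) := row_mx x%:M (g x).

(* Main.v *)
(** Cut mu into pieces f_w mu of contraction ratio about delta, where
    delta ^ d * |zeta| is slightly less than 1. On each piece the phase
    theta x + <zeta, g x> is, up to a small error, a polynomial of degree d - 1, so
    the contribution of the piece is the Fourier transform H of the pushforward of
    mu to the moment curve, at a frequency eta_w in R^(d-1). By duality
      (sum_w p_w |H(eta_w)|)^2 <= sum_(w,v) p_w p_v |H(eta_w - eta_v)|,
    and theta disappears from eta_w - eta_v when f_w and f_v have the same ratio;
    only polynomially many (in log |zeta|) ratios occur. The L^p hypothesis says
    that |H| is large only on few unit balls of B(C |zeta|). Finally, each unit ball
    receives little mass: the determinant of the curve is at least a power of the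
    distance to its finitely many zeros, so away from them the derivative of
    w |-> eta_w is large, and the w with eta_w in a given ball have their pieces in
    few short intervals, whose mass is controlled by the Frostman property of mu. *)

Require Import Defs.
From mathcomp Require Import all_boot all_order all_algebra.
From mathcomp Require Import all_classical all_reals all_analysis.
From mathcomp Require Import measurable_realfun.
From mathcomp Require Import perm complex.
From mathcomp Require Import ring lra.

Import Order.TTheory GRing.Theory Num.Theory.
Import numFieldNormedType.Exports.

Local Open Scope classical_set_scope.
Local Open Scope ring_scope.

Set Implicit Arguments.
Unset Strict Implicit.
Unset Printing Implicit Defensive.

(** * Bounded measurable functions *)

(** The bound must be uniform in theta, while the frequencies eta_w grow with theta and the
    hypothesis on B(R) costs R^eps. The first coordinate of the graph is the identity, so theta
    enters eta_w only in its first entry, as r_w theta. This is why duality is applied inside one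
    class of equal ratios: there all differences lie in a ball of radius O(|zeta|), whatever theta
    is.

    All quantities are powers of u = |zeta|^(-1/d^2). Let s be the Frostman exponent. Removing
    neighbourhoods of radius u^(s/(8A)) of the zeros of the determinant keeps it above a multiple of
    u^(s/8), and a unit ball of frequencies then receives mass O(u^(3s/4)). The order of the choices
    matters: eps depends on s and d alone, so that R^eps costs u^(-s/4); the hypothesis then
    provides p; only afterwards is the threshold tau fixed, with tau^(p+d-1) = u^(s/4). A factor
    u^(s/4) is left over. *)

Section bounded_measurable.
Context {d} {T : measurableType d} {R : realType}.
Implicit Types f g : T -> R.

(** Boundedness holds at every point, not almost everywhere, so the class is stable under
    composition with the similarities and its members are integrable for any probability. *)
Definition bmeas f := measurable_fun [set: T] f /\ exists M, forall x, `|f x| <= M.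

Lemma bmeas_cst c : bmeas (fun=> c).
Proof. by split; [exact: measurable_cst|exists `|c|]. Qed.

Lemma bmeasD f g : bmeas f -> bmeas g -> bmeas (fun x => f x + g x).
Proof.
move=> [mf [M hM]] [mg [N hN]]; split; first exact: measurable_funD.
by exists (M + N) => x; rewrite (le_trans (ler_normD _ _)) ?lerD.
Qed.

Lemma bmeasM f g : bmeas f -> bmeas g -> bmeas (fun x => f x * g x).
Proof.
move=> [mf [M hM]] [mg [N hN]]; split; first exact: measurable_funM.
by exists (M * N) => x; rewrite normrM ler_pM.
Qed.

Lemma bmeasZ c f : bmeas f -> bmeas (fun x => c * f x).
Proof. by move=> bf; apply: bmeasM => //; exact: bmeas_cst. Qed.

Lemma bmeasB f g : bmeas f -> bmeas g -> bmeas (fun x => f x - g x).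
Proof.
move=> bf bg; apply: bmeasD => //.
rewrite (_ : (fun x => - g x) = (fun x => -1 * g x)); first exact: bmeasZ.
by apply/funext => x; rewrite mulN1r.
Qed.

Lemma bmeas_sum I (s : seq I) (P : pred I) (F : I -> T -> R) :
  (forall i, P i -> bmeas (F i)) -> bmeas (fun x => \sum_(i <- s | P i) F i x).
Proof.
move=> bF; elim: s => [|i s ih].
  rewrite (_ : (fun _ => _) = fun=> 0); first exact: bmeas_cst.
  by apply/funext => x; rewrite big_nil.
case: (boolP (P i)) => Pi; last first.
  by under eq_fun do rewrite big_cons (negbTE Pi).
by under eq_fun do rewrite big_cons Pi; apply: bmeasD => //; exact: bF.
Qed.

Lemma bmeas_indic (A : set T) : measurable A -> bmeas (\1_A).
Proof.
move=> mA; split; first exact: measurable_indic.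
by exists 1 => x; rewrite indicE; case: (_ \in _); rewrite ?normr1 ?normr0.
Qed.

Lemma bmeas_cos f : measurable_fun [set: T] f -> bmeas (fun x => cos (f x)).
Proof.
move=> mf; split; first by apply: measurableT_comp => //;
  apply: continuous_measurable_fun; exact: continuous_cos.
by exists 1 => x; rewrite ler_norml cos_geN1 cos_le1.
Qed.

Lemma bmeas_sin f : measurable_fun [set: T] f -> bmeas (fun x => sin (f x)).
Proof.
move=> mf; split; first by apply: measurableT_comp => //;
  apply: continuous_measurable_fun; exact: continuous_sin.
by exists 1 => x; rewrite ler_norml sin_geN1 sin_le1.
Qed.

Variable mu : probability T R.
Local Notation E f := (\int[mu]_x f x).

Lemma bmeas_integrable f : bmeas f -> mu.-integrable [set: T] (EFin \o f).
Proof.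
move=> [mf [M hM]]; apply: measurable_bounded_integrable => //.
  by rewrite (le_lt_trans (probability_le1 mu measurableT)) ?ltry.
exists M; split; first exact: num_real.
by move=> N MN x _; exact: le_trans (hM x) (ltW MN).
Qed.

Lemma meanD f g : bmeas f -> bmeas g -> E (fun x => f x + g x) = E f + E g.
Proof. by move=> /bmeas_integrable? /bmeas_integrable?; rewrite RintegralD. Qed.

Lemma meanB f g : bmeas f -> bmeas g -> E (fun x => f x - g x) = E f - E g.
Proof. by move=> /bmeas_integrable? /bmeas_integrable?; rewrite RintegralB. Qed.

Lemma meanZ c f : bmeas f -> E (fun x => c * f x) = c * E f.
Proof. by move=> /bmeas_integrable?; rewrite RintegralZl. Qed.

Lemma mean_cst c : E (fun=> c) = c.
Proof. by rewrite Rintegral_cst// [X in fine X](probability_setT mu) mulr1. Qed.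

Lemma mean_sum I (s : seq I) (P : pred I) (F : I -> T -> R) :
  (forall i, P i -> bmeas (F i)) ->
  E (fun x => \sum_(i <- s | P i) F i x) = \sum_(i <- s | P i) E (F i).
Proof.
move=> bF; elim: s => [|i s ih].
  by rewrite big_nil; under eq_Rintegral do rewrite big_nil; rewrite mean_cst.
rewrite big_cons; case: (boolP (P i)) => Pi; last first.
  by under eq_Rintegral do rewrite big_cons (negbTE Pi).
under eq_Rintegral do rewrite big_cons Pi.
by rewrite meanD ?ih//; [exact: bF|exact: bmeas_sum].
Qed.

Lemma mean_indic (A : set T) : measurable A -> E (\1_A) = fine (mu A).
Proof. by move=> mA; rewrite /Rintegral integral_indic// setIT. Qed.

(** The comparison is asked for on a set of full measure only, since later pointwise bounds hold
    just on an interval carrying [mu]. *)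
Lemma mean_le (A : set T) f g : measurable A -> mu A = 1%E ->
  bmeas f -> bmeas g -> (forall x, A x -> f x <= g x) -> E f <= E g.
Proof.
move=> mA muA bf bg fg.
have key h : bmeas h -> E h = \int[mu]_(x in A) h x.
  move=> bh; rewrite /Rintegral (negligible_integral (N := ~` A))//.
  - by rewrite setTD setCK.
  - exact: measurableC.
  - exact: bmeas_integrable.
  - by rewrite [LHS](probability_setC mu)// muA subee.
rewrite key// [leRHS]key//; apply: le_Rintegral => //;
  by apply: integrableS (bmeas_integrable _).
Qed.

Lemma mean_leT f g : bmeas f -> bmeas g -> (forall x, f x <= g x) -> E f <= E g.
Proof. by move=> ? ? h; apply: (@mean_le setT) => //; exact: probability_setT. Qed.

Lemma mean_sqr f : bmeas f -> (E f) ^+ 2 <= E (fun x => f x ^+ 2).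
Proof.
move=> bf; set c := E f.
have b2 : bmeas (fun x => f x ^+ 2).
  by under eq_fun do rewrite expr2; exact: bmeasM.
have : E (fun=> 0) <= E (fun x => (f x ^+ 2 - (2 * c) * f x) + c ^+ 2).
  apply: mean_leT; first exact: bmeas_cst.
    apply: bmeasD; last exact: bmeas_cst.
    by apply: bmeasB => //; exact: bmeasZ.
  move=> x; have -> : f x ^+ 2 - (2 * c) * f x + c ^+ 2 = (f x - c) ^+ 2 by ring.
  exact: sqr_ge0.
rewrite mean_cst meanD ?mean_cst; [|by apply: bmeasB => //; exact: bmeasZ|exact: bmeas_cst].
rewrite meanB//; last exact: bmeasZ.
by rewrite meanZ// -/c; lra.
Qed.

End bounded_measurable.

Lemma normcE (R : realType) (a b : R) :
  Normc.normc (Complex a b) = Num.sqrt (a ^+ 2 + b ^+ 2).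
Proof. by []. Qed.

(** With [normc_ge_dual] this makes the modulus a maximum of real linear forms over the unit disc,
    so complex integrals are estimated through real ones. *)
Lemma normc_dual (R : realType) (a b : R) :
  exists u v : R, u ^+ 2 + v ^+ 2 <= 1 /\ Normc.normc (Complex a b) = u * a + v * b.
Proof.
set N := Normc.normc _.
have N2 : N ^+ 2 = a ^+ 2 + b ^+ 2.
  by rewrite /N normcE sqr_sqrtr// addr_ge0 ?sqr_ge0.
have [N0|N0] := eqVneq N 0.
  by exists 0, 0; rewrite N0 !mul0r addr0 expr0n/= addr0 ler01.
exists (a / N), (b / N); split.
  by rewrite !expr_div_n -mulrDl -N2 divff// sqrf_eq0.
apply: (mulfI N0); rewrite mulrDr -expr2 N2; field.
exact: N0.
Qed.

Lemma normc_ge_dual (R : realType) (a b u v : R) : u ^+ 2 + v ^+ 2 <= 1 ->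
  u * a + v * b <= Normc.normc (Complex a b).
Proof.
move=> uv; rewrite normcE.
apply: le_trans (ler_norm _) _; rewrite -sqrtr_sqr ler_wsqrtr//.
rewrite (@le_trans _ _ ((u ^+ 2 + v ^+ 2) * (a ^+ 2 + b ^+ 2)))//.
  rewrite -subr_ge0.
  have -> : (u ^+ 2 + v ^+ 2) * (a ^+ 2 + b ^+ 2) - (u * a + v * b) ^+ 2
    = (u * b - v * a) ^+ 2 by ring.
  exact: sqr_ge0.
by rewrite ler_piMl// addr_ge0 ?sqr_ge0.
Qed.

(** * Iterating the self-similarity relation *)

Lemma measurable_affine (R : realType) (r t : R) :
  measurable_fun [set: measurableTypeR R]
    (fun x : R => r * x + t : measurableTypeR R).
Proof.
apply: measurable_funD; last exact: measurable_cst.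
by apply: measurable_funM; [exact: measurable_cst|exact: measurable_id].
Qed.

Lemma bernoulli_ge (R : realType) (x : R) k : 0 <= x -> 1 + k%:R * x <= (1 + x) ^+ k.
Proof.
move=> x0; elim: k => [|k ih]; first by rewrite mul0r addr0 expr0.
rewrite exprS; apply: (@le_trans _ _ ((1 + x) * (1 + k%:R * x))).
  rewrite -natr1; have : 0 <= k%:R * x * x by rewrite !mulr_ge0. lra.
by apply: ler_wpM2l => //; rewrite addr_ge0.
Qed.

Lemma nat_gt (R : realType) (x : R) : exists N : nat, x < N%:R.
Proof. by exists (Num.trunc x).+1; exact: truncnS_gt. Qed.

Lemma expr_unbounded (R : realType) (B M : R) : 1 < B -> exists k : nat, M <= B ^+ k.
Proof.
move=> B1; have b0 : 0 < B - 1 by rewrite subr_gt0.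
have [N hN] := nat_gt (M / (B - 1)); exists N.
have := @bernoulli_ge _ (B - 1) N (ltW b0); have -> : 1 + (B - 1) = B by ring.
apply: le_trans.
by rewrite ler_wpDl// -ler_pdivrMr// ltW.
Qed.

Section words.
Variable R : realType.
Implicit Types (w : R * R * R) (W : seq (R * R * R)).

(* A word is the triple (p, r, t) standing for the weighted map p (x |-> r x + t). *)
Definition wp w : R := w.1.1.
Definition wr w : R := w.1.2.
Definition wt w : R := w.2.
Definition wmap w (x : measurableTypeR R) : measurableTypeR R :=
  wr w * x + wt w.

Lemma measurable_wmap w : measurable_fun setT (wmap w).
Proof. exact: measurable_affine. Qed.

Lemma bmeas_wmap (f : measurableTypeR R -> R) w :
  bmeas f -> bmeas (fun x => f (wmap w x)).
Proof.
move=> [mf [M hM]]; split.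
  exact: (measurableT_comp mf (measurable_wmap w)).
by exists M.
Qed.

Variable mu : probability (measurableTypeR R) R.

Definition decomposes W :=
  [/\ forall w, w \in W -> 0 < wp w, \sum_(w <- W) wp w = 1 &
      forall f, bmeas f ->
        \int[mu]_x f x = \sum_(w <- W) wp w * \int[mu]_x f (wmap w x)].

Lemma self_similar_integral n (p r t : 'I_n -> R) :
  (forall i, 0 < p i) -> \sum_(i < n) p i = 1 ->
  (forall A : set (measurableTypeR R), measurable A ->
          mu A = (\sum_(i < n) (p i)%:E *
            pushforward mu
              (fun x : R => (r i * x + t i)%R : measurableTypeR R) A)%E) ->
  forall f : measurableTypeR R -> R, bmeas f ->
  \int[mu]_x f x = \sum_(i < n) p i * \int[mu]_x f (r i * x + t i).
Proof.
move=> p0 p1 muE.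
case: n p r t p0 p1 muE => [|n] p r t p0 p1 muE.
  by move: p1; rewrite big_ord0 => /esym/eqP; rewrite oner_eq0.
pose F i := wmap (p i, r i, t i).
(* [msum] runs over a sequence indexed by [nat]; [inord] turns the index into a branch, which is why
   [n = 0] was excluded. *)
pose m_ (k : nat) : {measure set (measurableTypeR R) -> \bar R} :=
  mscale (NngNum (ltW (p0 (inord k))))
    (distribution mu (mfun_Sub (mem_set (measurable_wmap (p (inord k), r (inord k), t (inord k)))))).
have pos (f : measurableTypeR R -> R) : bmeas f -> (forall x, 0 <= f x) ->
    \int[mu]_x f x = \sum_(i < n.+1) p i * \int[mu]_x f (r i * x + t i).
  move=> bf f0.
  have mf : measurable_fun setT (EFin \o f) by apply/measurable_EFinP; case: bf.
  have e1 : (\int[mu]_x (f x)%:E = \int[msum m_ n.+1]_x (f x)%:E)%E.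
    apply: eq_measure_integral => A mA _.
    rewrite [LHS]muE// /= /msum; apply: eq_bigr => i _.
    by rewrite /m_ /mscale/= /distribution /pushforward inord_val.
  have e2 (i : 'I_n.+1) : (\int[m_ i]_x (f x)%:E =
      (p i * \int[mu]_x f (r i * x + t i))%:E)%E.
    rewrite /m_ ge0_integral_mscale//; last by move=> x _; rewrite lee_fin.
    rewrite inord_val EFinM; congr (_ * _)%E.
    rewrite ge0_integral_distribution//.
    rewrite /Rintegral fineK//; apply: integrable_fin_num => //.
    exact: (bmeas_integrable mu (bmeas_wmap (p i, r i, t i) bf)).
  rewrite /Rintegral e1 ge0_integral_measure_sum//; last first.
    by move=> x _; rewrite lee_fin.
  under eq_bigr do rewrite e2.
  by rewrite sumEFin.
move=> f [mf [M hM]].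
have bf : bmeas f by split => //; exists M.
(* Adding the bound [M] gives a nonnegative function; [M] cancels at the end because the weights add
   up to 1. *)
have bM : bmeas (fun x : measurableTypeR R => f x + M).
  by apply: bmeasD => //; exact: bmeas_cst.
have := pos _ bM (fun x => _).
rewrite meanD//; last exact: bmeas_cst.
rewrite mean_cst.
under eq_bigr => i _.
  rewrite (meanD mu (bmeas_wmap (p i, r i, t i) bf) (bmeas_cst M)) mean_cst mulrDr.
  over.
rewrite big_split/= -mulr_suml p1 mul1r => h.
apply: (addIr M); apply: h => x.
by have := hM x; rewrite ler_norml => /andP[+ _]; lra.
Qed.


Lemma ord_max_lt1 n (f : 'I_n -> R) : (forall i, f i < 1) ->
  exists2 lam : R, 0 < lam < 1 & forall i, f i <= lam.
Proof.
(* The seed [2^-1] makes [lam] positive even if there is no index. *)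
move=> f1; exists (\big[Num.max/2^-1]_(i < n) f i); last first.
  by move=> i; exact: le_bigmax.
rewrite (lt_le_trans _ (bigmax_ge_id _ _ _ _)) ?invr_gt0//=.
by rewrite bigmax_lt// invf_lt1// ltr1n.
Qed.

Lemma ord_min_gt0 n (f : 'I_n -> R) : (forall i, 0 < f i) ->
  exists2 rmin : R, 0 < rmin <= 1 & forall i, rmin <= f i.
Proof.
move=> f0; exists (\big[Num.min/1]_(i < n) f i); last first.
  by move=> i; exact: bigmin_le.
by rewrite lt_bigmin//= bigmin_le_id.
Qed.

Lemma measurable_norm_gt (M : R) :
  measurable [set x : measurableTypeR R | M < `|x|].
Proof.
have -> : [set x : measurableTypeR R | M < `|x|] =
    ((fun x : R => `|x|) @^-1` `]M, +oo[%classic).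
  by apply/seteqP; split => x /=; rewrite in_itv/= andbT.
rewrite -[X in measurable X]setTI; exact: normr_measurable.
Qed.

Lemma measure_norm_gt_small (e : R) : 0 < e ->
  exists N : nat, fine (mu [set x : measurableTypeR R | N%:R < `|x|]) < e.
Proof.
move=> e0; pose F (n : nat) := [set x : measurableTypeR R | n%:R < `|x|].
have F0 : \bigcap_n F n = set0.
  apply/seteqP; split => // x /= Fx.
  have [N hN] := nat_gt `|x|; have := Fx N Logic.I; rewrite /F/=.
  by rewrite ltNge (ltW hN).
have cv : mu (F n) @[n --> \oo] --> 0%E.
  rewrite -(measure0 mu) -F0; apply: nonincreasing_cvg_mu.
  - by rewrite (le_lt_trans (probability_le1 mu (measurable_norm_gt _))) ?ltry.
  - by move=> n; exact: measurable_norm_gt.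
  - by rewrite F0.
  - by move=> m n mn; apply/subsetPset => x /=; apply: le_lt_trans; rewrite ler_nat.
have /fine_cvgP[_ /cvgrPdist_lt/(_ _ e0)[N _ /(_ N (leqnn N))]] := cv.
rewrite sub0r normrN /= ger0_norm ?fine_ge0// => h.
by exists N.
Qed.

(** With lam L0 + T = L0, a point sent beyond L0 + x by some branch already lies beyond L0 + x /
    lam. So the tail at x is at most the tail at x / lam, and by iteration it is at most a limit of
    tails, which is 0. *)
Lemma self_similar_bounded : self_similar mu ->
  exists2 L : R, 1 <= L & mu [set x | `|x| <= L] = 1%E.
Proof.
move=> [n [p [r [t [p0 p1 r01 muE]]]]].
have [lam /andP[lam0 lam1] hlam] := ord_max_lt1 (fun i => (andP (r01 i)).2).
pose T := \big[Num.max/0]_(i < n) `|t i|.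
have hT i : `|t i| <= T by exact: le_bigmax.
have T0 : 0 <= T by exact: bigmax_ge_id.
pose L0 := T / (1 - lam).
have L00 : 0 <= L0 by rewrite divr_ge0// subr_ge0 ltW.
have L0E : T = L0 - lam * L0.
  by rewrite /L0; field; rewrite subr_eq0 gt_eqF.
pose A x := [set y : measurableTypeR R | L0 + x < `|y|].
have mA x : measurable (A x) by exact: measurable_norm_gt.
have step x : fine (mu (A x)) <= fine (mu (A (x / lam))).
  rewrite -mean_indic// (self_similar_integral p0 p1 muE); last exact: bmeas_indic.
  rewrite -mean_indic// -[leRHS]mul1r -p1 mulr_suml; apply: ler_sum => i _.
  apply: ler_wpM2l; first exact: ltW.
  apply: mean_leT.
  - exact: (bmeas_wmap (p i, r i, t i) (bmeas_indic (mA x))).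
  - exact: bmeas_indic.
  move=> y; rewrite !indicE ler_nat.
  case: (boolP (_ \in A x)) => // /[!inE] yA.
  rewrite mem_set//; move: yA; rewrite /A /= => yA.
  have {}yA : L0 + x < lam * `|y| + T.
    rewrite (lt_le_trans yA)// (le_trans (ler_normD _ _))// lerD//.
    by rewrite normrM ler_wpM2r.
  have e : lam * (L0 + x / lam) = lam * L0 + x by field; rewrite gt_eqF.
  rewrite -(ltr_pM2l lam0) e.
  move: yA; rewrite L0E; lra.
have iter k : fine (mu (A 1)) <= fine (mu (A (lam^-1 ^+ k))).
  elim: k => [|k ih]; first by rewrite expr0.
  by rewrite (le_trans ih)// (le_trans (step _))// exprSr.
have A0 : fine (mu (A 1)) = 0.
  apply/eqP; rewrite eq_le fine_ge0// andbT leNgt; apply/negP => /measure_norm_gt_small[N].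
  rewrite ltNge => /negP; apply.
  have [k hk] : exists k : nat, N%:R <= lam^-1 ^+ k.
    by apply: expr_unbounded; rewrite invf_gt1.
  rewrite (le_trans (iter k))// fine_le ?fin_num_measure//; [exact: measurable_norm_gt|].
  apply: le_measure; rewrite ?inE//; first exact: measurable_norm_gt.
  by move=> x; rewrite /A/= => h; rewrite (le_lt_trans _ h)// (le_trans hk)// lerDr.
exists (L0 + 1); first by rewrite lerDr.
have -> : [set x : R | `|x| <= L0 + 1] = ~` A 1.
  by apply/seteqP; split => x; rewrite /A/=; [move=> h; apply/negP; rewrite -leNgt|move/negP; rewrite -leNgt].
rewrite [LHS](probability_setC mu)//.
have -> : mu (A 1) = 0%E by rewrite -[mu _]fineK ?fin_num_measure// A0.
by rewrite sube0.
Qed.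

(* The ratios occurring at generation [k] are products of powers of the [n] base
   ratios with exponents at most [k], so there are only polynomially many. *)
Lemma self_similar_decomposes : self_similar mu ->
  exists (n : nat) (lam rmin : R), [/\ 0 < lam < 1, 0 < rmin <= 1 &
    forall k, exists W (rs : seq R), [/\ decomposes W, (size rs <= k.+1 ^ n)%N &
      forall w, w \in W ->
        [/\ wr w \in rs, rmin * lam ^+ k <= `|wr w| & `|wr w| <= lam ^+ k]]].
Proof.
move=> [n [p [r [t [p0 p1 r01 muE]]]]].
have [lam /andP[lam0 lam1] hlam] := ord_max_lt1 (fun i => (andP (r01 i)).2).
have [rmin /andP[rmin0 rmin1] hrmin] := ord_min_gt0 (fun i => (andP (r01 i)).1).
exists n, lam, rmin; split; rewrite ?lam0 ?rmin0// => k.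
suff [W [dW hW]] : exists W, decomposes W /\ forall w, w \in W ->
    [/\ exists e : 'I_n -> nat, (forall i, (e i <= k)%N) /\ wr w = \prod_i r i ^+ e i,
        rmin * lam ^+ k <= `|wr w| & `|wr w| <= lam ^+ k].
  exists W, [seq \prod_i r i ^+ (e i) | e : {ffun 'I_n -> 'I_k.+1}].
  split=> //; first by rewrite size_map -cardE card_ffun !card_ord.
  move=> w /hW[[e [ek ->]] ? ?]; split=> //.
  apply/mapP; exists [ffun i => inord (e i) : 'I_k.+1]; first by rewrite mem_enum.
  by apply: eq_bigr => i _; rewrite ffunE inordK// ltnS.
elim: k => [|k [W [[W0 W1 WE] hW]]].
  exists [:: (1, 1, 0)]; split.
    split; first by move=> w /[!inE]/eqP->; rewrite /wp/=.
      by rewrite big_seq1.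
    move=> f bf; rewrite big_seq1 /wp/= mul1r.
    by apply: eq_Rintegral => x _; rewrite /wmap/wr/wt/= mul1r addr0.
  move=> w /[!inE]/eqP->; rewrite /wr/= expr0 normr1 mulr1; split=> //.
  exists (fun=> 0%N); split=> //.
  by rewrite big1.
pose split_word w i := (wp w * p i, wr w * r i, wr w * t i + wt w).
(* Only words whose ratio still exceeds lam^(k+1) are split. One split suffices, since every base
   ratio is at most lam, and it cannot go below rmin lam^(k+1). At most one letter is added per
   generation, which bounds the exponents by k. *)
pose next w := if `|wr w| <= lam ^+ k.+1 then [:: w] else
  [seq split_word w i | i <- enum 'I_n].
exists (flatten [seq next w | w <- W]); split; first split.
- move=> w /flattenP[s /mapP[v vW ->]]; rewrite /next; case: ifP => _.
    by rewrite inE => /eqP->; exact: W0.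
  by move=> /mapP[i _ ->]; rewrite /wp/= mulr_gt0//; exact: W0.
- rewrite big_flatten/= big_map -[RHS]W1; apply: eq_bigr => w _.
  rewrite /next; case: ifP => _; first by rewrite big_seq1.
  by rewrite big_map big_enum/= -mulr_sumr p1 mulr1.
- move=> f bf; rewrite WE// big_flatten/= big_map; apply: eq_bigr => w _.
  rewrite /next; case: ifP => _; first by rewrite big_seq1.
  rewrite big_map big_enum/= (self_similar_integral p0 p1 muE); last exact: bmeas_wmap.
  rewrite mulr_sumr; apply: eq_bigr => i _.
  rewrite /wp/= mulrA; congr (_ * _); apply: eq_Rintegral => x _.
  by congr (f _); rewrite /wmap/wr/wt/=; ring.
- move=> w /flattenP[s /mapP[v vW ->]].
  have [[e [ek eE]] v1 v2] := hW _ vW.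
  rewrite /next; case: ifPn => [h|].
    rewrite inE => /eqP->; split=> //.
      by exists e; split=> // i; rewrite leqW.
    by apply: le_trans v1; rewrite ler_wpM2l ?(ltW rmin0)// exprS ler_piMl ?exprn_ge0 ?ltW.
  rewrite -ltNge => h /mapP[i _ ->]; rewrite /wr/= -!/(wr _); split.
  - exists (fun j => e j + (j == i))%N; split.
      by move=> j; case: (j == i); rewrite ?addn1 ?addn0 ?ltnS// leqW.
    rewrite eE; under [RHS]eq_bigr do rewrite exprD; rewrite big_split/=; congr (_ * _).
    rewrite (bigD1 i)//= eqxx expr1 big1 ?mulr1// => j /negbTE ->.
    by rewrite expr0.
  - by rewrite normrM mulrC ler_pM// ?(ltW rmin0) ?exprn_ge0// ltW.
  - by rewrite normrM exprSr ler_pM.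
Qed.

End words.

(** * Frostman exponent *)

Lemma interval_finite_subcover (R : realType) (M : R) (rho : R -> R) :
  (forall x, 0 < rho x) ->
  exists s : seq R, forall x, `|x| <= M -> exists2 y, y \in s & `|x - y| < rho y.
Proof.
move=> rho0; have := @segment_compact R (- M) M; rewrite compact_cover.
move=> /(_ R setT (fun y => ball y (rho y))) [].
- by move=> y _; exact: ball_open.
- by move=> x _; exists x => //; exact: ballxx.
move=> D _ hD; exists (finmap.enum_fset D) => x xM.
have /hD[y yD] : `[- M, M]%classic x by rewrite /= in_itv/= -ler_norml.
by rewrite /ball/= distrC => xy; exists y.
Qed.

Lemma seq_lower_bound (T : eqType) (R : realType) (s : seq T) (f : T -> R) :
  (forall x, 0 < f x) -> exists2 r : R, 0 < r & forall x, x \in s -> r <= f x.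
Proof.
move=> f0; elim: s => [|y s [r r0 h]]; first by exists 1.
exists (Num.min (f y) r); first by rewrite lt_min f0.
move=> x /[!inE] /predU1P[->|/h]; first by rewrite ge_min lexx.
by rewrite ge_min => ->; rewrite orbT.
Qed.

Lemma dist_tri (R : realType) (x y z : R) : `|x - z| <= `|x - y| + `|y - z|.
Proof. exact: ler_distD. Qed.

Section mass.
Variables (R : realType) (mu : probability (measurableTypeR R) R) (L : R).
Hypothesis L1 : 1 <= L.
Hypothesis muL : mu [set x | `|x| <= L] = 1%E.

Definition cball (x r : R) : set (measurableTypeR R) := [set y | `|(y : R) - x| <= r].

Lemma measurable_cball x r : measurable (cball x r).
Proof.
have -> : cball x r = ~` ((fun y : measurableTypeR R => 1 * y + - x) @^-1`
    [set y | r < `|y|]).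
  apply/seteqP; split => y; rewrite /cball/= mul1r.
    by move=> h; apply/negP; rewrite -leNgt.
  by move/negP; rewrite -leNgt.
apply: measurableC; rewrite -[X in measurable X]setTI.
by apply: measurable_affine => //; exact: measurable_norm_gt.
Qed.

Definition pr (A : set (measurableTypeR R)) : R := fine (mu A).

Lemma pr_ge0 A : 0 <= pr A. Proof. exact: fine_ge0. Qed.

Lemma pr_le1 A : measurable A -> pr A <= 1.
Proof.
move=> mA; have := probability_le1 mu mA.
by rewrite -(fineK (fin_num_measure mu _ mA)) lee_fin.
Qed.

Lemma le_pr A B : measurable A -> measurable B -> A `<=` B -> pr A <= pr B.
Proof.
move=> mA mB AB; rewrite /pr fine_le ?fin_num_measure// le_measure ?inE//.
Qed.

Lemma measurable_le_norm : measurable [set x : measurableTypeR R | `|x| <= L].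
Proof.
have -> : [set x : measurableTypeR R | `|x| <= L] = cball 0 L.
  by apply/seteqP; split => x; rewrite /cball/= subr0.
exact: measurable_cball.
Qed.

Lemma mean_le_supp (f g : measurableTypeR R -> R) : bmeas f -> bmeas g ->
  (forall x, `|x| <= L -> f x <= g x) -> \int[mu]_x f x <= \int[mu]_x g x.
Proof. by move=> bf bg fg; exact: (mean_le measurable_le_norm muL). Qed.

(** A piece carried into [A] gives its full weight to the integral of the indicator of [A]. *)
Lemma word_mass W (P : pred (R * R * R)) A : decomposes mu W -> measurable A ->
  (forall w x, w \in W -> P w -> `|x| <= L -> A (wmap w x)) ->
  \sum_(w <- W | P w) wp w <= pr A.
Proof.
move=> [W0 W1 WE] mA hA; rewrite /pr -mean_indic// WE; last exact: bmeas_indic.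
rewrite big_mkcond/= big_seq [leRHS]big_seq; apply: ler_sum => w wW.
have b := bmeas_wmap w (bmeas_indic mA).
case: ifPn => Pw; last first.
  by rewrite mulr_ge0 ?(ltW (W0 _ wW))// Rintegral_ge0// => x _; rewrite indicE.
rewrite -[leLHS]mulr1 ler_wpM2l ?(ltW (W0 _ wW))//.
rewrite -{1}(mean_cst mu 1); apply: mean_le_supp => //; first exact: bmeas_cst.
by move=> x xL; rewrite indicE mem_set//; exact: hA.
Qed.

Lemma wmap_dist w (x : R) : `|x| <= L -> `|wmap w x - wt w| <= L * `|wr w|.
Proof. by move=> xL; rewrite /wmap addrK normrM mulrC ler_wpM2r. Qed.

Lemma word_mass_ball W delta x rho : decomposes mu W ->
  (forall w, w \in W -> `|wr w| <= delta) ->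
  \sum_(w <- W | `|wt w - x| <= rho) wp w <= pr (cball x (rho + L * delta)).
Proof.
move=> dW hd; apply: word_mass => //; first exact: measurable_cball.
move=> w y wW h yL; rewrite /cball/=.
rewrite -(subrKA (wt w)) addrC (le_trans (ler_normD _ _))// lerD//.
by rewrite (le_trans (wmap_dist _ yL))// ler_wpM2l ?hd// (le_trans ler01).
Qed.

(** The centre [wt w] is the image of 0 and may lie off the support; positive mass nearby is what
    ties it to the support. *)
Lemma word_ball_gt0 W w : decomposes mu W -> w \in W ->
  0 < pr (cball (wt w) (L * `|wr w|)).
Proof.
move=> dW wW; have [W0 _ _] := dW.
apply: lt_le_trans (@word_mass W (pred1 w) _ dW (measurable_cball _ _) _); last first.
  by move=> _ x _ /eqP-> xL; exact: wmap_dist.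
rewrite big_mkcond/= (perm_big _ (perm_to_rem wW))/= big_cons eqxx.
rewrite ltr_wpDr ?W0// -big_mkcond/= sumr_ge0// => v /eqP->.
exact/ltW/W0.
Qed.

Hypothesis mu_na : non_atomic mu.

Lemma non_atomic_small x (e : R) : 0 < e ->
  exists2 r : R, 0 < r & pr (cball x r) <= e.
Proof.
move=> e0; pose F (n : nat) := cball x n.+1%:R^-1.
have F0 : \bigcap_n F n = [set x].
  apply/seteqP; split => [y Fy|y -> n _]; last first.
    by rewrite /F/cball/= subrr normr0 invr_ge0.
  apply/eqP; apply: contraT; rewrite -subr_eq0 -normr_gt0 => d0.
  have [N hN] := nat_gt `|y - x|^-1.
  have := Fy N Logic.I; rewrite /F/cball/= leNgt => /negP[].
  rewrite invf_plt ?posrE ?ltr0Sn//.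
  by rewrite (lt_trans hN)// ltr_nat.
have cv : mu (F n) @[n --> \oo] --> 0%E.
  rewrite -(mu_na x) -F0; apply: nonincreasing_cvg_mu.
  - by rewrite (le_lt_trans (probability_le1 mu (measurable_cball _ _))) ?ltry.
  - by move=> n; exact: measurable_cball.
  - rewrite F0; exact: measurable_set1.
  - move=> m n mn; apply/subsetPset => y /=; rewrite /F/cball/= => /le_trans; apply.
    by rewrite lef_pV2 ?posrE ?ltr0Sn// ler_nat ltnS.
have /fine_cvgP[_ /cvgrPdist_lt/(_ _ e0)[N _ /(_ N (leqnn N))]] := cv.
rewrite sub0r normrN /= ger0_norm ?fine_ge0// => h.
by exists (N.+1%:R^-1); [rewrite invr_gt0|exact: ltW].
Qed.

(** Compactness makes the radius uniform for centres in [-L-1, L+1]; balls of radius at most 1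
    centred elsewhere miss [-L, L] and are null. *)
Lemma non_atomic_uniform : exists2 r : R, 0 < r & forall x, pr (cball x r) <= 2^-1.
Proof.
have h0 : 0 < 2^-1 :> R by rewrite invr_gt0.
have /choice[rho hrho] : forall x, exists r : R, 0 < r /\ pr (cball x r) <= 2^-1.
  by move=> x; have [r ? ?] := non_atomic_small x h0; exists r.
have [|s hs] := @interval_finite_subcover R (L + 1) (fun x => rho x / 2).
  by move=> x; rewrite divr_gt0//; case: (hrho x).
have [|r r0 hr] := @seq_lower_bound _ _ s (fun x => rho x / 2).
  by move=> x; rewrite divr_gt0//; case: (hrho x).
exists (Num.min r 1); first by rewrite lt_min r0 ltr01.
move=> x; have [xL|xL] := leP `|x| (L + 1).
  have [y ys xy] := hs _ xL.
  apply: le_trans (proj2 (hrho y)).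
  apply: le_pr; [exact: measurable_cball..|].
  move=> z; rewrite /cball/= le_min => /andP[zr _].
  have {}zr : `|(z : R) - x| <= r := zr.
  have := hr _ ys; have := dist_tri (z : R) x y; lra.
apply: le_trans (ltW h0).
have -> : pr (cball x (Num.min r 1)) <= 0 = (pr (cball x (Num.min r 1)) <= pr (~` [set x : measurableTypeR R | `|x| <= L])).
  by congr (_ <= _); rewrite /pr (probability_setC mu measurable_le_norm) muL subee.
apply: le_pr; [exact: measurable_cball|exact: measurableC measurable_le_norm|].
move=> z; rewrite /cball/= le_min => /andP[_ zx]; apply/negP; rewrite -ltNge.
have {}zx : `|(z : R) - x| <= 1 := zx.
have := dist_tri (x : R) z 0; rewrite !subr0 (distrC x); lra.
Qed.

(** The largest mass of a ball of small radius rho is at most half of the one at radius rho / a: the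
    pieces meeting the ball have total weight at most 1/2 by [non_atomic_uniform], and pulled back
    to each piece the ball has radius at most rho / a. The exponent solves a^s = 1/2. *)
Lemma frostman : self_similar mu ->
  exists s C : R, [/\ 0 < s <= 1, 0 < C &
    forall x rho, 0 < rho -> pr (cball x rho) <= C * rho `^ s].
Proof.
move=> /self_similar_decomposes[n [lam [rmin [/andP[lam0 lam1] /andP[rm0 rm1] hW]]]].
have [r0 r00 hr0] := non_atomic_uniform.
have L0 : 0 < L by rewrite (lt_le_trans ltr01).
(* Makes the pieces so short that those meeting a ball of radius at most [r0 / 2] lie in the
   concentric ball of radius [r0]. *)
have [k hk] : exists k, 4 * L / r0 <= lam^-1 ^+ k.
  by apply: expr_unbounded; rewrite invf_gt1.
have [W [rs [dW _ Wr]]] := hW k.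
set del := lam ^+ k.
have del0 : 0 < del by rewrite exprn_gt0.
have del1 : del <= 1 by rewrite exprn_ile1// ltW.
have hdel : 2 * L * del <= r0 / 2.
  by move: hk; rewrite exprVn -/del ler_pdivrMr// ler_pdivlMl//; lra.
(* The rescaling would allow [rmin * del]; halving it gives [a <= 2^-1], hence [s <= 1]. *)
pose a := rmin * del / 2.
have a0 : 0 < a by rewrite divr_gt0// mulr_gt0.
have a12 : a <= 2^-1.
  by rewrite /a -[leRHS]mul1r ler_wpM2r ?invr_ge0// mulr_ile1// ltW.
have a1 : a < 1 by rewrite (le_lt_trans a12)// invf_lt1// ltr1n.
pose r1 := r0 / 2.
have r10 : 0 < r1 by rewrite divr_gt0.
have step x rho S : 0 <= rho -> rho <= r1 -> (forall y, pr (cball y (rho / a)) <= S) ->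
    pr (cball x rho) <= 2^-1 * S.
  move=> rho0 hrho hS.
  have S0 : 0 <= S := le_trans (pr_ge0 _) (hS 0).
  have [W0 _ WE] := dW.
  rewrite /pr -mean_indic; last exact: measurable_cball.
  rewrite WE; last exact: (bmeas_indic (measurable_cball _ _)).
  apply: (@le_trans _ _ (\sum_(w <- W | `|wt w - x| <= rho + L * del) wp w * S)).
    rewrite [leRHS]big_mkcond/= big_seq [leRHS]big_seq; apply: ler_sum => w wW.
    have [_ wr1 wr2] := Wr _ wW.
    have wr0 : 0 < `|wr w| by apply: lt_le_trans wr1; rewrite mulr_gt0.
    have wrn : wr w != 0 by rewrite -normr_gt0.
    have b := bmeas_wmap w (bmeas_indic (measurable_cball x rho)).
    case: ifPn => hw.
      apply: ler_wpM2l; first exact/ltW/W0.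
      apply: le_trans (hS ((x - wt w) / wr w)).
      rewrite /pr -mean_indic; last exact: measurable_cball.
      apply: mean_leT => //; first exact: (bmeas_indic (measurable_cball _ _)).
      move=> y; rewrite !indicE ler_nat.
      case: (boolP (_ \in cball x rho)) => //; rewrite inE /cball/= /wmap => yx.
      rewrite mem_set//=.
      have -> : y - (x - wt w) / wr w = (wr w * y + wt w - x) / wr w.
        by field.
      rewrite normrM normfV; apply: ler_pM => //.
      rewrite lef_pV2 ?posrE//; apply: le_trans wr1.
      rewrite /a -/del; have : 0 < rmin * del by rewrite mulr_gt0.
      lra.
    have {}hw : rho + L * del < `|wt w - x| by rewrite ltNge.
    apply: mulr_ge0_le0; first exact/ltW/W0.
    rewrite -[leRHS](mean_cst mu); apply: mean_le_supp => //; first exact: bmeas_cst.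
    move=> y yL; rewrite indicE memNset//= /cball/= => yx.
    have {}yx : `|(wmap w y : R) - x| <= rho := yx.
    have h1 : `|(wmap w y : R) - wt w| <= L * del.
      by rewrite (le_trans (wmap_dist _ yL))// ler_wpM2l// ltW.
    have := dist_tri (wt w) (wmap w y : R) x; rewrite (distrC (wt w) (wmap w y : R)); lra.
  rewrite -mulr_suml ler_wpM2r//.
  apply: le_trans (hr0 x).
  apply: le_trans (word_mass_ball x _ dW _) _.
    by move=> w /Wr[_ _]; exact.
  apply: le_pr; [exact: measurable_cball..|].
  move=> z; rewrite /cball/= => /le_trans; apply.
  have h : rho + L * del + L * del <= r0 by rewrite /r1 in hrho; lra.
  exact: h.
have iter j : forall x, pr (cball x (r1 * a ^+ j)) <= 2^-1 ^+ j.
  elim: j => [|j ih] x; first by rewrite expr0; exact: (pr_le1 (measurable_cball _ _)).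
  rewrite [leRHS]exprS; apply: step.
  - by rewrite mulr_ge0 ?exprn_ge0// ltW.
  - by rewrite ler_piMr ?ltW// exprn_ilt1// ltW.
  - by rewrite exprSr mulrA mulfK ?gt_eqF.
pose s := ln 2 / - ln a.
have lna : ln 2 <= - ln a.
  by rewrite -lnV ?posrE// ler_ln ?posrE ?invr_gt0// -[leLHS]invrK lef_pV2 ?posrE// ?invr_gt0.
have ln2 : 0 < ln 2 :> R by rewrite ln_gt0// ltr1n.
have lna0 : 0 < - ln a by exact: lt_le_trans lna.
have s01 : 0 < s <= 1 by rewrite /s divr_gt0//= ler_pdivrMr// mul1r.
have as2 : a `^ s = 2^-1.
  rewrite /powR gt_eqF// /s.
  have -> : ln 2 / - ln a * ln a = - ln 2.
    by field; rewrite -oppr_eq0 gt_eqF.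
  by rewrite expRN lnK// posrE.
exists s, (2 * r1 `^ (- s)); split=> //.
  by rewrite mulr_gt0// powR_gt0.
move=> x rho rho0.
have [s0 s1] := andP s01.
have C0 : r1 `^ s * r1 `^ (- s) = 1.
  by rewrite -powRD ?subrr ?powRr0// (gt_eqF r10) implybT.
have u0 : 0 < r1 `^ (- s) by rewrite powR_gt0.
have [hrho|hrho] := leP r1 rho.
  apply: le_trans (pr_le1 (measurable_cball _ _)) _.
  have h : r1 `^ s <= rho `^ s by rewrite ge0_ler_powR// ?nnegrE ltW.
  have := ler_wpM2r (ltW u0) h; rewrite C0.
  have : 0 <= rho `^ s * r1 `^ (- s) by rewrite mulr_ge0 ?powR_ge0.
  lra.
have [j [j1 j2]] : exists j, r1 * a ^+ j.+1 < rho /\ rho <= r1 * a ^+ j.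
  have ex : exists j, r1 * a ^+ j.+1 < rho.
    have [|N] := @expr_unbounded R a^-1 (r1 / rho); first by rewrite invf_gt1.
    rewrite exprVn ler_pdivrMr// ler_pdivlMl ?exprn_gt0// => hN.
    exists N; apply: lt_le_trans hN.
    by rewrite mulrC ltr_pM2r// exprS gtr_pMl// exprn_gt0.
  exists (ex_minn ex); case: ex_minnP => j j1 jmin; split=> //.
  case: j j1 jmin => [|j] _ jmin; first by rewrite expr0 mulr1 ltW.
  by rewrite leNgt; apply/negP => /jmin; rewrite ltnn.
apply: (@le_trans _ _ (2^-1 ^+ j)).
  apply: le_trans (iter j x); apply: le_pr; [exact: measurable_cball..|].
  by move=> z /le_trans; exact.
apply: (@le_trans _ _ (2 * r1 `^ (- s) * (r1 * a ^+ j.+1) `^ s)); last first.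
  apply: ler_wpM2l; first by rewrite mulr_ge0 ?powR_ge0.
  by rewrite ge0_ler_powR ?nnegrE ?ltW// ?mulr_gt0 ?exprn_gt0.
rewrite powRM ?exprn_ge0 ?(ltW r10) ?(ltW a0)//.
have -> : (a ^+ j.+1) `^ s = 2^-1 ^+ j.+1.
  by rewrite -powR_mulrn ?ltW// -powRrM mulrC powRrM powR_mulrn ?powR_ge0// as2.
have -> : 2 * r1 `^ (- s) * (r1 `^ s * 2^-1 ^+ j.+1) =
   (r1 `^ s * r1 `^ (- s)) * 2^-1 ^+ j by rewrite exprS; field.
by rewrite C0 mul1r.
Qed.

End mass.

(** * Characteristic functions and duality *)

Lemma mvt_ball (R : realType) (f df : R -> R) (x y : R) :
  (forall z, `|z - x| <= `|y - x| -> is_derive z 1 f (df z)) ->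
  exists2 c : R, `|c - x| <= `|y - x| & f y - f x = df c * (y - x).
Proof.
move=> fdf.
have cf a b : (forall z, z \in `[a, b] -> `|z - x| <= `|y - x|) ->
    {within `[a, b], continuous f}.
  move=> h; apply: derivable_within_continuous => z /h /fdf[].
  by [].
have [xy|yx] := leP x y.
  have hz z : z \in `[x, y] -> `|z - x| <= `|y - x|.
    by rewrite in_itv/= => /andP[xz zy]; rewrite !ger0_norm ?subr_ge0// lerD2r.
  have [||c cxy e] := @MVT_segment R f df x y xy.
  - by move=> z /subset_itv_oo_cc/hz/fdf.
  - exact: cf hz.
  by exists c => //; exact: hz.
have hz z : z \in `[y, x] -> `|z - x| <= `|y - x|.
  rewrite in_itv/= => /andP[xz zy].
  by rewrite !ler0_norm ?subr_le0 ?(ltW yx)// lerN2 lerD2r.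
have [||c cxy e] := @MVT_segment R f df y x (ltW yx).
- by move=> z /subset_itv_oo_cc/hz/fdf.
- exact: cf hz.
exists c; first exact: hz.
by rewrite -(opprB (f x)) e -mulrN opprB.
Qed.

Lemma lipschitz_ball (R : realType) (f df : R -> R) (x y M : R) :
  (forall z, `|z - x| <= `|y - x| -> is_derive z 1 f (df z)) ->
  (forall z, `|z - x| <= `|y - x| -> `|df z| <= M) ->
  `|f y - f x| <= M * `|y - x|.
Proof.
by move=> /mvt_ball[c cx ->] hM; rewrite normrM ler_wpM2r// hM.
Qed.

Lemma cos_lipschitz (R : realType) (x y : R) : `|cos x - cos y| <= `|x - y|.
Proof.
rewrite -[leRHS]mul1r; apply: (@lipschitz_ball _ _ (fun z => - sin z)) => z _.
by rewrite normrN ler_norml sin_geN1 sin_le1.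
Qed.

Lemma sin_lipschitz (R : realType) (x y : R) : `|sin x - sin y| <= `|x - y|.
Proof.
rewrite -[leRHS]mul1r; apply: (@lipschitz_ball _ _ cos) => z _.
by rewrite ler_norml cos_geN1 cos_le1.
Qed.

Lemma is_derive_monomial (R : realType) (c x z : R) j :
  is_derive z 1 (fun y => c * (y - x) ^+ j) (c * (j%:R * (z - x) ^+ j.-1)).
Proof.
pose F (y : R) := y - x.
have dF : is_derive z (1 : R) F 1.
  exact: is_derive_shift.
have -> : (fun y => c * (y - x) ^+ j) = c *: (F ^+ j).
  by apply/funext => y; rewrite /GRing.scale/= exprfctE.
by apply: is_derive_eq; rewrite /GRing.scale/= mulr1.
Qed.

(** Induction on [d]: the derivative of the remainder is a remainder of one order less for the
    shifted family [f j.+1]. Using the mean value inequality instead of integrating gives up the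
    factor 1/d!, which is harmless here. *)
Lemma taylor_bound (R : realType) (d : nat) (f : nat -> R -> R) (x rho M : R) :
  (forall j z, (j < d)%N -> `|z - x| <= rho -> is_derive z 1 (f j) (f j.+1 z)) ->
  (forall z, `|z - x| <= rho -> `|f d z| <= M) ->
  forall y, `|y - x| <= rho ->
  `|f 0%N y - \sum_(j < d) f j x / j`!%:R * (y - x) ^+ j| <= M * `|y - x| ^+ d.
Proof.
elim: d f => [|d ih] f fd fM y yx.
  by rewrite big_ord0 subr0 expr0 mulr1 fM.
pose T (n : nat) (g : nat -> R -> R) (y : R) := \sum_(j < n) g j x / j`!%:R * (y - x) ^+ j.
pose g j := f j.+1.
have Tx : T d.+1 f x = f 0%N x.
  rewrite /T big_ord_recl/= big1 ?addr0 ?expr0 ?mulr1 ?divr1//.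
  by move=> i _; rewrite subrr expr0n/= mulr0.
have dT (z : R) : is_derive z 1 (T d.+1 f) (T d g z).
  rewrite /T.
  have -> : (fun y => \sum_(j < d.+1) f j x / j`!%:R * (y - x) ^+ j) =
    \sum_(j < d.+1) (fun y => f j x / j`!%:R * (y - x) ^+ j).
    by apply/funext => u; rewrite fct_sumE.
  have -> : \sum_(j < d) g j x / j`!%:R * (z - x) ^+ j =
    \sum_(j < d.+1) (f j x / j`!%:R * (j%:R * (z - x) ^+ j.-1)).
    rewrite [RHS]big_ord_recl/= mul0r mulr0 add0r; apply: eq_bigr => i _.
    rewrite /bump/= add1n /g factS natrM mulrA; congr (_ * _).
    field; rewrite pnatr_eq0 -lt0n fact_gt0/=.
    by rewrite addrC natr1 pnatr_eq0.
  apply: is_derive_sum => j.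
  exact: is_derive_monomial.
have h1 z : `|z - x| <= `|y - x| -> `|z - x| <= rho by move/le_trans; exact.
pose r z := f 0%N z - T d.+1 f z.
have -> : f 0%N y - \sum_(j < d.+1) f j x / j`!%:R * (y - x) ^+ j = r y - r x.
  by rewrite /r Tx subrr subr0.
rewrite exprSr mulrA; apply: (@lipschitz_ball _ r (fun z => f 1%N z - T d g z)) => z zx.
  apply: is_deriveB; exact: fd (h1 _ zx).
have := ih g (fun j u jd ux => fd j.+1 u jd ux) fM z (h1 _ zx); move=> /le_trans; apply.
have M0 : 0 <= M by apply: le_trans (fM x _); rewrite ?subrr ?normr0// (le_trans _ yx).
by rewrite ler_wpM2l// lerXn2r ?nnegrE.
Qed.

Section char.
Context {d} {T : measurableType d} {R : realType} (mu : probability T R).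
Implicit Types f g : T -> R.

(** The modulus of the mean of exp(i f). With a phase as argument instead of a frequency,
    restricting to a piece, Taylor expansion and taking differences become operations on [f]. *)
Definition char f := Normc.normc
  (Complex (\int[mu]_x cos (f x)) (\int[mu]_x sin (f x))).

Lemma unit_normr (u v : R) : u ^+ 2 + v ^+ 2 <= 1 -> `|u| <= 1 /\ `|v| <= 1.
Proof.
move=> uv; have ? := sqr_ge0 u; have ? := sqr_ge0 v.
by split; rewrite -(@ler_pXn2r _ 2)// ?nnegrE// expr1n real_normK ?num_real//; lra.
Qed.

Lemma char_witness f : measurable_fun setT f -> exists u v : R,
  u ^+ 2 + v ^+ 2 <= 1 /\ char f = \int[mu]_x (u * cos (f x) + v * sin (f x)).
Proof.
move=> mf; have [u [v [uv e]]] := normc_dual (\int[mu]_x cos (f x)) (\int[mu]_x sin (f x)).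
exists u, v; split => //; rewrite /char e.
have bc := bmeas_cos mf; have bs := bmeas_sin mf.
by rewrite meanD ?meanZ//; exact: bmeasZ.
Qed.

Lemma char_ge f (u v : R) : measurable_fun setT f -> u ^+ 2 + v ^+ 2 <= 1 ->
  \int[mu]_x (u * cos (f x) + v * sin (f x)) <= char f.
Proof.
move=> mf uv; have bc := bmeas_cos mf; have bs := bmeas_sin mf.
rewrite meanD; [|exact: bmeasZ..].
by rewrite !meanZ//; exact: normc_ge_dual.
Qed.

Lemma char_ge0 f : 0 <= char f.
Proof. by rewrite /char normcE sqrtr_ge0. Qed.

Lemma bmeas_char f (u v : R) : measurable_fun setT f ->
  bmeas (fun x => u * cos (f x) + v * sin (f x)).
Proof. by move=> mf; apply: bmeasD; apply: bmeasZ; [exact: bmeas_cos|exact: bmeas_sin]. Qed.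

Lemma dist_circle (u v a b : R) : u ^+ 2 + v ^+ 2 <= 1 ->
  u * cos a + v * sin a <= u * cos b + v * sin b + 2 * `|a - b|.
Proof.
move=> /unit_normr[u1 v1].
have h (w x : R) : `|w| <= 1 -> w * x <= `|x|.
  move=> w1; apply: le_trans (ler_norm _) _.
  by rewrite normrM ler_piMl.
have := h u (cos a - cos b) u1; have := h v (sin a - sin b) v1.
have := cos_lipschitz a b; have := sin_lipschitz a b.
rewrite !mulrBr; lra.
Qed.

Lemma char_le_dist (A : set T) f g (e : R) : measurable A -> mu A = 1%E ->
  measurable_fun setT f -> measurable_fun setT g ->
  (forall x, A x -> `|f x - g x| <= e) -> char f <= char g + 2 * e.
Proof.
move=> mA muA mf mg fg; have [u [v [uv ->]]] := char_witness mf.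
apply: (@le_trans _ _ (\int[mu]_x (u * cos (g x) + v * sin (g x) + 2 * e))).
  apply: (mean_le mA muA); [exact: bmeas_char| |].
    by apply: bmeasD; [exact: bmeas_char|exact: bmeas_cst].
  move=> x Ax; apply: le_trans (dist_circle _ (g x) uv) _.
  by rewrite lerD2l ler_wpM2l// fg.
rewrite meanD; [|exact: bmeas_char|exact: bmeas_cst].
by rewrite mean_cst lerD2r; exact: char_ge.
Qed.

Lemma char_shift f (c : R) : measurable_fun setT f ->
  char (fun x => f x + c) <= char f.
Proof.
move=> mf; have mfc : measurable_fun setT (fun x => f x + c).
  by apply: measurable_funD => //; exact: measurable_cst.
have [u [v [uv ->]]] := char_witness mfc.
(* Shifting the phase amounts to rotating the vector (u, v), which keeps its norm. *)
have -> : \int[mu]_x (u * cos (f x + c) + v * sin (f x + c)) =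
  \int[mu]_x ((u * cos c + v * sin c) * cos (f x) + (v * cos c - u * sin c) * sin (f x)).
  by apply: eq_Rintegral => x _; rewrite cosD sinD; ring.
apply: char_ge => //.
have -> : (u * cos c + v * sin c) ^+ 2 + (v * cos c - u * sin c) ^+ 2 =
  (u ^+ 2 + v ^+ 2) * (cos c ^+ 2 + sin c ^+ 2) by ring.
by rewrite cos2Dsin2 mulr1.
Qed.

Lemma char_le1 f : measurable_fun setT f -> char f <= 1.
Proof.
move=> mf; have [u [v [uv ->]]] := char_witness mf.
rewrite -[leRHS](mean_cst mu 1); apply: mean_leT; [exact: bmeas_char|exact: bmeas_cst|].
move=> x; set a := cos _; set b := sin _.
have ab : a ^+ 2 + b ^+ 2 = 1 by exact: cos2Dsin2.
have ? := sqr_ge0 (u - a); have ? := sqr_ge0 (v - b).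
move: (sqr_ge0 (u - a)) (sqr_ge0 (v - b)); rewrite !sqrrB; lra.
Qed.

(* Expanding the square of the left-hand side as a double sum turns the values
   of the transform at the [f i] into its values at the differences. *)
Lemma char_duality (I : Type) (s : seq I) (p : I -> R) (f : I -> T -> R) :
  (forall i, 0 <= p i) -> (forall i, measurable_fun setT (f i)) ->
  (\sum_(i <- s) p i * char (f i)) ^+ 2 <=
  \sum_(i <- s) \sum_(j <- s) p i * p j * char (fun x => f i x - f j x).
Proof.
move=> p0 mf.
have /choice[u /choice[v huv]] : forall i, exists u, exists v : R,
    u ^+ 2 + v ^+ 2 <= 1 /\ char (f i) = \int[mu]_x (u * cos (f i x) + v * sin (f i x)).
  by move=> i; exact: char_witness.
pose a i x := u i * cos (f i x) + v i * sin (f i x).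
(* [a i] and [b i] are the real and imaginary parts of the exponential of [f i], multiplied by the
   conjugate of its witness. Adding the square of the sum of the [b i] completes the squared modulus
   of a complex sum, whose expansion involves only the differences of phases. *)
pose b i x := u i * sin (f i x) - v i * cos (f i x).
have ba i : bmeas (a i) by exact: bmeas_char.
have bb i : bmeas (b i).
  by apply: bmeasB; apply: bmeasZ; [exact: bmeas_sin|exact: bmeas_cos].
have bpa i : bmeas (fun x => p i * a i x) by exact: bmeasZ.
have bpb i : bmeas (fun x => p i * b i x) by exact: bmeasZ.
have bsa : bmeas (fun x => \sum_(i <- s) p i * a i x) by exact: bmeas_sum.
have bsb : bmeas (fun x => \sum_(i <- s) p i * b i x) by exact: bmeas_sum.
have -> : \sum_(i <- s) p i * char (f i) = \int[mu]_x (\sum_(i <- s) p i * a i x).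
  rewrite mean_sum//; apply: eq_bigr => i _.
  by rewrite meanZ// (huv i).2.
apply: le_trans (mean_sqr mu bsa) _.
pose cU i j := u i * u j + v i * v j.
pose cV i j := v i * u j - u i * v j.
have mfd i j : measurable_fun setT (fun x => f i x - f j x) by exact: measurable_funB.
apply: (@le_trans _ _ (\int[mu]_x \sum_(i <- s) \sum_(j <- s) p i * p j *
    (cU i j * cos (f i x - f j x) + cV i j * sin (f i x - f j x)))).
  apply: mean_leT.
  - by under eq_fun do rewrite expr2; exact: bmeasM.
  - by apply: bmeas_sum => i _; apply: bmeas_sum => j _; apply: bmeasZ; exact: bmeas_char.
  move=> x; apply: (@le_trans _ _ ((\sum_(i <- s) p i * a i x) ^+ 2 + (\sum_(i <- s) p i * b i x) ^+ 2)).
    by rewrite lerDl sqr_ge0.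
  rewrite !expr2 !mulr_suml -big_split/=; apply: ler_sum => i _.
  rewrite !mulr_sumr -big_split/=; apply: ler_sum => j _.
  by rewrite /a /b /cU /cV cosB sinB; lra.
rewrite mean_sum; last first.
  by move=> i _; apply: bmeas_sum => j _; apply: bmeasZ; exact: bmeas_char.
apply: ler_sum => i _; rewrite mean_sum; last first.
  by move=> j _; apply: bmeasZ; exact: bmeas_char.
apply: ler_sum => j _; rewrite meanZ; last exact: bmeas_char.
apply: ler_wpM2l; first by rewrite mulr_ge0.
apply: char_ge => //.
have -> : cU i j ^+ 2 + cV i j ^+ 2 = (u i ^+ 2 + v i ^+ 2) * (u j ^+ 2 + v j ^+ 2).
  by rewrite /cU /cV; ring.
have [ui _] := huv i; have [uj _] := huv j.
by apply: mulr_ile1 => //; rewrite addr_ge0 ?sqr_ge0.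
Qed.

End char.

Lemma char_decomposes (R : realType) (mu : probability (measurableTypeR R) R)
    W (f : measurableTypeR R -> R) : decomposes mu W -> measurable_fun setT f ->
  char mu f <= \sum_(w <- W) wp w * char mu (fun x => f (wmap w x)).
Proof.
move=> [W0 W1 WE] mf; have [u [v [uv ->]]] := char_witness mu mf.
rewrite WE; last exact: bmeas_char.
rewrite big_seq [leRHS]big_seq; apply: ler_sum => w wW.
apply: ler_wpM2l; first exact/ltW/W0.
apply: (@char_ge _ _ _ _ (fun x => f (wmap w x))) => //.
exact: (measurableT_comp mf (measurable_wmap w)).
Qed.

(** * Counting large Fourier coefficients *)

Section ge0_le_integral_nomeas.
Import HBNNSimple.

(** The integral of a nonnegative function is a supremum over the simple functions below it, so
    monotonicity needs no measurability. This spares proving it for the power of [H] in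
    [lp_mass]. *)
Lemma ge0_le_integral_nomeas d (T : measurableType d) (R : realType)
    (mu : {measure set T -> \bar R}) (f1 f2 : T -> \bar R) :
  (forall x, 0 <= f1 x)%E -> (forall x, f1 x <= f2 x)%E ->
  (\int[mu]_x f1 x <= \int[mu]_x f2 x)%E.
Proof.
move=> f10 f12; rewrite !ge0_integralTE//; last first.
  by move=> x; exact: le_trans (f12 x).
apply: ereal_sup_le => y [h /= hf1 <-].
by exists h => // x; exact: le_trans (f12 x).
Qed.

End ge0_le_integral_nomeas.

Section balls.
Variable R : realType.

Lemma ball_rVE n (y : 'rV[R]_n) (c : R) : 0 < c ->
  ball y c = [set v | forall i, `|v ord0 i - y ord0 i| < c].
Proof.
move=> c0; apply/seteqP; split => v /=.
  by move=> [_ h] i; have := h ord0 i; rewrite /ball/= distrC.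
by move=> h; split=> // i j; rewrite ord1 /ball/= distrC.
Qed.

Lemma measurable_ball_rV n (y : 'rV[R]_n) (c : R) : 0 < c -> measurable (ball y c).
Proof.
move=> c0.
have -> : ball y c =
    \bigcap_(i in [set: 'I_n]) ((fun v : 'rV[R]_n => v ord0 i) @^-1` (ball (y ord0 i) c)).
  rewrite ball_rVE//; apply/seteqP; split => v /=.
    by move=> h i _; rewrite /ball/= distrC; exact: h.
  by move=> h i; have := h i Logic.I; rewrite /ball/= distrC.
apply: fin_bigcap_measurable => // i _.
rewrite -[X in measurable X]setTI; apply: measurable_coord => //.
exact: measurable_ball.
Qed.

Lemma lebesgue_rV_ball n (y : 'rV[R]_n) (c : R) : 0 < c ->
  lebesgue_rV R n (ball y c) = ((2 * c) ^+ n)%:E.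
Proof.
move=> c0; elim: n y => [|n ih] y.
  rewrite /= /dirac indicE mem_set ?expr0// ball_rVE//=.
  by case.
pose y' := \row_(i < n) y ord0 (lift ord0 i).
rewrite /= /lebesgue_rV_succ /pushforward.
have -> : @rV_cons R n @^-1` ball y c = ball (y ord0 ord0) c `*` ball y' c.
  rewrite !ball_rVE//; apply/seteqP; split => -[x v] /=; rewrite /rV_cons/=.
    move=> h; split => [|i].
      have := h ord0; rewrite /ball/= distrC.
      have -> : (ord0 : 'I_n.+1) = lshift n (ord0 : 'I_1) by exact/val_inj.
      by rewrite (@row_mxEl _ 1 1 n) mxE.
    have := h (lift ord0 i); rewrite /y' mxE.
    have -> : lift ord0 i = rshift 1 i :> 'I_(1 + n) by exact/val_inj.
    by rewrite (@row_mxEr _ 1 1 n).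
  move=> [h0 h] i.
  case: (unliftP ord0 i) => [j|] ->.
    have := h j; rewrite /y' mxE.
    have -> : lift ord0 j = rshift 1 j :> 'I_(1 + n) by exact/val_inj.
    by rewrite (@row_mxEr _ 1 1 n).
  move: h0; rewrite /ball/= distrC.
  have -> : (ord0 : 'I_n.+1) = lshift n (ord0 : 'I_1) by exact/val_inj.
  by rewrite (@row_mxEl _ 1 1 n) mxE.
rewrite product_measure1E; [|exact: measurable_ball|exact: measurable_ball_rV].
rewrite ih [X in (X * _)%E](lebesgue_measure_ball _ (ltW c0)) -EFinM exprS.
by rewrite -[c *+ 2]mulr_natl.
Qed.

(* Double counting: integrate [\sum_i wt i * \1_(ball (y i) c)], which is at most
   [M] everywhere and vanishes off the set where [H >= tau / 2]. *)
Lemma lp_mass (I : eqType) m (H : 'rV[R]_m -> R) (p B rad c K tau M : R)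
    (s : seq I) (wt : I -> R) (y : I -> 'rV[R]_m) :
  (forall v, 0 <= H v) ->
  (forall (u v : 'rV[R]_m) (e : R), (forall i, `|u ord0 i - v ord0 i| <= e) -> H u <= H v + K * e) ->
  0 <= p -> 0 < c -> 0 < M -> 0 < tau -> K * c <= tau / 2 -> 0 < rad ->
  (\int[lebesgue_rV R m]_(xi in ball (0%R : 'rV[R]_m) rad) ((H xi `^ p)%R)%:E <= B%:E)%E ->
  (forall i, i \in s -> 0 <= wt i) ->
  (forall i, i \in s -> tau < H (y i)) ->
  (forall i k, i \in s -> `|y i ord0 k| + c <= rad) ->
  (forall Q : pred I, (forall i j, i \in s -> j \in s -> Q i -> Q j ->
       forall k, `|y i ord0 k - y j ord0 k| <= 2 * c) ->
     \sum_(i <- s | Q i) wt i <= M) ->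
  (\sum_(i <- s) wt i) * ((tau / 2) `^ p * (2 * c) ^+ m) <= M * B.
Proof.
move=> H0 HL p0 c0 M0 tau0 Kc rad0 hB wt0 hH yrad hM.
set lam := lebesgue_rV R m.
pose b i : set 'rV[R]_m := ball (y i) c.
have mb i : measurable (b i) by exact: measurable_ball_rV.
pose g (v : 'rV[R]_m) : R := M^-1 * (tau / 2) `^ p * \sum_(i <- s) wt i * \1_(b i) v.
pose f : 'rV[R]_m -> R := (fun v => H v `^ p) \_ (ball 0 rad).
have g0 (v : 'rV[R]_m) : 0 <= g v.
  rewrite !mulr_ge0 ?powR_ge0 ?invr_ge0 ?(ltW M0)// big_seq sumr_ge0// => i si.
  by rewrite mulr_ge0 ?wt0// indicE.
have gf (v : 'rV[R]_m) : g v <= f v.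
  have gM : \sum_(i <- s) wt i * \1_(b i) v <= M.
    have -> : \sum_(i <- s) wt i * \1_(b i) v = \sum_(i <- s | v \in b i) wt i.
      rewrite [RHS]big_mkcond; apply: eq_bigr => i _; rewrite indicE.
      by case: (v \in b i); rewrite ?mulr1 ?mulr0.
    (* Balls of radius [c] through a common point have centres within [2 * c] of each other. *)
    apply: hM => i j si sj; rewrite !inE /b !ball_rVE//= => hi hj k.
    have h3 : `|y i ord0 k - y j ord0 k| <= `|v ord0 k - y i ord0 k| + `|v ord0 k - y j ord0 k|.
      by rewrite [X in _ <= X + _]distrC; exact: dist_tri.
    have h1 : `|v ord0 k - y i ord0 k| < c := hi k.
    have h2 : `|v ord0 k - y j ord0 k| < c := hj k.
    clear -h1 h2 h3; lra.
  have [/hasP[i si vi]|/hasPn hn] := boolP (has (fun i => v \in b i) s); last first.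
    rewrite /g big1_seq ?mulr0; last first.
      by move=> i /andP[_ /hn /negbTE h]; rewrite indicE h mulr0.
    rewrite /f /patch; case: ifP => // _; exact: powR_ge0.
  rewrite inE /b ball_rVE//= in vi.
  rewrite /f /patch ifT; last first.
    rewrite inE ball_rVE//= => k; rewrite mxE subr0.
    have := yrad i k si; have := dist_tri (v ord0 k) (y i ord0 k) 0; rewrite !subr0.
    have h1 : `|v ord0 k - y i ord0 k| < c := vi k.
    clear -h1; lra.
  rewrite /g mulrAC mulrC -[leRHS]mulr1; apply: ler_pM; rewrite ?powR_ge0//.
  - rewrite mulr_ge0 ?invr_ge0 ?(ltW M0)// big_seq sumr_ge0// => j sj.
    by rewrite mulr_ge0 ?wt0// indicE.
  - apply: ge0_ler_powR => //; rewrite ?nnegrE ?divr_ge0 ?(ltW tau0)//.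
    have := hH i si.
    have : H (y i) <= H v + K * c.
      by apply: HL => k; rewrite distrC; exact: ltW (vi k).
    clear -Kc; lra.
  - by rewrite mulrC ler_pdivrMr// mul1r.
have gI : (\int[lam]_v (g v)%:E = (M^-1 * ((\sum_(i <- s) wt i) * ((tau / 2) `^ p * (2 * c) ^+ m)))%:E)%E.
  pose t := M^-1 * (tau / 2) `^ p.
  have t0 : 0 <= t by rewrite mulr_ge0 ?powR_ge0// invr_ge0 ltW.
  (* [ge0_integral_sum] wants every term nonnegative, also for indices outside [s], hence the
     absolute value. *)
  transitivity (\int[lam]_v (\sum_(i <- s) ((t * `|wt i|)%:E * (\1_(b i) v)%:E)))%E.
    apply: eq_integral => z _; rewrite /g mulr_sumr -sumEFin.
    apply: eq_big_seq => k sk; rewrite -EFinM mulrA; congr (_ * _)%:E.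
    by rewrite ger0_norm// wt0.
  rewrite ge0_integral_sum//; last 2 first.
  - move=> k; apply: measurable_funeM; apply/measurable_EFinP; exact: measurable_indic.
  - move=> k z _; rewrite -EFinM lee_fin; apply: mulr_ge0; first exact: mulr_ge0.
    by rewrite indicE.
  rewrite mulr_suml mulr_sumr -sumEFin; apply: eq_big_seq => k sk.
  rewrite (ge0_integralZl_EFin _ _ _ _ (mulr_ge0 t0 (normr_ge0 (wt k))))//; last first.
    by apply/measurable_EFinP; exact: measurable_indic.
  transitivity ((t * `|wt k|)%:E * ((2 * c) ^+ m)%:E)%E.
    by congr (_ * _)%E; rewrite integral_indic// setIT; exact: lebesgue_rV_ball.
  rewrite -EFinM; congr _%:E.
  by rewrite ger0_norm ?wt0// /t; ring.
rewrite -ler_pdivrMl//.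
rewrite -lee_fin -gI; apply: le_trans hB.
rewrite [leRHS]integral_mkcond; apply: ge0_le_integral_nomeas => x.
  by rewrite lee_fin.
by have := gf x; rewrite -lee_fin /f /patch; case: ifP.
Qed.

End balls.

(** * Power series *)

Section power_series.
Variable R : realType.
Implicit Types (a : nat -> R) (f : R -> R).

Lemma geometric_majorant_cvg (u : nat -> R) (C th : R) : 0 <= th < 1 ->
  (forall j, `|u j| <= C * th ^+ j) -> cvgn (series u).
Proof.
move=> /andP[th0 th1] hu; apply: normed_cvg.
have C0 : 0 <= C by have := hu 0%N; rewrite expr0 mulr1; apply: le_trans.
apply: (@series_le_cvg _ _ (geometric C th)) => [n|n|n|].
- exact: normr_ge0.
- by rewrite /= mulr_ge0// exprn_ge0.
- exact: hu.
- by apply: is_cvg_geometric_series; rewrite ger0_norm.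
Qed.

Definition pbounded a (rho C : R) := forall j, `|a j| * rho ^+ j <= C.

Lemma pbounded_cvg a (rho C x : R) : 0 < rho -> pbounded a rho C -> `|x| < rho ->
  cvgn (pseries a x).
Proof.
move=> rho0 ha xrho; apply: (@geometric_majorant_cvg _ C (`|x| / rho)).
  by rewrite divr_ge0 ?(ltW rho0)//= ltr_pdivrMr// mul1r.
move=> j; rewrite normrM normrX expr_div_n mulrA mulrAC.
apply: ler_wpM2r; first by rewrite exprn_ge0.
by rewrite ler_pdivlMr ?exprn_gt0.
Qed.

(** The sum 1 + q + ... + q^j is at least (j + 1) q^j, and times 1 - q it telescopes. *)
Lemma succ_geometric_le (q : R) j : 0 <= q < 1 ->
  j.+1%:R * q ^+ j * (1 - q) <= 1.
Proof.
move=> /andP[q0 q1]; have {}q1 : q <= 1 by exact: ltW.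
have h : j.+1%:R * q ^+ j * (1 - q) <= 1 - q ^+ j.+1.
  elim: j => [|j ih]; first by rewrite expr0 expr1 !mul1r.
  rewrite -natr1 exprS.
  have := ler_wpM2l q0 ih; rewrite exprS.
  have -> : q ^+ j.+2 = q * (q * q ^+ j) by rewrite !exprS.
  have p1 : q * q ^+ j <= 1 by rewrite -exprS exprn_ile1.
  have : (q * q ^+ j) * (1 - q) <= 1 * (1 - q) by rewrite ler_wpM2r// subr_ge0.
  set u := q ^+ j; nra.
by apply: le_trans h _; rewrite gerBl exprn_ge0.
Qed.

(** Shrinking the radius pays for the factor j + 1 that differentiation brings. *)
Lemma pbounded_diffs a (rho rho' C : R) : 0 < rho' < rho -> pbounded a rho C ->
  exists C', pbounded (pseries_diffs a) rho' C'.
Proof.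
move=> /andP[r0 rr] ha; have rho0 : 0 < rho by exact: lt_trans rr.
have q1 : rho' / rho < 1 by rewrite ltr_pdivrMr// mul1r.
exists (C / rho / (1 - rho' / rho)) => j.
rewrite /pseries_diffs normrM ger0_norm//.
rewrite ler_pdivlMr ?subr_gt0//.
have -> : j.+1%:R * `|a j.+1| * rho' ^+ j * (1 - rho' / rho) =
  (j.+1%:R * (rho' / rho) ^+ j * (1 - rho' / rho)) * (`|a j.+1| * rho ^+ j.+1 / rho).
  rewrite expr_div_n exprS; field.
  by rewrite expf_eq0 (gt_eqF rho0) andbF.
rewrite -[leRHS]mul1r; apply: ler_pM.
- by rewrite !mulr_ge0 ?exprn_ge0 ?divr_ge0 ?subr_ge0 ?(ltW q1) ?(ltW r0) ?(ltW rho0).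
- by rewrite !mulr_ge0 ?exprn_ge0 ?invr_ge0 ?(ltW rho0).
- by apply: succ_geometric_le; rewrite q1 divr_ge0 ?(ltW r0) ?(ltW rho0).
- by rewrite ler_wpM2r ?invr_ge0 ?(ltW rho0).
Qed.

Definition pser_at (x0 r : R) f := exists a, forall x, `|x - x0| < r ->
  pseries a (x - x0) @ \oo --> f x.

Lemma pser_at_pbounded a f (x0 r rho : R) : 0 < rho < r ->
  (forall x, `|x - x0| < r -> pseries a (x - x0) @ \oo --> f x) ->
  exists C, pbounded a rho C.
Proof.
move=> /andP[rho0 rr] h.
have /h : `|x0 + rho - x0| < r by rewrite addrC addKr gtr0_norm.
rewrite addrC addKr => /cvgP/cvg_series_bounded[M [Mr hM]].
exists (M + 1) => j; have := hM (M + 1) _ j Logic.I.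
rewrite /= normrM normrX (gtr0_norm rho0); apply.
by rewrite ltrDl.
Qed.

Lemma pser_at_deriv f (x0 r : R) : 0 < r -> pser_at x0 r f ->
  exists f', pser_at x0 r f' /\ forall x, `|x - x0| < r -> is_derive x 1 f (f' x).
Proof.
move=> r0 [a ha]; exists (fun x => limn (pseries (pseries_diffs a) (x - x0))).
(* Each formal derivative costs a sixth of the gap between [t] and [r]. Termwise differentiation
   calls for the series and its first two formal derivatives, so the gap is never exhausted. *)
have bd t k : 0 <= t < r -> (k < 5)%N -> exists C,
    pbounded (iter k (fun a => pseries_diffs a) a) (t + (r - t) * (5 - k)%:R / 6) C.
  move=> /andP[t0 tr]; elim: k => [|k ih] k5.
    apply: pser_at_pbounded ha; rewrite subn0; lra.
  have [C] := ih (ltnW k5); apply: pbounded_diffs.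
  have h : (1 : R) <= (5 - k.+1)%:R by rewrite ler1n subn_gt0.
  have e : (5 - k)%:R = (5 - k.+1)%:R + 1 :> R.
    by rewrite natr1 subnSK// ltnW.
  rewrite e; have : 0 < r - t by rewrite subr_gt0.
  set u := r - t; set v := _%:R => u0; have : 0 < u * v by rewrite mulr_gt0// (lt_le_trans _ h).
  rewrite mulrDr; lra.
have cv t k x : 0 <= t < r -> (k < 5)%N -> `|x| <= t ->
    cvgn (pseries (iter k (fun a => pseries_diffs a) a) x).
  move=> trr k5 xt; have [C hC] := bd _ _ trr k5; have /andP[t0 tr] := trr.
  have h : t < t + (r - t) * (5 - k)%:R / 6.
    by rewrite ltrDl divr_gt0// mulr_gt0 ?subr_gt0// ltr0n subn_gt0.
  apply: pbounded_cvg hC _; first exact: le_lt_trans h.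
  exact: le_lt_trans h.
split.
  exists (pseries_diffs a) => x xr.
  by apply: (cv `|x - x0| 1%N) => //; rewrite normr_ge0.
move=> x xr; pose K := (`|x - x0| + r) / 2.
have K0 : 0 <= K < r by rewrite /K; have := normr_ge0 (x - x0); move: xr; set u := `|_|; lra.
have xK : `|x - x0| < `|K|.
  rewrite (ger0_norm (andP K0).1) /K; move: xr; set u := `|_|; lra.
have KK : `|K| <= K by rewrite ger0_norm// (andP K0).1.
have d1 := @pseries_snd_diffs R a K (x - x0) (cv _ 0%N _ K0 isT KK)
   (cv _ 1%N _ K0 isT KK) (cv _ 2%N _ K0 isT KK) xK.
have d2 : is_derive x (1 : R) (fun y => limn (pseries a (y - x0)))
    (limn (pseries (pseries_diffs a) (x - x0))).
  have ds : is_derive x (1 : R) (fun y => y - x0) 1 by exact: is_derive_shift.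
  have := @is_derive1_comp _ (fun u => limn (pseries a u)) (fun y => y - x0) x _ _ d1 ds.
  by rewrite mulr1.
apply: near_eq_is_derive d2; near=> y.
have yr : `|y - x0| < r.
  have : `|y - x| < r - `|x - x0|.
    near: y; apply/nbhs_ballP; exists (r - `|x - x0|); first by rewrite /= subr_gt0.
    by move=> y; rewrite /ball/= distrC.
  have := dist_tri y x x0; set u := `|_|; lra.
by apply/cvg_lim => //; exact: ha.
Unshelve. all: by end_near.
Qed.

End power_series.

(** * Finite order of zeros *)

Section polynomial_approximation.
Variable R : realType.
Implicit Types (f g : R -> R) (P Q : {poly R}).

Definition absp P : {poly R} := \poly_(j < size P) `|P`_j|.

Lemma coef_absp P j : (absp P)`_j = `|P`_j|.
Proof.
rewrite coef_poly; case: ltnP => // h.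
by rewrite nth_default// normr0.
Qed.

(* The weighted l1-norm of the coefficients of [P]. *)
Definition wnorm (rho : R) P := (absp P).[rho].

Lemma wnormE (rho : R) n P : (size P <= n)%N ->
  wnorm rho P = \sum_(j < n) `|P`_j| * rho ^+ j.
Proof.
move=> Pn; rewrite /wnorm (@horner_coef_wide _ n).
  by apply: eq_bigr => j _; rewrite coef_absp.
exact: leq_trans (size_poly _ _) Pn.
Qed.

Lemma wnorm_ge0 (rho : R) P : 0 <= rho -> 0 <= wnorm rho P.
Proof.
by move=> r0; rewrite (wnormE _ (leqnn _)) sumr_ge0// => i _; rewrite mulr_ge0 ?exprn_ge0.
Qed.

Lemma wnormD (rho : R) P Q : 0 <= rho -> wnorm rho (P + Q) <= wnorm rho P + wnorm rho Q.
Proof.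
move=> r0; pose n := maxn (size P) (size Q).
rewrite !(@wnormE _ n) ?leq_maxl ?leq_maxr ?size_polyD// -big_split/=.
apply: ler_sum => i _; rewrite -mulrDl ler_wpM2r ?exprn_ge0// coefD; exact: ler_normD.
Qed.

Lemma wnormM (rho : R) P Q : 0 <= rho -> wnorm rho (P * Q) <= wnorm rho P * wnorm rho Q.
Proof.
move=> r0; have -> : wnorm rho P * wnorm rho Q = (absp P * absp Q).[rho] by rewrite hornerM.
pose n := maxn (size (P * Q)) (size (absp P * absp Q)).
rewrite (@wnormE _ n) ?leq_maxl// (@horner_coef_wide _ n) ?leq_maxr//.
apply: ler_sum => i _; rewrite ler_wpM2r ?exprn_ge0// !coefM.
apply: le_trans (ler_norm_sum _ _ _) _; apply: ler_sum => j _.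
by rewrite normrM !coef_absp.
Qed.

Lemma horner_wnorm (rho h : R) P : `|h| <= rho -> `|P.[h]| <= wnorm rho P.
Proof.
move=> hr; rewrite (wnormE _ (leqnn _)) horner_coef.
apply: le_trans (ler_norm_sum _ _ _) _; apply: ler_sum => j _.
by rewrite normrM normrX ler_wpM2l// lerXn2r ?nnegrE// (le_trans _ hr).
Qed.

(* A function with order [n] polynomial approximations whose errors and
   coefficients decay geometrically. Unlike convergent power series, this class is
   visibly stable under products, and suffices for isolated zeros to have finite
   order. *)
Definition approx_by (x0 rho C : R) f (n : nat) P :=
  [/\ (size P <= n)%N, wnorm rho P <= C &
      forall h, `|h| <= rho -> `|f (x0 + h) - P.[h]| <= C * (`|h| / rho) ^+ n].

(** [C] is independent of the order [n]. All small radii are allowed so that two functions can be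
    approximated at a common one. *)
Definition poly_approx (x0 : R) f := exists rho0 : R, 0 < rho0 /\
  forall rho, 0 < rho -> rho <= rho0 -> exists C, forall n, exists P, approx_by x0 rho C f n P.

Lemma approx_ge0 (x0 rho C : R) f n P : 0 < rho -> approx_by x0 rho C f n P -> 0 <= C.
Proof. by move=> r0 [_ + _]; apply: le_trans; exact: wnorm_ge0 (ltW r0). Qed.

Lemma poly_approxD x0 f g : poly_approx x0 f -> poly_approx x0 g ->
  poly_approx x0 (fun x => f x + g x).
Proof.
move=> [r1 [r10 h1]] [r2 [r20 h2]]; exists (Num.min r1 r2).
split; first by rewrite lt_min r10.
move=> rho rho0; rewrite le_min => /andP[rr1 rr2].
have [C1 hC1] := h1 _ rho0 rr1; have [C2 hC2] := h2 _ rho0 rr2.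
exists (C1 + C2) => n; have [P [P1 P2 P3]] := hC1 n; have [Q [Q1 Q2 Q3]] := hC2 n.
exists (P + Q); split.
- by rewrite (leq_trans (size_polyD _ _))// geq_max P1.
- by apply: le_trans (wnormD _ _ (ltW rho0)) _; rewrite lerD.
- move=> h hr; have -> : f (x0 + h) + g (x0 + h) - (P + Q).[h] = (f (x0 + h) - P.[h]) + (g (x0 + h) - Q.[h]) by rewrite hornerD; ring.
  rewrite mulrDl.
  by apply: le_trans (ler_normD _ _) _; rewrite lerD ?P3 ?Q3.
Qed.

(** The product of the approximations is cut at degree [n]. The discarded part is X^n times a
    polynomial of weighted norm at most C1 C2 rho^(-n), so it is no larger than the allowed error.
    The constant 4 counts this part and the three error terms of a product. *)
Lemma poly_approxM x0 f g : poly_approx x0 f -> poly_approx x0 g ->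
  poly_approx x0 (fun x => f x * g x).
Proof.
move=> [r1 [r10 h1]] [r2 [r20 h2]]; exists (Num.min r1 r2).
split; first by rewrite lt_min r10.
move=> rho rho0; rewrite le_min => /andP[rr1 rr2].
have [C1 hC1] := h1 _ rho0 rr1; have [C2 hC2] := h2 _ rho0 rr2.
exists (4 * C1 * C2) => n; have [P hP] := hC1 n; have [Q hQ] := hC2 n.
have C10 := approx_ge0 rho0 hP; have C20 := approx_ge0 rho0 hQ.
have [P1 P2 P3] := hP; have [Q1 Q2 Q3] := hQ.
have PQ : wnorm rho (P * Q) <= C1 * C2.
  by apply: le_trans (wnormM _ _ (ltW rho0)) _; rewrite ler_pM ?wnorm_ge0 ?(ltW rho0).
have CC : 0 <= C1 * C2 by rewrite mulr_ge0.
exists (take_poly n (P * Q)); split.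
- exact: size_take_poly.
- have : wnorm rho (take_poly n (P * Q)) <= wnorm rho (P * Q).
    pose k := maxn (size (P * Q)) (size (take_poly n (P * Q))).
    rewrite !(@wnormE _ k) ?leq_maxr ?leq_maxl//; apply: ler_sum => j _.
    rewrite ler_wpM2r ?exprn_ge0 ?(ltW rho0)// coef_take_poly.
    by case: ifP => // _; rewrite normr0.
  move: PQ CC; set u := wnorm _ _; set v := wnorm _ _; lra.
move=> h hr.
set t := (`|h| / rho) ^+ n.
have t0 : 0 <= t by rewrite exprn_ge0// divr_ge0// ltW.
have t1 : t <= 1.
  by rewrite exprn_ile1 ?divr_ge0 ?(ltW rho0)// ler_pdivrMr// mul1r.
have e : (P * Q).[h] - (take_poly n (P * Q)).[h] = (drop_poly n (P * Q) * 'X^n).[h].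
  by rewrite -hornerN -hornerD -{1}(poly_take_drop n (P * Q)) addrAC subrr add0r.
have tail : `|(drop_poly n (P * Q) * 'X^n).[h]| <= C1 * C2 * t.
  rewrite hornerM hornerXn normrM normrX.
  apply: (@le_trans _ _ (wnorm rho (drop_poly n (P * Q)) * `|h| ^+ n)).
    by rewrite ler_wpM2r ?exprn_ge0// horner_wnorm.
  have : wnorm rho (drop_poly n (P * Q)) * rho ^+ n <= C1 * C2.
    apply: le_trans PQ.
    pose k := maxn (size (P * Q)) (size (drop_poly n (P * Q))).
    rewrite (@wnormE _ k (drop_poly _ _)) ?leq_maxr// (@wnormE _ (n + k)); last first.
      by rewrite (leq_trans (leq_maxl _ (size (drop_poly n (P * Q)))))// leq_addl.
    rewrite big_split_ord/= mulr_suml ler_wpDl ?sumr_ge0//.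
      by move=> i _; rewrite mulr_ge0 ?exprn_ge0 ?(ltW rho0).
    apply: ler_sum => i _; by rewrite coef_drop_poly -mulrA -exprD addnC.
  move=> hw; rewrite /t expr_div_n mulrA [leRHS]mulrAC.
  rewrite ler_wpM2r ?exprn_ge0//.
  by rewrite ler_pdivlMr ?exprn_gt0.
have hP3 := P3 h hr; have hQ3 := Q3 h hr.
have hPh : `|P.[h]| <= C1 := le_trans (horner_wnorm P hr) P2.
have -> : f (x0 + h) * g (x0 + h) - (take_poly n (P * Q)).[h] =
   (f (x0 + h) - P.[h]) * (g (x0 + h) - Q.[h]) + (f (x0 + h) - P.[h]) * Q.[h] +
    P.[h] * (g (x0 + h) - Q.[h]) + (drop_poly n (P * Q) * 'X^n).[h].
  by rewrite -e hornerM; ring.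
have hQh : `|Q.[h]| <= C2 := le_trans (horner_wnorm Q hr) Q2.
have tt : t * t <= t by rewrite ler_piMr.
have m1 : `|(f (x0 + h) - P.[h]) * (g (x0 + h) - Q.[h])| <= C1 * C2 * t.
  rewrite normrM; apply: (@le_trans _ _ ((C1 * t) * (C2 * t))); first exact: ler_pM.
  by rewrite mulrACA ler_wpM2l.
have m2 : `|(f (x0 + h) - P.[h]) * Q.[h]| <= C1 * C2 * t.
  by rewrite normrM mulrAC; exact: ler_pM.
have m3 : `|P.[h] * (g (x0 + h) - Q.[h])| <= C1 * C2 * t.
  by rewrite normrM -mulrA; exact: ler_pM.
apply: le_trans (ler_normD _ _) _.
apply: le_trans (lerD (ler_normD _ _) (lexx _)) _.
apply: le_trans (lerD (lerD (ler_normD _ _) (lexx _)) (lexx _)) _.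
apply: le_trans (lerD (lerD (lerD m1 m2) m3) tail) _.
by have -> : C1 * C2 * t + C1 * C2 * t + C1 * C2 * t + C1 * C2 * t = 4 * C1 * C2 * t by ring.
Qed.

Lemma poly_approx_cst x0 (c : R) : poly_approx x0 (fun=> c).
Proof.
exists 1; split => // rho rho0 _; exists `|c| => -[|n].
  exists 0; split; first by rewrite size_poly0.
    by rewrite (@wnormE _ 0) ?size_poly0// big_ord0.
  by move=> h _; rewrite horner0 subr0 expr0 mulr1.
exists c%:P; split; first by rewrite (leq_trans (size_polyC_leq1 _)).
  by rewrite (@wnormE _ 1) ?size_polyC_leq1// big_ord_recl big_ord0 coefC/= expr0 mulr1 addr0.
by move=> h _; rewrite hornerC subrr normr0 mulr_ge0 ?exprn_ge0// divr_ge0// ltW.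
Qed.

Lemma poly_approx_sum x0 I (s : seq I) (F : I -> R -> R) :
  (forall i, poly_approx x0 (F i)) -> poly_approx x0 (fun x => \sum_(i <- s) F i x).
Proof.
move=> hF; elim: s => [|i s ih].
  by under eq_fun do rewrite big_nil; exact: poly_approx_cst.
by under eq_fun do rewrite big_cons; exact: poly_approxD.
Qed.

Lemma poly_approx_prod x0 I (s : seq I) (F : I -> R -> R) :
  (forall i, poly_approx x0 (F i)) -> poly_approx x0 (fun x => \prod_(i <- s) F i x).
Proof.
move=> hF; elim: s => [|i s ih].
  by under eq_fun do rewrite big_nil; exact: poly_approx_cst.
by under eq_fun do rewrite big_cons; exact: poly_approxM.
Qed.

Lemma poly_approx_det x0 n (A : R -> 'M[R]_n) :
  (forall i j, poly_approx x0 (fun x => A x i j)) -> poly_approx x0 (fun x => \det (A x)).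
Proof.
move=> hA; rewrite /determinant; apply: poly_approx_sum => s.
by apply: poly_approxM; [exact: poly_approx_cst|exact: poly_approx_prod].
Qed.

Lemma poly_approx_pser x0 r f : 0 < r -> pser_at x0 r f -> poly_approx x0 f.
Proof.
(* For rho <= r / 4 the coefficients are bounded at radius 2 rho < r, so on |h| <= rho the tails are
   dominated by a geometric series of ratio 1/2, whence the constant 2 C. *)
move=> r0 [a ha]; exists (r / 4); split; first by rewrite divr_gt0.
move=> rho rho0 rr.
have [C hC] : exists C, pbounded a (2 * rho) C.
  by apply: pser_at_pbounded ha; lra.
have C0 : 0 <= C by have := hC 0%N; rewrite expr0 mulr1; apply: le_trans.
have geo n (b : R) : 0 <= b <= 1 -> \sum_(j < n) C * (b / 2) ^+ j <= 2 * C.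
  move=> /andP[b0 b1].
  have h : (\sum_(j < n) (b / 2) ^+ j) * (1 - b / 2) <= 1.
    have -> : (\sum_(j < n) (b / 2) ^+ j) * (1 - b / 2) = 1 - (b / 2) ^+ n.
      by rewrite -[RHS]opprB subrX1; ring.
    by rewrite gerBl exprn_ge0// divr_ge0.
  rewrite -mulr_sumr mulrC ler_wpM2r//.
  have s0 : 0 <= \sum_(j < n) (b / 2) ^+ j by rewrite sumr_ge0// => i _; rewrite exprn_ge0 ?divr_ge0.
  move: h s0; set S := \sum_(_ < _) _ => h s0.
  have : S * 2^-1 <= S * (1 - b / 2) by rewrite ler_wpM2l//; lra.
  lra.
have aj j (h : R) : `|h| <= rho -> `|a j * h ^+ j| <= C * (`|h| / rho / 2) ^+ j.
  move=> hr; rewrite normrM normrX.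
  have -> : `|h| / rho / 2 = `|h| / (2 * rho) by field; rewrite gt_eqF.
  rewrite expr_div_n mulrA mulrAC ler_wpM2r ?exprn_ge0//.
  by rewrite ler_pdivlMr ?exprn_gt0 ?mulr_gt0.
exists (2 * C) => n; exists (\poly_(j < n) a j); split; first exact: size_poly.
  rewrite (wnormE _ (size_poly _ _)).
  apply: le_trans (geo n 1 _); last by rewrite ler01 lexx.
  apply: ler_sum => j _; rewrite coef_poly ltn_ord.
  have := aj j rho; rewrite ger0_norm ?(ltW rho0)// divff ?gt_eqF// normrM normrX.
  by rewrite (ger0_norm (ltW rho0)); exact.
move=> h hr.
have hb : 0 <= `|h| / rho <= 1 by rewrite divr_ge0 ?(ltW rho0)//= ler_pdivrMr// mul1r.
have part k : `|series (fun j => a j * h ^+ j) (n + k)%N - (\poly_(j < n) a j).[h]| <=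
    2 * C * (`|h| / rho) ^+ n.
  rewrite /series/= (big_cat_nat (n := n))//= ?leq_addr//.
  rewrite (@horner_coef_wide _ n) ?size_poly// -(big_mkord xpredT (fun j => (\poly_(j0 < n) a j0)`_j * h ^+ j)).
  have -> : \sum_(0 <= j < n) (\poly_(j0 < n) a j0)`_j * h ^+ j = \sum_(0 <= j < n) a j * h ^+ j.
    by apply: eq_big_nat => j /andP[_ jn]; rewrite coef_poly jn.
  rewrite addrAC subrr add0r -[X in \sum_(X <= _ < _) _]add0n big_addn addKn big_mkord.
  apply: le_trans (ler_norm_sum _ _ _) _.
  apply: le_trans (_ : \sum_(j < k) (C * (`|h| / rho / 2) ^+ j) * (`|h| / rho) ^+ n <= _).
    apply: ler_sum => j _; apply: le_trans (aj _ _ hr) _.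
    rewrite exprD [leLHS]mulrA ler_wpM2l// ?mulr_ge0 ?exprn_ge0 ?divr_ge0 ?(ltW rho0)//.
    have /andP[b0 b1] := hb.
    by rewrite lerXn2r ?nnegrE ?divr_ge0 ?(ltW rho0)// ler_pdivrMr// ler_peMr// ler1n.
  by rewrite -mulr_suml ler_wpM2r ?exprn_ge0 ?(andP hb).1// geo.
have cv : series (fun j => a j * h ^+ j) @ \oo --> f (x0 + h).
  have := ha (x0 + h); rewrite addrC addKr; apply.
  by rewrite (le_lt_trans hr)//; lra.
have cv2 : `|series (fun j => a j * h ^+ j) k - (\poly_(j < n) a j).[h]| @[k --> \oo]
    --> `|f (x0 + h) - (\poly_(j < n) a j).[h]|.
  by apply: cvg_norm; apply: cvgB => //; exact: cvg_cst.
apply: (cvgr_to_le cv2); near=> k.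
have nk : (n <= k)%N by near: k; exact: nbhs_infty_ge.
by rewrite -(subnKC nk).
Unshelve. all: by end_near.
Qed.

(** If some approximation [P] is nonzero, its lowest term, of degree K < n, dominates both the rest
    of [P] and the error of order n near 0. If all of them are zero, the error bound alone gives |f|
    <= C 2^(-n) for every n on half the radius. *)
Lemma poly_approx_dichotomy x0 f : poly_approx x0 f ->
  (exists2 r : R, 0 < r & forall h, `|h| <= r -> f (x0 + h) = 0) \/
  (exists K c r, [/\ 0 < c, 0 < r & forall h, `|h| <= r -> c * `|h| ^+ K <= `|f (x0 + h)|]).
Proof.
move=> [rho [rho0 /(_ rho rho0 (lexx _))[C hC]]].
have C0 : 0 <= C by have [P] := hC 0%N; exact: approx_ge0.
have [[n [P [Pn0 [P1 P2 P3]]]]|none] := pselect (exists n P, P != 0 /\ approx_by x0 rho C f n P).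
  right.
  have ex : exists K, P`_K != 0.
    exists (size P).-1; by rewrite -lead_coefE lead_coef_eq0.
  pose K := ex_minn ex.
  have [PK Kmin] : P`_K != 0 /\ forall j, (j < K)%N -> P`_j = 0.
    rewrite /K; case: ex_minnP => k kP kmin; split => // j jk.
    by apply/eqP; apply: contraT => /kmin; rewrite leqNgt jk.
  have Kn : (K < n)%N.
    rewrite (leq_trans _ P1)// ltnNge; apply/negP => /(nth_default 0) h.
    by rewrite h eqxx in PK.
  pose D := drop_poly K P.
  have PE h : P.[h] = D.[h] * h ^+ K.
    rewrite -{1}(poly_take_drop K P) hornerD hornerM hornerXn.
    have -> : take_poly K P = 0; last by rewrite horner0 add0r.
    by apply/polyP => j; rewrite coef_take_poly coef0; case: ifP => // /Kmin.
  have D0 : D.[0] = P`_K by rewrite horner_coef0 coef_drop_poly add0n.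
  pose c := `|P`_K|.
  have c0 : 0 < c by rewrite normr_gt0.
  have [r [r0 hr]] : exists r : R, 0 < r /\ forall h, `|h| < r -> `|D.[h] - P`_K| < c / 2.
    have := @continuous_horner R D 0; rewrite /continuous_at D0.
    move=> /cvgrPdist_lt/(_ (c / 2)).
    rewrite divr_gt0// => /(_ isT)/nbhs_ballP[r /= r0 hr].
    exists r; split => // h hh; rewrite distrC; apply: hr.
    by rewrite /ball/= sub0r normrN.
  pose b := C / rho ^+ K.+1.
  have b0 : 0 <= b by rewrite divr_ge0 ?exprn_ge0// ltW.
  (* The three terms ensure that [D] stays within c / 2 of its value at 0, that the approximation is
     valid, and that its error is at most c / 4 times |h|^K. The added 1 covers [b = 0]. *)
  pose r' := Num.min (Num.min (r / 2) rho) (c / 4 / (b + 1)).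
  have r'0 : 0 < r' by rewrite !lt_min rho0 !divr_gt0// ltr_wpDl.
  exists K, (c / 4), r'; split; rewrite ?divr_gt0//.
  move=> h; rewrite !le_min => /andP[/andP[h1 h2] h3].
  have hr2 : `|h| < r by rewrite (le_lt_trans h1)// gtr_pMr// invf_lt1// ltr1n.
  have e1 : `|f (x0 + h) - P.[h]| <= c / 4 * `|h| ^+ K.
    apply: le_trans (P3 h h2) _.
    have hb : `|h| / rho <= 1 by rewrite ler_pdivrMr// mul1r.
    apply: (@le_trans _ _ (C * (`|h| / rho) ^+ K.+1)).
      by rewrite ler_wpM2l// ler_wiXn2l// divr_ge0// ltW.
    have -> : C * (`|h| / rho) ^+ K.+1 = (b * `|h|) * `|h| ^+ K.
      rewrite /b expr_div_n exprS; field.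
      by rewrite ?expf_eq0 (gt_eqF rho0) ?andbF.
    rewrite ler_wpM2r ?exprn_ge0//.
    apply: le_trans (_ : (b + 1) * `|h| <= _); first by rewrite ler_wpM2r// lerDl.
    by rewrite mulrC -ler_pdivlMr// ltr_wpDl.
  have e2 : c / 2 * `|h| ^+ K <= `|P.[h]|.
    rewrite PE normrM normrX ler_wpM2r ?exprn_ge0//.
    have := hr h hr2; have := dist_tri P`_K D.[h] 0; rewrite !subr0 -/c.
    rewrite (distrC P`_K); set u := `|_ - _|; set v := `|D.[h]|; lra.
  have := dist_tri P.[h] (f (x0 + h)) 0; rewrite !subr0 [X in _ <= X + _ -> _]distrC.
  move: e1 e2; set u := `|_ - _|; set v := `|P.[h]|; set w := `|f _|; set z := `|h| ^+ K; lra.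
left; exists (rho / 2); first by rewrite divr_gt0.
move=> h hh; apply/eqP; rewrite -normr_le0 leNgt; apply/negP => fh.
have hb n : `|f (x0 + h)| <= C * (2^-1) ^+ n.
  have [P hP] := hC n.
  have P0 : P = 0 by apply/eqP; apply: contraT => P0; exfalso; apply: none; exists n, P.
  have [_ _ P3] := hP; have hr : `|h| <= rho by rewrite (le_trans hh)// ler_pdivrMr// ler_peMr ?ler1n// ltW.
  have := P3 h hr; rewrite P0 horner0 subr0 => /le_trans; apply.
  rewrite ler_wpM2l// lerXn2r ?nnegrE ?divr_ge0 ?(ltW rho0)//.
  by rewrite ler_pdivrMr// mulrC.
have [|N hN] := @expr_unbounded R 2 ((C + 1) / `|f (x0 + h)|); first by rewrite ltr1n.
have := hb N; rewrite exprVn ler_pdivlMr ?exprn_gt0// leNgt => /negP; apply.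
by rewrite mulrC -ltr_pdivrMr//; apply: lt_le_trans hN; rewrite ltr_pM2r ?invr_gt0// ltrDl.
Qed.

End polynomial_approximation.

(** * Local structure of the curve *)

Lemma continuous_nonzero_lower (R : realType) (D : R -> R) (x0 : R) :
  {for x0, continuous D} -> D x0 != 0 ->
  exists s B : R, [/\ 0 < s, 0 < B & forall z, `|z - x0| < s -> 1 <= B * `|D z|].
Proof.
move=> cD D0; have c0 : 0 < `|D x0| by rewrite normr_gt0.
have := cD; move=> /cvgrPdist_lt/(_ (`|D x0| / 2)).
rewrite divr_gt0// => /(_ isT)/nbhs_ballP[s /= s0 hs].
exists s, (2 / `|D x0|); split; rewrite ?divr_gt0// => z zs.
rewrite mulrAC ler_pdivlMr// mul1r.
have h : `|D x0 - D z| < `|D x0| / 2.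
  by apply: hs; rewrite /ball/= distrC.
have := dist_tri (D x0) (D z) 0; rewrite !subr0.
move: h; set u := `|_ - _|; set v := `|D z|; lra.
Qed.

Section curve_regularity.
Variables (R : realType) (n : nat) (U : set R) (Q : R -> 'rV[R]_n).
Hypothesis oU : open U.

Definition qd (j : nat) (i : 'I_n) (x : R) : R := derive1n j Q x ord0 i.

Lemma qd_is_derive j i z : derivable (derive1n j Q) z 1 ->
  is_derive z 1 (qd j i) (qd j.+1 i z).
Proof.
move=> dq; have [h1 h2] := (derivable_mxP (derive1n j Q) z 1, derive_mx dq).
apply: DeriveDef; first by apply/(h1 : _ <-> _).1.
by rewrite /qd derive1nS derive1E h2 mxE.
Qed.

Definition regular_at (x0 r B : R) := forall z, `|z - x0| < r ->
  [/\ U z, forall j i, (j <= n)%N -> is_derive z 1 (qd j i) (qd j.+1 i z) &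
      forall j i, (j <= n.+1)%N -> `|qd j i z| <= B].

Lemma open_ball_sub x0 : U x0 ->
  exists r : R, 0 < r /\ forall z, `|z - x0| < r -> U z.
Proof.
move=> Ux0; have : nbhs x0 U by exact: open_nbhs_nbhs.
move=> /nbhs_ballP[r /= r0 h]; exists r; split => // z zr; apply: h.
by rewrite /ball/= distrC.
Qed.

Lemma qd_continuous x0 j i : curve_Ck U Q n.+1 -> U x0 -> (j <= n.+1)%N ->
  {for x0, continuous (qd j i)}.
Proof.
move=> [h1 h2] Ux0; rewrite leq_eqVlt => /predU1P[->|jn].
  rewrite /qd; apply: (@continuous_comp _ _ _ (derive1n n.+1 Q) (fun v : 'rV[R]_n => v ord0 i)).
    exact: h2.
  exact: coord_continuous.
apply: differentiable_continuous; apply/derivable1_diffP.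
by have [] := qd_is_derive i (h1 _ _ jn Ux0).
Qed.

Lemma curve_Ck_regular x0 : curve_Ck U Q n.+1 -> U x0 ->
  exists r B : R, [/\ 0 < r, 0 < B & regular_at x0 r B].
Proof.
move=> hQ Ux0; have [r [r0 hr]] := open_ball_sub Ux0.
pose B := 1 + \sum_(ji : 'I_n.+2 * 'I_n) `|qd ji.1 ji.2 x0|.
have B0 : 0 < B by rewrite ltr_pwDl// sumr_ge0.
have : \forall z \near x0, forall ji : 'I_n.+2 * 'I_n, `|qd ji.1 ji.2 z| <= B.
  apply: (@filter_forall _ _ (fun (ji : 'I_n.+2 * 'I_n) (z : R) => `|qd ji.1 ji.2 z| <= B) (nbhs x0)) => -[j i] /=.
  have := @qd_continuous x0 j i hQ Ux0 (ltn_ord j).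
  move=> /cvgrPdist_lt/(_ 1 ltr01); apply: filterS => z zx.
  have : `|qd j i x0| <= \sum_(ji : 'I_n.+2 * 'I_n) `|qd ji.1 ji.2 x0|.
    by rewrite (bigD1 (j, i))//= lerDl sumr_ge0.
  have := dist_tri (qd j i x0) (qd j i z) 0; rewrite /B.
  have := dist_tri (qd j i z) (qd j i x0) 0; rewrite !subr0 [X in _ <= X + _ -> _]distrC.
  move: zx; set u := `|_ - _|; set v := `|qd j i x0|; set w := `|qd j i z|; lra.
move=> /nbhs_ballP[s /= s0 hs].
exists (Num.min r s), B; split => //; first by rewrite lt_min r0.
move=> z; rewrite lt_min => /andP[zr zs]; have Uz := hr _ zr; split => //.
  by move=> j i jn; apply: qd_is_derive; exact: hQ.1.
move=> j i jn; have zb : ball x0 s z by rewrite /ball/= distrC.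
by have := hs z zb (inord j, i); rewrite /= inordK.
Qed.

(** One radius serves all orders because [pser_at_deriv] differentiates without shrinking the
    interval. *)
Lemma analytic_pser x0 : curve_analytic U Q -> U x0 ->
  exists r : R, [/\ 0 < r, forall z, `|z - x0| < r -> U z &
    forall j, (forall z, `|z - x0| < r -> derivable (derive1n j Q) z 1) /\
      forall i, pser_at x0 r (qd j i)].
Proof.
move=> hQ Ux0; have [r1 [r10 hr1]] := open_ball_sub Ux0.
have [a [r2 [r20 hr2]]] := hQ x0 Ux0.
pose r := Num.min r1 r2; have r0 : 0 < r by rewrite lt_min r10.
exists r; split => //.
  by move=> z; rewrite lt_min => /andP[/hr1].
have next j : (forall i, pser_at x0 r (qd j i)) ->
    (forall z, `|z - x0| < r -> derivable (derive1n j Q) z 1) /\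
    forall i, pser_at x0 r (qd j.+1 i).
  move=> hj; have dj z : `|z - x0| < r -> derivable (derive1n j Q) z 1.
    move=> zr; apply/derivable_mxP => k i; rewrite ord1.
    have [f' [_ /(_ z zr)[]]] := pser_at_deriv r0 (hj i).
    by [].
  split => // i; have [f' [[b hb] df']] := pser_at_deriv r0 (hj i).
  exists b => z zr; suff -> : qd j.+1 i z = f' z by exact: hb.
  have [_ <-] := qd_is_derive i (dj z zr).
  by have [_ ->] := df' z zr.
have base i : pser_at x0 r (qd 0 i).
  exists (fun j => a j ord0 i) => z; rewrite lt_min => /andP[_ zr].
  have h := hr2 z zr.
  have -> : pseries (fun j => a j ord0 i) (z - x0) =
      (fun v : 'rV[R]_n => v ord0 i) \o series (fun j => (z - x0) ^+ j *: a j).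
    apply/funext => k; rewrite /pseries /series/= summxE; apply: eq_bigr => l _.
    by rewrite mxE mulrC.
  exact: (cvg_comp _ _ h (@coord_continuous _ _ _ ord0 i (Q z))).
have all j : forall i, pser_at x0 r (qd j i).
  by elim: j => [//|j ih]; exact: (next j ih).2.
by move=> j; split => //; exact: (next j (all j)).1.
Qed.

Lemma analytic_Ck k : curve_analytic U Q -> curve_Ck U Q k.
Proof.
move=> hQ; have dQ j x : U x -> derivable (derive1n j Q) x 1.
  move=> Ux; have [r [r0 _ h]] := analytic_pser hQ Ux.
  by apply: (h j).1; rewrite subrr normr0.
split=> [j x _ Ux|x Ux]; first exact: dQ.
by apply: differentiable_continuous; apply/derivable1_diffP; exact: dQ.
Qed.

Lemma curve_det_continuous x0 : curve_Ck U Q n.+1 -> U x0 ->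
  {for x0, continuous (curve_det Q)}.
Proof.
move=> hQ Ux0.
have cs I (s : seq I) (F : I -> R -> R) : (forall i, continuous_at x0 (F i)) ->
    continuous_at x0 (fun x => \sum_(i <- s) F i x).
  move=> hF; elim: s => [|i s ih].
    by under eq_fun do rewrite big_nil; exact: cvg_cst.
  by under eq_fun do rewrite big_cons; apply: cvgD; [exact: hF|exact: ih].
have cp I (s : seq I) (F : I -> R -> R) : (forall i, continuous_at x0 (F i)) ->
    continuous_at x0 (fun x => \prod_(i <- s) F i x).
  move=> hF; elim: s => [|i s ih].
    by under eq_fun do rewrite big_nil; exact: cvg_cst.
  by under eq_fun do rewrite big_cons; apply: cvgM; [exact: hF|exact: ih].
have dE : curve_det Q = fun x => \sum_(s : 'S_n) (-1) ^+ s * \prod_i qd (s i).+1 i x.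
  apply/funext => x; rewrite /curve_det /determinant; apply: eq_bigr => s _.
  by congr (_ * _); apply: eq_bigr => i _; rewrite mxE.
suff h : continuous_at x0 (curve_det Q) by exact: h.
rewrite dE; apply: cs => s; apply: cvgM; first exact: cvg_cst.
apply: cp => i; suff h : {for x0, continuous (qd (s i).+1 i)} by exact: h.
apply: qd_continuous => //.
by rewrite ltnS ltnW.
Qed.

(** In the nondegenerate case continuity gives [K = 0]. In the non-trapped case the determinant is a
    polynomial in power series, so [poly_approx_dichotomy] applies: a zero of infinite order would
    make it vanish on an interval, against the finiteness of its zeros. *)
Lemma curve_det_lower x0 :
  non_trapped_curve U Q \/ nondegenerate_curve U Q -> U x0 ->
  exists (K : nat) (r B : R), [/\ 0 < r, 0 < B, regular_at x0 r B &
    forall z, `|z - x0| < r -> `|z - x0| ^+ K <= B * `|curve_det Q z|].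
Proof.
move=> hQ Ux0; case: hQ => [[hA hfin]|[hC hdet]]; last first.
  have [r [B [r0 B0 hreg]]] := curve_Ck_regular hC Ux0.
  have [s [c [s0 c0 hs]]] := continuous_nonzero_lower (curve_det_continuous hC Ux0) (hdet _ Ux0).
  exists 0%N, (Num.min r s), (Num.max B c); split.
  - by rewrite lt_min r0.
  - by rewrite lt_max B0.
  - move=> z; rewrite lt_min => /andP[/hreg[? ? hB] _]; split => //.
    by move=> j i jn; rewrite (le_trans (hB _ _ jn))// le_max lexx.
  - move=> z; rewrite lt_min => /andP[_ /hs]; rewrite expr0.
    move: (curve_det Q z) => D /le_trans; apply.
    by rewrite ler_wpM2r// le_max lexx orbT.
have hC := analytic_Ck n.+1 hA.
have [r [B [r0 B0 hreg]]] := curve_Ck_regular hC Ux0.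
have pad : poly_approx x0 (curve_det Q).
  rewrite /curve_det; apply: poly_approx_det => i j.
  have -> : (fun x => (\matrix_(i, j) derive1n j.+1 Q x ord0 i) i j) = qd j.+1 i.
    by apply/funext => x; rewrite mxE.
  have [s [s0 _ h]] := analytic_pser hA Ux0.
  by apply: (poly_approx_pser s0); exact: (h j.+1).2.
have [[s s0 hs]|[K [c [s [c0 s0 hs]]]]] := poly_approx_dichotomy pad.
  exfalso; pose t := Num.min (r / 2) s.
  have t0 : 0 < t by rewrite lt_min divr_gt0.
  have sub z : `[x0 - t, x0 + t]%classic z -> `|z - x0| <= t.
    by rewrite /= in_itv/= ler_distl.
  have /hfin : `[x0 - t, x0 + t] `<=` U.
    move=> z /sub zt; have [] := hreg z; last by [].
    apply: le_lt_trans zt _; rewrite gt_min; apply/orP; left.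
    by rewrite gtr_pMr// invf_lt1// ltr1n.
  have -> : [set x | `[x0 - t, x0 + t]%classic x /\ curve_det Q x = 0] = `[x0 - t, x0 + t]%classic.
    apply/seteqP; split => z /=; first by case.
    move=> zt; split => //; rewrite -(hs (z - x0)); first by congr curve_det; ring.
    by have := sub z zt; rewrite le_min => /andP[].
  (* A finite set is Lebesgue null, an interval of positive length is not. *)
  move=> /finite_set_countable/countable_lebesgue_measure0.
  rewrite lebesgue_measure_itv/= lte_fin.
  have -> : x0 - t < x0 + t by rewrite ltrD2l; lra.
  rewrite -EFinB => -[]; lra.
exists K, (Num.min r s), (Num.max B c^-1); split.
- by rewrite lt_min r0.
- by rewrite lt_max B0.
- move=> z; rewrite lt_min => /andP[/hreg[? ? hB] _]; split => //.
  by move=> j i jn; rewrite (le_trans (hB _ _ jn))// le_max lexx.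
- move=> z; rewrite lt_min => /andP[_ zs].
  have := hs (z - x0) (ltW zs).
  have -> : x0 + (z - x0) = z by ring.
  move: (curve_det Q z) => D; rewrite -ler_pdivlMl// => /le_trans; apply.
  by rewrite ler_wpM2r// le_max lexx orbT.
Qed.

Variable mu : probability (measurableTypeR R) R.
Hypothesis U_supp : msupport mu `<=` U.
Hypothesis Q_curve : non_trapped_curve U Q \/ nondegenerate_curve U Q.

(** One integer serves as inverse radius, bound, exponent and constant, so that finitely many local
    statements merge by enlarging it. On this ball the determinant can vanish only at [y], a point
    of the cover that differs in general from the centre [x]. *)
Definition local_bound (A : nat) (y x : R) := forall z, `|z - x| < A%:R^-1 ->
  [/\ U z, forall j i, (j <= n)%N -> is_derive z 1 (qd j i) (qd j.+1 i z),
      forall j i, (j <= n.+1)%N -> `|qd j i z| <= A%:R &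
      `|z - y| ^+ A <= A%:R * `|curve_det Q z|].

(** Near a point of the support the curve is under control, and near any other point [mu] is null.
    Compactness then leaves finitely many [y] and a single [A]. *)
Lemma local_bound_cover (M : R) : exists (A : nat) (cs : seq R), (0 < A)%N /\
  forall x, `|x| <= M -> pr mu (ball x A%:R^-1) = 0 \/
    exists2 y, y \in cs & local_bound A y x.
Proof.
have /choice[A hA] : forall y, exists A : nat, (0 < A)%N /\
    (pr mu (ball y A%:R^-1) = 0 \/ local_bound A y y).
  move=> y; have [ys|ys] := pselect (msupport mu y).
    have [K [r [B [r0 B0 hreg hdet]]]] := curve_det_lower Q_curve (U_supp ys).
    have [N1 hN1] := nat_gt r^-1; have [N2 hN2] := nat_gt B.
    exists (maxn (maxn N1 N2) (maxn K 1)); set A := maxn _ _.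
    have A0 : (0 < A)%N by rewrite !leq_max !orbT.
    split => //; right => z zA.
    have zr : `|z - y| < r.
      apply: lt_le_trans zA _; rewrite -[leRHS]invrK lef_pV2 ?posrE ?invr_gt0 ?ltr0n//.
      by apply: le_trans (ltW hN1) _; rewrite ler_nat !leq_max leqnn.
    have BA : B <= A%:R by apply: le_trans (ltW hN2) _; rewrite ler_nat !leq_max leqnn orbT.
    have [Uz dz bz] := hreg z zr; split => //.
      by move=> j i jn; exact: le_trans (bz _ _ jn) BA.
    apply: (@le_trans _ _ (`|z - y| ^+ K)).
      apply: ler_wiXn2l; rewrite ?normr_ge0//.
        by apply: le_trans (ltW zA) _; rewrite invf_le1 ?ltr0n// ler1n.
      by rewrite !leq_max leqnn orbT.
    by apply: le_trans (hdet z zr) _; rewrite ler_wpM2r.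
  have [V [oV Vy mV]] : exists V : set R, [/\ open V, V y & ~ (0 < mu V)%E].
    move: ys => /existsNP[V /not_implyP[oV /not_implyP[Vy mV]]].
    by exists V.
  have : nbhs y V by exact: open_nbhs_nbhs.
  move=> /nbhs_ballP[r /= r0 hr].
  have [N hN] := nat_gt r^-1; exists N.+1; split => //; left.
  apply/eqP; rewrite eq_le pr_ge0 andbT.
  have mVm : measurable (V : set (measurableTypeR R)) by exact: open_measurable.
  apply: (@le_trans _ _ (pr mu V)).
    apply: le_pr => //; first exact: measurable_ball.
    apply: subset_trans hr; apply: le_ball.
    rewrite -[leRHS]invrK lef_pV2 ?posrE ?invr_gt0 ?ltr0n//.
    by apply: le_trans (ltW hN) _; rewrite ler_nat.
  by rewrite leNgt; apply/negP => h; apply: mV; rewrite -[mu V]fineK ?fin_num_measure// lte_fin.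
(* Half radii leave room for a ball of radius 1/Am around [x] inside the ball of radius 1/A(y)
   around [y]. The sum in [Am] is just a common upper bound. *)
have [|s hs] := @interval_finite_subcover R M (fun y => (2 * (A y)%:R)^-1).
  by move=> y; rewrite invr_gt0 mulr_gt0// ltr0n; case: (hA y).
pose Am := (2 * \sum_(y <- s) A y).+1.
have hAm y : y \in s -> (2 * A y <= Am)%N.
  move=> ys; rewrite /Am leqW// leq_mul2l/= (big_rem y ys)/=.
  exact: leq_addr.
exists Am, s; split => // x /hs[y ys xy].
have [Ay0 hy] := hA y.
have AyAm : (A y <= Am)%N by apply: leq_trans (hAm y ys); rewrite leq_pmull.
have sub z : `|z - x| < Am%:R^-1 -> `|z - y| < (A y)%:R^-1.
  move=> zx; have h1 : Am%:R^-1 <= (2 * (A y)%:R)^-1 :> R.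
    by rewrite lef_pV2 ?posrE ?mulr_gt0 ?ltr0n// -natrM ler_nat hAm.
  have e : (A y)%:R^-1 = (2 * (A y)%:R)^-1 + (2 * (A y)%:R)^-1 :> R.
    by field; rewrite pnatr_eq0 -lt0n.
  have := dist_tri z x y; rewrite e; lra.
case: hy => hy; [left|right].
  apply/eqP; rewrite eq_le pr_ge0 andbT -hy.
  apply: le_pr; [exact: measurable_ball..|].
  by move=> z; rewrite /ball/= distrC => /sub; rewrite distrC.
exists y => // z /sub zy; have [Uz dz bz detz] := hy z zy; split => //.
  by move=> j i jn; apply: le_trans (bz j i jn) _; rewrite ler_nat.
apply: (@le_trans _ _ (`|z - y| ^+ A y)).
  apply: ler_wiXn2l; rewrite ?normr_ge0//.
  by apply: le_trans (ltW zy) _; rewrite invf_le1 ?ltr0n// ler1n.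
by apply: le_trans detz _; rewrite ler_wpM2r// ler_nat.
Qed.

End curve_regularity.

(** * Linearizing the phase on small pieces *)

Section fourier_char.
Variables (R : realType) (mu : probability (measurableTypeR R) R).

Lemma measurable_dotp n (xi : 'rV[R]_n) : measurable_fun setT (dotp xi).
Proof.
apply: measurable_sum => i; apply: measurable_funM; first exact: measurable_cst.
exact: measurable_coord.
Qed.

Lemma normc_fourier_pushforward n (F : measurableTypeR R -> 'rV[R]_n) xi :
  measurable_fun setT F -> Normc.normc (fourier (pushforward mu F) xi) =
  char mu (fun x => 2 * pi * dotp xi (F x)).
Proof.
move=> mF; rewrite /char /fourier.
have mf : measurable_fun setT (fun v : 'rV[R]_n => 2 * pi * dotp xi v).
  by apply: measurable_funM; [exact: measurable_cst|exact: measurable_dotp].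
have h (u : R -> R) : (forall f : measurableTypeR R -> R, measurable_fun setT f ->
      bmeas (fun x => u (f x))) -> (forall f : 'rV[R]_n -> R, measurable_fun setT f ->
      bmeas (fun x => u (f x))) ->
    fine (\int[pushforward mu F]_x (u (2 * pi * dotp xi x))%:E)%E =
    \int[mu]_x u (2 * pi * dotp xi (F x)).
  move=> hu hu'; rewrite /Rintegral integral_pushforward//.
  - by apply/measurable_EFinP; case: (hu' _ mf).
  - apply: bmeas_integrable.
    by apply: hu; exact: measurableT_comp mf mF.
by rewrite !h//; [exact: bmeas_sin|exact: bmeas_sin|exact: bmeas_cos|exact: bmeas_cos].
Qed.

Definition mphase m (eta : 'rV[R]_m) (x : measurableTypeR R) : R :=
  2 * pi * dotp eta (moment_curve m x).

Lemma measurable_mphase m (eta : 'rV[R]_m) : measurable_fun setT (mphase eta).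
Proof.
apply: measurable_funM; first exact: measurable_cst.
exact: measurableT_comp (measurable_dotp eta) (@measurable_moment_curve R m).
Qed.

Definition mfourier m (eta : 'rV[R]_m) : R :=
  Normc.normc (fourier (pushforward mu (@moment_curve R m)) eta).

Lemma mfourierE m (eta : 'rV[R]_m) : mfourier eta = char mu (mphase eta).
Proof. exact: normc_fourier_pushforward (@measurable_moment_curve R m). Qed.

Variable L : R.
Hypothesis L1 : 1 <= L.
Hypothesis muL : mu [set x | `|x| <= L] = 1%E.

Lemma mfourier_lipschitz m (u v : 'rV[R]_m) (e : R) :
  (forall i, `|u ord0 i - v ord0 i| <= e) ->
  mfourier u <= mfourier v + 4 * pi * m%:R * L ^+ m * e.
Proof.
move=> uv; rewrite !mfourierE.
have -> : 4 * pi * m%:R * L ^+ m * e = 2 * (2 * pi * (m%:R * (L ^+ m * e))) :> R by ring.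
apply: (char_le_dist (measurable_le_norm L) muL); [exact: measurable_mphase..|].
move=> x xL; rewrite /mphase -mulrBr normrM ger0_norm; last by rewrite mulr_ge0// pi_ge0.
apply: ler_wpM2l; first by rewrite mulr_ge0// pi_ge0.
rewrite /dotp -sumrB.
apply: le_trans (ler_norm_sum _ _ _) _.
have -> : m%:R * (L ^+ m * e) = \sum_(i < m) (L ^+ m * e).
  by rewrite sumr_const card_ord mulr_natl.
apply: ler_sum => i _; rewrite !mxE -mulrBl normrM mulrC; apply: ler_pM => //.
rewrite normrX (@le_trans _ _ (L ^+ i.+1))//.
  by rewrite lerXn2r ?nnegrE// (le_trans _ L1).
exact: ler_weXn2l.
Qed.

End fourier_char.

Section graph_phase.
Variables (R : realType) (m : nat) (g : R -> 'rV[R]_m).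
Hypothesis m0 : (0 < m)%N.

Let Q := graph_curve g.
Let i0 : 'I_(1 + m) := lshift m ord0.

(* The [j]-th derivative of the phase of the curve, without the linear term. *)
Definition gphase (zeta : 'rV[R]_m) (j : nat) (x : R) : R :=
  \sum_(i < m) zeta ord0 i * qd Q j (rshift 1 i) x.

Definition qphase (theta : R) (zeta : 'rV[R]_m) (j : nat) (x : R) : R :=
  dotp (row_mx theta%:M zeta) (derive1n j Q x).

Lemma qphaseE theta zeta j x :
  qphase theta zeta j x = theta * qd Q j i0 x + gphase zeta j x.
Proof.
rewrite /qphase /dotp big_split_ord/= big_ord_recl big_ord0 addr0 row_mxEl mxE eqxx mulr1n.
congr (_ + _); apply: eq_bigr => i _.
by rewrite row_mxEr.
Qed.

Variables (t rho A : R).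
Hypothesis hder : forall z, `|z - t| < rho ->
  forall j i, (j <= 1 + m)%N -> is_derive z 1 (qd Q j i) (qd Q j.+1 i z).
Hypothesis hbd : forall z, `|z - t| < rho ->
  forall j i, (j <= (1 + m).+1)%N -> `|qd Q j i z| <= A.

Lemma near_tball z : `|z - t| < rho -> \forall y \near z, `|y - t| < rho.
Proof.
move=> zt; apply/nbhs_ballP; exists (rho - `|z - t|); first by rewrite /= subr_gt0.
move=> y; rewrite /ball/= distrC => yz; have := dist_tri y z t; move: yz.
by set u := `|y - z|; set v := `|z - t|; lra.
Qed.

(** With [graph_qd2]: since the first coordinate of the graph is the identity, [theta] is absent
    from all derivatives of the phase of order at least 2. *)
Lemma graph_qd1 z : `|z - t| < rho -> qd Q 1 i0 z = 1.
Proof.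
move=> zt; have [_ <-] := hder zt i0 (leq0n _).
have -> : qd Q 0 i0 = id.
  by apply/funext => y; rewrite /qd /= /Q /graph_curve row_mxEl mxE eqxx mulr1n.
exact: derive_id.
Qed.

Lemma graph_qd2 j z : (j.+1 <= 1 + m)%N -> `|z - t| < rho -> qd Q j.+2 i0 z = 0.
Proof.
elim: j z => [|j ih] z jm zt; have [_ <-] := hder zt i0 jm.
  rewrite (@near_eq_derive _ _ _ _ (cst (1 : R))) ?derive_cst//.
  by near do apply: graph_qd1; exact: near_tball.
rewrite (@near_eq_derive _ _ _ _ (cst (0 : R))) ?derive_cst//.
by near do apply: (ih _ (ltnW jm)); exact: near_tball.
Unshelve. all: by end_near.
Qed.

Lemma gphase_is_derive zeta j z : (j <= 1 + m)%N -> `|z - t| < rho ->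
  is_derive z 1 (gphase zeta j) (gphase zeta j.+1 z).
Proof.
move=> jm zt.
have -> : gphase zeta j = \sum_(i < m) (zeta ord0 i *: qd Q j (rshift 1 i)).
  by apply/funext => y; rewrite fct_sumE.
have -> : gphase zeta j.+1 z = \sum_(i < m) zeta ord0 i *: qd Q j.+1 (rshift 1 i) z by [].
by apply: is_derive_sum => i; apply: is_deriveZ; exact: hder.
Qed.

Lemma qphase_is_derive theta zeta j z : (j <= 1 + m)%N -> `|z - t| < rho ->
  is_derive z 1 (qphase theta zeta j) (qphase theta zeta j.+1 z).
Proof.
move=> jm zt.
have -> : qphase theta zeta j = theta *: qd Q j i0 + gphase zeta j.
  by apply/funext => y; rewrite qphaseE.
rewrite qphaseE; apply: is_deriveD; last exact: gphase_is_derive.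
by apply: is_deriveZ; exact: hder.
Qed.

Lemma gphase_bound (zeta : 'rV[R]_m) (Z : R) j z : (j <= (1 + m).+1)%N -> `|z - t| < rho ->
  (forall i, `|zeta ord0 i| <= Z) -> `|gphase zeta j z| <= m%:R * Z * A.
Proof.
move=> jm zt hZ; apply: le_trans (ler_norm_sum _ _ _) _.
have -> : m%:R * Z * A = \sum_(i < m) Z * A.
  by rewrite sumr_const card_ord -[RHS]mulr_natl mulrA.
by apply: ler_sum => i _; rewrite normrM ler_pM// hbd.
Qed.

(* The frequency at which the Taylor expansion of the phase sees the piece
   [x |-> r x + t]. *)
Definition wfreq theta (zeta : 'rV[R]_m) (r : R) : 'rV[R]_m :=
  \row_(k < m) (qphase theta zeta k.+1 t / k.+1`!%:R * r ^+ k.+1).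

Variables (mu : probability (measurableTypeR R) R) (L : R).
Hypothesis L1 : 1 <= L.
Hypothesis muL : mu [set x | `|x| <= L] = 1%E.
Variable U : set R.
Hypothesis hU : forall z, `|z - t| < rho -> U z.
Hypothesis mQ : measurable_fun [set: measurableTypeR R] (Q \_ U).

(** Taylor expansion at [t] to degree m: [char_shift] drops the constant term, and the others form
    the phase of the moment curve at [wfreq]. The remainder is controlled by the derivative of order
    m + 1 >= 2, free of [theta], so the error is uniform in [theta]. *)
Lemma piece_char theta (zeta : 'rV[R]_m) (Z r : R) :
  (forall i, `|zeta ord0 i| <= Z) -> `|r| * L < rho ->
  char mu (fun x : measurableTypeR R => 2 * pi * dotp (row_mx theta%:M zeta)
     ((Q \_ U) (r * x + t))) <=
  mfourier mu (wfreq theta zeta r) +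
    4 * pi * (m%:R * Z * A * (`|r| * L) ^+ (1 + m)).
Proof.
move=> hZ rL.
set xi := row_mx _ _; set eta := wfreq _ _ _.
have c0 : 0 <= 2 * pi :> R by rewrite mulr_ge0// pi_ge0.
have Z0 : 0 <= Z by exact: le_trans (normr_ge0 _) (hZ (Ordinal m0)).
have rL0 : 0 <= `|r| * L by rewrite mulr_ge0// (le_trans _ L1).
have A0 : 0 <= A by have := @hbd t _ 0%N i0 isT; rewrite subrr normr0 => /(_ (le_lt_trans rL0 rL)); apply: le_trans.
have mL : measurable_fun setT (fun x : measurableTypeR R => 2 * pi * dotp xi ((Q \_ U) (r * x + t))).
  apply: measurable_funM; first exact: measurable_cst.
  apply: (measurableT_comp (measurable_dotp xi)).
  exact: (measurableT_comp mQ (measurable_affine r t)).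
have mM := measurable_mphase eta.
pose c := 2 * pi * qphase theta zeta 0 t.
have mMc : measurable_fun setT (fun x => mphase eta x + c).
  by apply: measurable_funD => //; exact: measurable_cst.
rewrite mfourierE.
apply: le_trans (lerD (char_shift mu c mM) (lexx _)).
have -> : 4 * pi * (m%:R * Z * A * (`|r| * L) ^+ (1 + m)) =
  2 * (2 * pi * (m%:R * Z * A * (`|r| * L) ^+ (1 + m))) by ring.
apply: (char_le_dist (measurable_le_norm L) muL mL mMc) => x xL.
have hx : `|r * x + t - t| <= `|r| * L by rewrite addrK normrM ler_wpM2l.
rewrite /patch ifT; last by rewrite inE; apply: hU; exact: le_lt_trans rL.
have -> : 2 * pi * dotp xi (Q (r * x + t)) - (mphase eta x + c) =
  2 * pi * (qphase theta zeta 0 (r * x + t) -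
    \sum_(j < 1 + m) qphase theta zeta j t / j`!%:R * (r * x + t - t) ^+ j).
  have -> : dotp xi (Q (r * x + t)) = qphase theta zeta 0 (r * x + t) by [].
  rewrite big_ord_recl/= expr0 mulr1 divr1 /mphase /c /dotp.
  have -> : \sum_(i < m) eta ord0 i * moment_curve m x ord0 i =
     \sum_(i < m) qphase theta zeta (bump 0 i) t / (bump 0 i)`!%:R * (r * x + t - t) ^+ bump 0 i.
    apply: eq_bigr => i _; rewrite /eta /wfreq /moment_curve !mxE /bump leq0n add1n addrK exprMn; ring.
  by ring.
rewrite normrM (ger0_norm c0) ler_wpM2l//.
have M0 : 0 <= m%:R * Z * A by rewrite !mulr_ge0.
apply: (@le_trans _ _ (m%:R * Z * A * `|r * x + t - t| ^+ (1 + m))); last first.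
  by rewrite ler_wpM2l// lerXn2r ?nnegrE.
apply: (@taylor_bound _ (1 + m) (qphase theta zeta) t (`|r| * L)) => //.
- move=> j z jm zr; apply: qphase_is_derive; first exact: ltnW.
  exact: le_lt_trans rL.
- move=> z zr; have zt : `|z - t| < rho by exact: le_lt_trans rL.
  have -> : qphase theta zeta (1 + m) z = gphase zeta (1 + m) z.
    rewrite qphaseE; have -> : qd Q (1 + m) i0 z = 0; last by rewrite mulr0 add0r.
    by have := @graph_qd2 m.-1 z; rewrite -[(1 + m)%N]/m.+1 (prednK m0) => ->.
  exact: gphase_bound.
Qed.

End graph_phase.

(** * Separation of frequencies *)

Lemma det_bound (R : realType) n (M : 'M[R]_n) (A : R) :
  (forall i j, `|M i j| <= A) -> `|\det M| <= n`!%:R * A ^+ n.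
Proof.
move=> hM; rewrite /determinant; apply: le_trans (ler_norm_sum _ _ _) _.
have -> : n`!%:R * A ^+ n = \sum_(s : 'S_n) A ^+ n.
  by rewrite sumr_const card_Sn mulr_natl.
apply: ler_sum => s _; rewrite normrM normrX normrN1 expr1n mul1r normr_prod.
have -> : A ^+ n = \prod_(i < n) A by rewrite prodr_const card_ord.
by apply: ler_prod => i _; rewrite normr_ge0 hM.
Qed.

(** A quantitative Cramer rule: v det M = (v M) adj M, with the cofactors bounded by the Leibniz
    formula. *)
Lemma det_le_image (R : realType) n (M : 'M[R]_n) (v : 'rV[R]_n) (A E : R) i :
  (forall i j, `|M i j| <= A) -> (forall j, `|(v *m M) ord0 j| <= E) -> 0 <= E ->
  `|\det M| * `|v ord0 i| <= n%:R * (E * (n.-1`!%:R * A ^+ n.-1)).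
Proof.
move=> hM hv E0.
have e : \det M * v ord0 i = ((v *m M) *m \adj M) ord0 i.
  by rewrite -mulmxA mul_mx_adj mul_mx_scalar mxE.
rewrite -normrM e mxE; apply: le_trans (ler_norm_sum _ _ _) _.
have -> : n%:R * (E * (n.-1`!%:R * A ^+ n.-1)) = \sum_(j < n) (E * (n.-1`!%:R * A ^+ n.-1)).
  by rewrite sumr_const card_ord mulr_natl.
apply: ler_sum => j _; rewrite normrM; apply: ler_pM => //.
rewrite mxE /cofactor normrM normrX normrN1 expr1n mul1r.
by apply: det_bound => k l; rewrite !mxE.
Qed.

Lemma ord_argmax (R : realType) m (f : 'I_m -> R) : (0 < m)%N ->
  exists k, forall l, f l <= f k.
Proof.
move=> m0; exists [arg max_(k > Ordinal m0) f k]%O => l.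
by case: (@Order.TotalTheory.arg_maxP _ _ _ (Ordinal m0) xpredT f isT) => k _; apply.
Qed.

Section frequency_separation.
Variables (R : realType) (m : nat) (g : R -> 'rV[R]_m).
Hypothesis m0 : (0 < m)%N.
Let Q := graph_curve g.
Let i0 : 'I_(1 + m) := lshift m ord0.
Variables (U : set R) (A : nat) (zeta : 'rV[R]_m) (Z : R).
Hypothesis A0 : (0 < A)%N.
Hypothesis hZ : forall i, `|zeta ord0 i| <= Z.
Hypothesis hZe : exists i, `|zeta ord0 i| = Z.

Lemma Z_ge0 : 0 <= Z.
Proof. exact: le_trans (normr_ge0 _) (hZ (Ordinal m0)). Qed.

(** The loss in [some_gphase_large]: one [A] from the lower bound on the determinant, the rest from
    [det_le_image] in size 1 + m. *)
Definition sepD : R := A%:R * ((1 + m)%:R * (m`!%:R * A%:R ^+ m)).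

Lemma sepD_gt0 : 0 < sepD.
Proof. by rewrite /sepD !mulr_gt0 ?exprn_gt0 ?ltr0n// fact_gt0. Qed.

Lemma qd_i0_eq (y y' t t' : R) j : local_bound U Q A y t -> local_bound U Q A y' t' ->
  (0 < j)%N -> (j <= 1 + m)%N -> qd Q j i0 t = qd Q j i0 t'.
Proof.
move=> h h'; have rho0 : 0 < A%:R^-1 :> R by rewrite invr_gt0 ltr0n.
have hd s (hs : local_bound U Q A y s) := fun z zs => let: And4 _ d _ _ := hs z zs in d.
have d z (zs : `|z - t| < A%:R^-1) := let: And4 _ d _ _ := h z zs in d.
have d' z (zs : `|z - t'| < A%:R^-1) := let: And4 _ d _ _ := h' z zs in d.
case: j => [//|[|j]] _ jm.
  by rewrite (graph_qd1 d) ?(graph_qd1 d') ?subrr ?normr0.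
by rewrite (graph_qd2 d) ?(graph_qd2 d') ?subrr ?normr0 ?(ltnW jm).
Qed.

(** The first entry of [v] is chosen to annihilate the first entry of v M; the remaining entries are
    the derivatives of orders 2 to m + 1 of <zeta, g>. If all were small, [det_le_image] would make
    zeta small. *)
Lemma some_gphase_large (y t kap : R) : local_bound U Q A y t -> 0 <= kap -> kap <= `|t - y| ->
  exists k : 'I_m, kap ^+ A * Z <= sepD * `|gphase g zeta k.+2 t|.
Proof.
move=> h kap0 hk; have rho0 : 0 < A%:R^-1 :> R by rewrite invr_gt0 ltr0n.
have tt : `|t - t| < A%:R^-1 by rewrite subrr normr0.
have d z (zs : `|z - t| < A%:R^-1) := let: And4 _ d _ _ := h z zs in d.
have [_ _ hb hdet] := h t tt.
have [i Zi] := hZe.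
have [k hmax] := ord_argmax (fun l : 'I_m => `|gphase g zeta l.+2 t|) m0.
exists k.
pose M : 'M[R]_(1 + m) := \matrix_(i, j) derive1n j.+1 Q t ord0 i.
pose v : 'rV[R]_(1 + m) := row_mx (- gphase g zeta 1 t)%:M zeta.
have hM i1 j1 : `|M i1 j1| <= A%:R.
  by rewrite mxE; apply: hb; rewrite ltnS; exact: ltnW.
have vM j : `|(v *m M) ord0 j| <= `|gphase g zeta k.+2 t|.
  have -> : (v *m M) ord0 j = - gphase g zeta 1 t * qd Q j.+1 i0 t + gphase g zeta j.+1 t.
    rewrite mxE big_split_ord/= big_ord_recl big_ord0 addr0 row_mxEl !mxE eqxx mulr1n.
    by congr (_ + _); apply: eq_bigr => l _; rewrite row_mxEr mxE.
  case: j => -[|j] /= jm.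
    by rewrite (graph_qd1 d)// mulr1 addNr normr0.
  rewrite (graph_qd2 d)//; last exact: ltnW.
  by rewrite mulr0 add0r; exact: (hmax (Ordinal (jm : (j < m)%N))).
have := det_le_image (rshift 1 i) hM vM (normr_ge0 _).
rewrite row_mxEr Zi /= => hcr.
have hka : kap ^+ A <= A%:R * `|\det M|.
  apply: le_trans (hdet); by rewrite lerXn2r ?nnegrE.
apply: (@le_trans _ _ (A%:R * `|\det M| * Z)); first by rewrite ler_wpM2r// Z_ge0.
rewrite -mulrA /sepD -[leRHS]mulrA; apply: ler_wpM2l => //.
apply: le_trans hcr _; rewrite -[leRHS]mulrA; apply: ler_wpM2l => //.
by rewrite mulrC.
Qed.

(** This is where [theta] cancels: the ratio [r] is common, and the first coordinate of the curve
    has the same derivatives at [t] and [t']. *)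
Lemma wfreq_diff (y y' t t' theta r : R) (k : 'I_m) :
  local_bound U Q A y t -> local_bound U Q A y' t' ->
  wfreq g t theta zeta r ord0 k - wfreq g t' theta zeta r ord0 k =
  (gphase g zeta k.+1 t - gphase g zeta k.+1 t') / k.+1`!%:R * r ^+ k.+1.
Proof.
move=> h h'; have jm : (k.+1 <= 1 + m)%N by rewrite add1n ltnS ltnW.
have e := qd_i0_eq h h' (ltn0Sn k) jm.
have wE s : wfreq g s theta zeta r ord0 k =
    (theta * qd Q k.+1 i0 s + gphase g zeta k.+1 s) / k.+1`!%:R * r ^+ k.+1.
  by rewrite mxE qphaseE.
rewrite !wE e; move: (qd _ _ _ _) (gphase _ _ _ t) (gphase _ _ _ t') => a b c.
by ring.
Qed.

Lemma wfreq_diff_bound (y y' t t' theta r : R) (k : 'I_m) :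
  local_bound U Q A y t -> local_bound U Q A y' t' -> `|r| <= 1 ->
  `|wfreq g t theta zeta r ord0 k - wfreq g t' theta zeta r ord0 k| <= 2 * (m%:R * Z * A%:R).
Proof.
move=> h h' r1; rewrite (wfreq_diff _ _ _ h h').
have rho0 : 0 < A%:R^-1 :> R by rewrite invr_gt0 ltr0n.
have b z (zs : `|z - t| < A%:R^-1) := let: And4 _ _ b _ := h z zs in b.
have b' z (zs : `|z - t'| < A%:R^-1) := let: And4 _ _ b _ := h' z zs in b.
have km : (k.+1 <= (1 + m).+1)%N by exact: leq_trans (ltn_ord k) (leqW (leqnSn m)).
have b1 : `|gphase g zeta k.+1 t| <= m%:R * Z * A%:R.
  by apply: (gphase_bound b) => //; rewrite subrr normr0.
have b2 : `|gphase g zeta k.+1 t'| <= m%:R * Z * A%:R.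
  by apply: (gphase_bound b') => //; rewrite subrr normr0.
rewrite 2!normrM normfV normrX (@ger0_norm _ (k.+1`!%:R))//.
apply: (@le_trans _ _ `|gphase g zeta k.+1 t - gphase g zeta k.+1 t'|).
  rewrite -[leRHS]mulr1; apply: ler_pM; rewrite ?exprn_ge0 ?mulr_ge0 ?invr_ge0 ?exprn_ile1//.
  by rewrite ler_pdivrMr ?ltr0n ?fact_gt0// ler_peMr// ler1n fact_gt0.
move: b1 b2; move: (gphase _ _ _ t) (gphase _ _ _ t') => x x' b1 b2.
by have := ler_normB x x'; move/le_trans; apply; lra.
Qed.

(** The k-th frequency has derivative [gphase k.+2] times r^(k+1) / (k+1)!, up to a term that
    cancels in differences. For some k it is large at [t], and the smallness of |t' - t| keeps at
    least half of that lower bound up to [t'], so the mean value theorem applies. The exponent m is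
    the worst case of k + 1. *)
Lemma wfreq_separation (y y' t t' theta r kap : R) :
  local_bound U Q A y t -> local_bound U Q A y' t' -> 0 <= kap -> kap <= `|t - y| ->
  `|r| <= 1 -> `|t' - t| < A%:R^-1 ->
  2 * sepD * m%:R * A%:R * `|t' - t| <= kap ^+ A ->
  (forall k, `|wfreq g t' theta zeta r ord0 k - wfreq g t theta zeta r ord0 k| <= 2) ->
  kap ^+ A * Z * `|r| ^+ m * `|t' - t| <= 4 * sepD * m`!%:R.
Proof.
move=> h h' kap0 hk r1 t't hsmall hfreq.
have [k hlarge] := some_gphase_large h kap0 hk.
have rho0 : 0 < A%:R^-1 :> R by rewrite invr_gt0 ltr0n.
have d z (zs : `|z - t| < A%:R^-1) := let: And4 _ d _ _ := h z zs in d.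
have b z (zs : `|z - t| < A%:R^-1) := let: And4 _ _ b _ := h z zs in b.
have sub z : `|z - t| <= `|t' - t| -> `|z - t| < A%:R^-1 by move/le_lt_trans; exact.
have km := ltn_ord k.
have [c ct e] : exists2 c : R, `|c - t| <= `|t' - t| &
    gphase g zeta k.+1 t' - gphase g zeta k.+1 t = gphase g zeta k.+2 c * (t' - t).
  apply: mvt_ball => z /sub zt; apply: (gphase_is_derive d zeta) => //.
  by rewrite ltnW.
have lip : `|gphase g zeta k.+2 c - gphase g zeta k.+2 t| <= m%:R * Z * A%:R * `|c - t|.
  apply: (@lipschitz_ball _ _ (gphase g zeta k.+3)) => z zc.
    by apply: (gphase_is_derive d zeta) => //; apply: sub; exact: le_trans ct.
  apply: (gphase_bound b) => //; apply: sub; exact: le_trans ct.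
have D0 := sepD_gt0.
have Z0 := Z_ge0.
have hf : `|gphase g zeta k.+2 c| * `|t' - t| / k.+1`!%:R * `|r| ^+ k.+1 <= 2.
  have := hfreq k; rewrite (wfreq_diff _ _ _ h' h) e.
  move: (gphase _ _ _ c) => x.
  by rewrite !normrM normfV normrX (@ger0_norm _ (k.+1`!%:R)).
move: hlarge lip hf; move: (gphase g zeta k.+2 c) (gphase g zeta k.+2 t) => Gc Gt hlarge lip.
clear e hfreq d b sub h h'.
have hc : kap ^+ A * Z <= 2 * sepD * `|Gc|.
  have h1 : 2 * sepD * `|Gc - Gt| <= kap ^+ A * Z.
    apply: (@le_trans _ _ (2 * sepD * (m%:R * Z * A%:R * `|t' - t|))).
      apply: ler_wpM2l; first by rewrite mulr_ge0// ltW.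
      by apply: le_trans lip _; rewrite ler_wpM2l// !mulr_ge0.
    have -> : 2 * sepD * (m%:R * Z * A%:R * `|t' - t|) =
      (2 * sepD * m%:R * A%:R * `|t' - t|) * Z by ring.
    by rewrite ler_wpM2r.
  have : sepD * `|Gt| <= sepD * (`|Gc - Gt| + `|Gc|).
    rewrite ler_wpM2l ?(ltW D0)//.
    have := dist_tri Gt Gc 0.
    by rewrite !subr0 (distrC Gt).
  rewrite mulrDr; lra.
set G := `|Gc| in hc *; set T := `|t' - t| => hf.
have F0 : 0 < k.+1`!%:R :> R by rewrite ltr0n fact_gt0.
have rk : `|r| ^+ m <= `|r| ^+ k.+1 by rewrite ler_wiXn2l.
have Fm : k.+1`!%:R <= m`!%:R :> R by rewrite ler_nat leq_fact.
have T0 : 0 <= T by rewrite normr_ge0.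
have G0 : 0 <= G by rewrite normr_ge0.
have hf2 : G * T * `|r| ^+ m <= 2 * m`!%:R.
  apply: (@le_trans _ _ (G * T * `|r| ^+ k.+1)).
    by rewrite ler_wpM2l// mulr_ge0.
  apply: (@le_trans _ _ (2 * k.+1`!%:R)); last by rewrite ler_wpM2l.
  by rewrite -ler_pdivrMr// mulrAC.
apply: (@le_trans _ _ (2 * sepD * G * `|r| ^+ m * T)).
  by rewrite ler_wpM2r// ler_wpM2r// exprn_ge0.
have -> : 2 * sepD * G * `|r| ^+ m * T = 2 * sepD * (G * T * `|r| ^+ m) by ring.
have -> : 4 * sepD * m`!%:R = 2 * sepD * (2 * m`!%:R) by ring.
by rewrite ler_wpM2l// mulr_ge0// ltW.
Qed.

End frequency_separation.

(** * The energy estimate *)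

(** Cut [-M, M] into cells of length [ell]. Two points of one cell are within [ell], hence within
    [Lam], so each cell is charged to one ball around any of its points. *)
Lemma cluster_mass (R : realType) (I : eqType) (s : seq I) (P : pred I) (wt t : I -> R)
    (M ell Lam mass : R) :
  0 < ell -> 0 <= M -> (forall i, i \in s -> 0 <= wt i) ->
  (forall i, i \in s -> `|t i| <= M) ->
  (forall x, \sum_(i <- s | P i && (`|t i - x| <= Lam)) wt i <= mass) ->
  (forall i j, i \in s -> j \in s -> P i -> P j -> `|t i - t j| <= ell -> `|t i - t j| <= Lam) ->
  \sum_(i <- s | P i) wt i <= (2 * M / ell + 1) * mass.
Proof.
move=> ell0 M0 wt0 tM hmass hsep.
have mass0 : 0 <= mass.
  apply: le_trans (hmass 0); rewrite big_seq_cond sumr_ge0// => i /andP[si _]; exact: wt0.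
pose N := Num.trunc (2 * M / ell).
have N0 : 0 <= 2 * M / ell by rewrite divr_ge0 ?mulr_ge0// ltW.
pose b i : 'I_N.+1 := inord (Num.trunc ((t i + M) / ell)).
have bE i : i \in s -> (b i)%:R <= (t i + M) / ell < (b i)%:R + 1.
  move=> si; have tM1 := tM i si.
  have h0 : 0 <= (t i + M) / ell.
    by rewrite divr_ge0 ?(ltW ell0)//; move: tM1; rewrite ler_norml; lra.
  rewrite /b inordK.
    have /andP[h1 h2] := truncn_itv h0.
    by rewrite h1/= natr1.
  rewrite ltnS; apply: le_truncn.
  rewrite ler_wpM2r ?invr_ge0 ?(ltW ell0)//.
  by move: tM1; rewrite ler_norml; lra.
rewrite (partition_big b xpredT)//=.
apply: (@le_trans _ _ (\sum_(j < N.+1) mass)).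
  apply: ler_sum => j _.
  have [/hasP[i0 si0 /andP[Pi0 /eqP bi0]]|/hasPn none] := boolP (has (fun i => P i && (b i == j)) s); last first.
    rewrite big_seq_cond big1// => i /andP[si Pi].
    by have := none i si; rewrite Pi.
  apply: le_trans (hmass (t i0)).
  rewrite big_seq_cond [leRHS]big_seq_cond.
  rewrite big_mkcond [leRHS]big_mkcond/=; apply: ler_sum => i _.
  case: ifPn => [/and3P[si Pi /eqP bi]|_]; last first.
    by case: ifPn => // /andP[si _]; exact: wt0.
  rewrite si Pi /= hsep//.
  have := bE i si; have := bE i0 si0; rewrite bi bi0 => /andP[a1 a2] /andP[a3 a4].
  have h : `|(t i + M) / ell - (t i0 + M) / ell| <= 1.
    by rewrite ler_norml; lra.
  move: h; rewrite -mulrBl opprD addrACA subrr addr0 normrM normfV (gtr0_norm ell0).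
  by rewrite ler_pdivrMr// mul1r.
rewrite sumr_const card_ord -[_ *+ N.+1]mulr_natl ler_wpM2r//.
by rewrite -natr1 lerD2r; have /andP[] := truncn_itv N0.
Qed.

Lemma sum_cover (R : realType) (I J : eqType) (s : seq I) (rs : seq J) (P : pred I)
    (h : I -> J) (F : I -> R) :
  (forall i, i \in s -> 0 <= F i) -> (forall i, i \in s -> h i \in rs) ->
  \sum_(i <- s | P i) F i <= \sum_(r <- rs) \sum_(i <- s | P i && (h i == r)) F i.
Proof.
move=> F0 hrs; under [leRHS]eq_bigr do rewrite big_mkcondr.
rewrite exchange_big/= big_seq_cond [leRHS]big_seq_cond; apply: ler_sum => i /andP[si Pi].
rewrite (perm_big _ (perm_to_rem (hrs i si)))/= big_cons eqxx lerDl sumr_ge0// => r _.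
by case: ifP => // _; exact: F0.
Qed.

Lemma rVB_E (R : realType) m (u v : 'rV[R]_m) k : (u - v) ord0 k = u ord0 k - v ord0 k.
Proof. by rewrite !mxE. Qed.

Section energy.
Variables (R : realType) (mu : probability (measurableTypeR R) R) (L : R).
Hypothesis L1 : 1 <= L.
Hypothesis muL : mu [set x | `|x| <= L] = 1%E.
Variables (ss CF : R).
Hypothesis hF : forall x rho : R, 0 < rho -> pr mu (cball x rho) <= CF * rho `^ ss.
Variables (m : nat) (g : R -> 'rV[R]_m) (U : set R) (A : nat).
Hypothesis m0 : (0 < m)%N.
Hypothesis A0 : (0 < A)%N.
Variables (zeta : 'rV[R]_m) (Z theta : R).
Hypothesis hZ : forall i, `|zeta ord0 i| <= Z.
Hypothesis hZe : exists i, `|zeta ord0 i| = Z.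
Hypothesis Z0 : 0 < Z.
Variables (W : seq (R * R * R)) (del rl kap : R).
Hypothesis dW : decomposes mu W.
Hypothesis rl0 : 0 < rl.
Hypothesis Wr : forall w, w \in W -> rl <= `|wr w| /\ `|wr w| <= del.
Hypothesis del1 : del <= 1.
Hypothesis del0 : 0 < del.
Hypothesis kap0 : 0 < kap.

Let Q := graph_curve g.

(** The centre keeps distance [kap] from the only nearby point where the determinant may
    degenerate. *)
Definition good (w : R * R * R) : Prop :=
  exists y, local_bound U Q A y (wt w) /\ kap <= `|wt w - y|.

Lemma word_center w : w \in W -> `|wt w| <= 2 * L.
Proof.
move=> wW; rewrite leNgt; apply/negP => h.
have := word_ball_gt0 muL dW wW; rewrite ltNge => /negP; apply.
have -> : 0 = pr mu (~` [set x : measurableTypeR R | `|x| <= L]).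
  by rewrite /pr (probability_setC mu (measurable_le_norm L)) muL subee.
apply: le_pr; [exact: measurable_cball|exact: measurableC (measurable_le_norm L)|].
move=> z; rewrite /cball/= => zw; apply/negP; rewrite -ltNge.
have {}zw : `|(z : R) - wt w| <= L * `|wr w| := zw.
have : L * `|wr w| <= L * 1.
  by rewrite ler_wpM2l ?(le_trans ler01)// (le_trans (Wr wW).2).
have := dist_tri (wt w) (z : R) 0; rewrite !subr0 (distrC (wt w)).
by rewrite mulr1; lra.
Qed.

(** [ell] is a distance below which [wfreq_separation] applies, and [Lam] is the distance it then
    enforces. In [Mtot] the term [L * del] is the radius of a piece around its centre. *)
Definition ell : R := Num.min (2 * A%:R)^-1 (kap ^+ A / (2 * sepD R m A * m%:R * A%:R)).
Definition Lam : R := 4 * sepD R m A * m`!%:R / (kap ^+ A * Z * rl ^+ m).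
Definition Mtot : R := (4 * L / ell + 1) * (CF * (Lam + L * del) `^ ss).

Lemma sepDm_gt0 : 0 < 2 * sepD R m A * m%:R * A%:R :> R.
Proof.
have h := sepD_gt0 R m A0.
by apply: mulr_gt0; last rewrite ltr0n//; apply: mulr_gt0; last rewrite ltr0n//; exact: mulr_gt0.
Qed.

Lemma ell_gt0 : 0 < ell.
Proof.
rewrite lt_min; apply/andP; split; first by rewrite invr_gt0 mulr_gt0// ltr0n.
by rewrite divr_gt0 ?exprn_gt0// sepDm_gt0.
Qed.

Lemma Lam_gt0 : 0 < Lam.
Proof.
have h := sepD_gt0 R m A0.
apply: divr_gt0; last by rewrite !mulr_gt0 ?exprn_gt0.
by apply: mulr_gt0; [exact: mulr_gt0|rewrite ltr0n fact_gt0].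
Qed.

Definition freq w : 'rV[R]_m := wfreq g (wt w) theta zeta (wr w).

(* The centers of such words lie in at most [4 L / ell + 1] clusters of radius
   [Lam], and Frostman's bound applies to each cluster. *)
Lemma close_freq_mass (P : pred (R * R * R)) (r : R) :
  (forall w, w \in W -> P w -> good w /\ wr w = r) ->
  (forall w w', w \in W -> w' \in W -> P w -> P w' ->
     forall k, `|freq w ord0 k - freq w' ord0 k| <= 2) ->
  \sum_(w <- W | P w) wp w <= Mtot.
Proof.
move=> hP hclose.
have [W0 W1 WE] := dW.
have -> : Mtot = (2 * (2 * L) / ell + 1) * (CF * (Lam + L * del) `^ ss).
  by rewrite /Mtot; congr ((_ / _ + 1) * _); ring.
have L0 : 0 < L by exact: lt_le_trans L1.
apply: (@cluster_mass _ _ _ _ _ (@wt R) _ _ Lam) => //.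
- exact: ell_gt0.
- by rewrite mulr_ge0// ltW.
- by move=> w /W0/ltW.
- exact: word_center.
- move=> x; apply: (@le_trans _ _ (\sum_(w <- W | `|wt w - x| <= Lam) wp w)).
    rewrite big_mkcond [leRHS]big_mkcond/= big_seq [leRHS]big_seq; apply: ler_sum => w /W0 w0.
    by case: (P w) => //=; case: ifP => // _; exact: ltW.
  apply: le_trans (word_mass_ball L1 muL x Lam dW (fun w h => (Wr h).2)) _.
  by apply: hF; apply: addr_gt0; [exact: Lam_gt0|exact: mulr_gt0].
move=> w w' wW w'W Pw Pw' hell.
have [[y' [ly' ky']] r'] := hP w' w'W Pw'; have [[y [ly ky]] rw] := hP w wW Pw.
have [r1 r2] := Wr w'W.
have hr : `|wr w'| <= 1 by exact: le_trans del1.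
have := wfreq_separation m0 A0 hZ hZe ly' ly (ltW kap0) ky' hr
   (theta := theta).
move=> /(_ _ _ _) h.
have e1 : `|wt w - wt w'| < A%:R^-1.
  apply: le_lt_trans hell _; rewrite /ell gt_min; apply/orP; left.
  by rewrite ltf_pV2 ?posrE ?mulr_gt0 ?ltr0n// ltr_pMl ?ltr0n// ltr1n.
have e2 : 2 * sepD R m A * m%:R * A%:R * `|wt w - wt w'| <= kap ^+ A.
  rewrite mulrC -ler_pdivlMr ?sepDm_gt0//.
  by apply: le_trans hell _; rewrite /ell ge_min lexx orbT.
have e3 k : `|wfreq g (wt w) theta zeta (wr w') ord0 k -
    wfreq g (wt w') theta zeta (wr w') ord0 k| <= 2.
  by have := hclose w w' wW w'W Pw Pw' k; rewrite /freq rw r'.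
have := h e1 e2 e3.
rewrite /Lam ler_pdivlMr ?mulr_gt0 ?exprn_gt0//; apply: le_trans.
rewrite mulrC ler_wpM2r//; apply: ler_wpM2l; first by rewrite mulr_ge0 ?exprn_ge0 ?ltW.
by rewrite lerXn2r ?nnegrE ?normr_ge0 ?(ltW rl0).
Qed.

Variables (p tau B : R).
Hypothesis p0 : 0 <= p.
Hypothesis tau0 : 0 < tau.
Hypothesis tau1 : tau <= 1.
(** The added 1 keeps the constant positive and gives [c <= 2^-1]. *)
Definition lipK : R := 4 * pi * m%:R * L ^+ m + 1.
(** The bound of [wfreq_diff_bound] on frequency differences, plus room for balls of radius [c]. *)
Definition rad : R := 2 * (m%:R * Z * A%:R) + 1.
Hypothesis hB : (\int[lebesgue_rV R m]_(xi in ball (0%R : 'rV[R]_m) rad)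
  ((mfourier mu xi `^ p)%R)%:E <= B%:E)%E.
Let c : R := tau / (2 * lipK).
Definition EB : R := Mtot * B / ((tau / 2) `^ p * (2 * c) ^+ m).

Lemma lipK_ge1 : 1 <= lipK.
Proof. by rewrite /lipK lerDr !mulr_ge0 ?pi_ge0 ?exprn_ge0 ?(le_trans ler01 L1). Qed.

Lemma c_gt0 : 0 < c.
Proof. by rewrite divr_gt0// mulr_gt0// (lt_le_trans _ lipK_ge1). Qed.

Lemma c_le : c <= 2^-1.
Proof.
rewrite /c ler_pdivrMr ?mulr_gt0 ?(lt_le_trans _ lipK_ge1)//.
by rewrite mulrA mulVf ?mul1r ?(le_trans tau1 lipK_ge1).
Qed.

Hypothesis CF0 : 0 < CF.

Lemma Mtot_gt0 : 0 < Mtot.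
Proof.
have L0 : 0 < L by exact: lt_le_trans L1.
have e0 := ell_gt0; have l0 := Lam_gt0.
apply: mulr_gt0; first by apply: addr_gt0 => //; apply: divr_gt0 => //; exact: mulr_gt0.
by apply: mulr_gt0 => //; apply: powR_gt0; apply: addr_gt0 => //; exact: mulr_gt0.
Qed.

(** [lp_mass] is applied to the frequencies translated by that of [w0]: they lie in a ball of radius
    independent of [theta], and closeness of two of them is closeness of the original frequencies,
    so [close_freq_mass] supplies [M]. *)
Lemma large_freq_mass (P : pred (R * R * R)) (r : R) w0 :
  (forall w, w \in W -> P w -> good w /\ wr w = r) -> w0 \in W -> P w0 ->
  \sum_(w <- W | P w && (tau < mfourier mu (freq w - freq w0))) wp w <= EB.
Proof.
move=> hP w0W Pw0; have [W0 _ _] := dW.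
pose P' w := P w && (tau < mfourier mu (freq w - freq w0)).
have K0 : 0 < lipK by exact: lt_le_trans lipK_ge1.
have den : 0 < (tau / 2) `^ p * (2 * c) ^+ m.
  have h := c_gt0; apply: mulr_gt0; first by rewrite powR_gt0// divr_gt0.
  by apply: exprn_gt0; exact: mulr_gt0.
rewrite /EB ler_pdivlMr// -big_filter.
have := @lp_mass R _ m (@mfourier R mu m) p B rad c lipK tau Mtot [seq w <- W | P' w] (@wp R)
   (fun w => freq w - freq w0).
apply => //.
- by move=> v; rewrite mfourierE char_ge0.
- move=> u v e huv; apply: le_trans (mfourier_lipschitz L1 muL huv) _.
  rewrite lerD2l /lipK [leRHS]mulrDl mul1r lerDl.
  by apply: le_trans (huv (Ordinal m0)).
- exact: c_gt0.
- exact: Mtot_gt0.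
- have -> : lipK * c = tau / 2; last by [].
  by rewrite /c; field; rewrite gt_eqF.
- by rewrite /rad ltr_wpDl// !mulr_ge0// ltW.
- by move=> w; rewrite mem_filter => /andP[_ /W0/ltW].
- by move=> w; rewrite mem_filter => /andP[/andP[]].
- move=> w k; rewrite mem_filter => /andP[/andP[Pw _] wW].
  have [[y [ly ky]] rw] := hP w wW Pw; have [[y' [ly' ky']] rw'] := hP w0 w0W Pw0.
  have hr : `|wr w0| <= 1 by apply: le_trans del1; exact: (Wr w0W).2.
  have := wfreq_diff_bound A0 hZ theta k ly ly' hr.
  rewrite rVB_E /freq rw -rw' /rad => h; apply: lerD => //.
  by apply: le_trans c_le _; rewrite invf_le1// ler1n.
move=> D hD; rewrite big_filter_cond.
apply: (@close_freq_mass _ r).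
- by move=> w wW /andP[/andP[Pw _] _]; exact: hP.
- move=> w w' wW w'W /andP[P1 D1] /andP[P2 D2] k.
  have := hD w w'; rewrite !mem_filter P1 P2 wW w'W => /(_ isT isT D1 D2 k).
  rewrite !rVB_E; move: (freq w _ _) (freq w' _ _) (freq w0 _ _) => a b d.
  have -> : a - d - (b - d) = a - b by ring.
  by move=> /le_trans; apply; have := c_le; lra.
Qed.

Lemma mphaseB (u v : 'rV[R]_m) x : mphase u x - mphase v x = mphase (u - v) x.
Proof.
rewrite /mphase -mulrBr /dotp -sumrB; congr (_ * _); apply: eq_bigr => i _.
by rewrite !mxE mulrBl.
Qed.

(** After duality one word [w0] is frozen. Partners with a coefficient at most [tau] contribute
    [tau] in all; for the others the coefficient is bounded by 1 and their weight by [EB]. *)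
Lemma group_energy (P : pred (R * R * R)) (r : R) :
  (forall w, w \in W -> P w -> good w /\ wr w = r) ->
  (\sum_(w <- W | P w) wp w * mfourier mu (freq w)) ^+ 2 <= tau + EB.
Proof.
move=> hP; have [W0 W1 _] := dW.
(* [char_duality] wants nonnegative weights at every index, also outside [W], hence the absolute
   values. *)
have S0 w : w \in W -> wp w = `|wp w| by move=> /W0/ltW/ger0_norm.
rewrite big_seq_cond; under eq_bigr => w /andP[wW _] do rewrite (S0 _ wW) mfourierE.
rewrite -big_seq_cond -big_filter; set s := [seq w <- W | P w].
apply: le_trans (char_duality mu s (fun w => normr_ge0 (wp w))
   (fun w => measurable_mphase (freq w))) _.
rewrite exchange_big/=.
have sW w : w \in s -> w \in W /\ P w by rewrite mem_filter => /andP[].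
have ps : \sum_(w <- s) `|wp w| <= 1.
  rewrite -W1 big_filter big_mkcond/= big_seq [leRHS]big_seq; apply: ler_sum => w wW.
  by case: ifP => _; rewrite -?(S0 _ wW)// ltW// W0.
have E0 : 0 <= tau + EB.
  apply: addr_ge0; first exact: ltW.
  have B0 : 0 <= B.
    by rewrite -lee_fin; apply: le_trans hB; apply: integral_ge0 => x _; rewrite lee_fin powR_ge0.
  apply: divr_ge0; first by apply: mulr_ge0 => //; exact/ltW/Mtot_gt0.
  by apply: mulr_ge0; [exact: powR_ge0|apply: exprn_ge0; apply: mulr_ge0 => //; exact/ltW/c_gt0].
apply: (@le_trans _ _ (\sum_(w0 <- s) `|wp w0| * (tau + EB))); last first.
  by rewrite -mulr_suml ler_piMl.
rewrite big_seq [leRHS]big_seq; apply: ler_sum => w0 /sW[w0W Pw0].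
have -> : \sum_(i <- s) `|wp i| * `|wp w0| * char mu (fun x => mphase (freq i) x - mphase (freq w0) x)
   = `|wp w0| * \sum_(i <- s) `|wp i| * mfourier mu (freq i - freq w0).
  rewrite mulr_sumr; apply: eq_bigr => i _; rewrite mfourierE mulrCA mulrA.
  by congr (_ * char mu _); apply/funext => x; rewrite mphaseB.
apply: ler_wpM2l => //.
apply: (@le_trans _ _ (\sum_(i <- s) `|wp i| * tau +
    \sum_(i <- s) (if tau < mfourier mu (freq i - freq w0) then `|wp i| else 0))).
  rewrite -big_split/=; apply: ler_sum => i _.
  case: ltP => h; last by rewrite addr0 ler_wpM2l.
  apply: ler_wpDl; first by rewrite mulr_ge0// ltW.
  rewrite ler_piMr// mfourierE; apply: char_le1; exact: measurable_mphase.
apply: lerD; first by rewrite -mulr_suml ler_piMl// ltW.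
apply: le_trans (large_freq_mass hP w0W Pw0).
rewrite -big_mkcond/= big_filter_cond.
rewrite big_seq_cond [leRHS]big_seq_cond; rewrite le_eqVlt; apply/orP; left; apply/eqP; apply: eq_bigr => w /andP[wW _].
by rewrite -S0.
Qed.

Variables (rs : seq R) (cs : seq R).
Hypothesis Wrs : forall w, w \in W -> wr w \in rs.
Hypothesis Wloc : forall w, w \in W -> exists2 y, y \in cs & local_bound U Q A y (wt w).

(** Words centred within [kap] of a point of [cs] are discarded at the cost of their Frostman mass.
    The others are good and are grouped by ratio, each group giving a square root. *)
Lemma total_energy :
  \sum_(w <- W) wp w * mfourier mu (freq w) <=
  (size cs)%:R * (CF * (kap + L * del) `^ ss) + (size rs)%:R * Num.sqrt (tau + EB).
Proof.
have [W0 W1 _] := dW.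
have L0 : 0 < L by exact: lt_le_trans L1.
have H0 u : 0 <= mfourier mu u by rewrite mfourierE char_ge0.
have H1 u : mfourier mu u <= 1 by rewrite mfourierE; apply: char_le1; exact: measurable_mphase.
have F0 w : w \in W -> 0 <= wp w * mfourier mu (freq w).
  by move=> wW; rewrite mulr_ge0// ltW// W0.
pose bad w := has (fun y => `|wt w - y| <= kap) cs.
rewrite (bigID bad)/=; apply: lerD.
  apply: (@le_trans _ _ (\sum_(y <- cs) \sum_(w <- W | `|wt w - y| <= kap) wp w)).
    under [leRHS]eq_bigr do rewrite big_mkcond.
    rewrite exchange_big/= big_seq_cond [leRHS]big_seq big_mkcondr/=.
    apply: ler_sum => w wW; have p0w := ltW (W0 w wW).
    have all0 r' : 0 <= \sum_(j <- r') (if `|wt w - j| <= kap then wp w else 0).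
      by rewrite sumr_ge0// => j _; case: ifP.
    case: ifP => // /hasP[y ycs hy].
    rewrite (perm_big _ (perm_to_rem ycs))/= big_cons hy.
    apply: ler_wpDr => //.
    by rewrite ler_piMr.
  have -> : (size cs)%:R * (CF * (kap + L * del) `^ ss) = \sum_(y <- cs) CF * (kap + L * del) `^ ss.
    by rewrite big_const_seq count_predT iter_addr_0 mulr_natl.
  apply: ler_sum => y _.
  apply: le_trans (word_mass_ball L1 muL y kap dW (fun w h => (Wr h).2)) _.
  by apply: hF; rewrite addr_gt0 ?mulr_gt0.
apply: le_trans (sum_cover (fun w => ~~ bad w) F0 Wrs) _.
have -> : (size rs)%:R * Num.sqrt (tau + EB) = \sum_(r <- rs) Num.sqrt (tau + EB).
  by rewrite big_const_seq count_predT iter_addr_0 mulr_natl.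
apply: ler_sum => r _.
set S := \sum_(_ <- _ | _) _.
have S0 : 0 <= S by rewrite /S big_seq_cond sumr_ge0// => w /andP[/F0].
rewrite -[S]ger0_norm// -sqrtr_sqr ler_wsqrtr//.
apply: (@group_energy _ r) => w wW /andP[/hasPn nb /eqP rw]; split => //.
have [y ycs ly] := Wloc wW; exists y; split => //.
by have := nb y ycs; rewrite -ltNge => /ltW.
Qed.

End energy.

(** * Choice of scales *)

Section parameters.
Variables (R : realType) (L ss CF rmin lam : R) (m A : nat).
Hypotheses (L1 : 1 <= L) (ss0 : 0 < ss) (ss1 : ss <= 1) (CF0 : 0 < CF).
Hypotheses (rm0 : 0 < rmin) (lam0 : 0 < lam) (m0 : (0 < m)%N) (A0 : (0 < A)%N).

(** The exponent makes kapu^A = u^(ss/8), the loss allowed in the lower bound on the determinant. *)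
Definition kapu (u : R) : R := u `^ (ss / (8 * A%:R)).

(* With [Z = u ^ - (m + 1) ^ 2] and pieces of size [u ^ (m + 2)], the Taylor error is
   [u ^ (m + 1)] while the frequencies still separate points at distance [u]. *)
Definition scaled (u Z del : R) : Prop :=
  [/\ 0 < u, u <= 1, Z * u ^+ (m.+1 ^ 2) = 1, lam * u ^+ m.+2 <= del &
      del <= u ^+ m.+2].

Lemma powR_prod (u a b : R) : 0 < u -> u `^ a * u `^ b = u `^ (a + b).
Proof. by move=> u0; rewrite powRD// (gt_eqF u0) implybT. Qed.

Lemma kapu_expr (u : R) : 0 < u -> kapu u ^+ A = u `^ (ss / 8).
Proof.
move=> u0; rewrite /kapu -powR_mulrn ?powR_ge0// -powRrM; congr (_ `^ _).
by field; rewrite pnatr_eq0 -lt0n.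
Qed.

Lemma scaled_del (u Z del : R) : scaled u Z del -> 0 < del /\ del <= u.
Proof.
move=> [u0 u1 _ d1 d2]; split; first by apply: lt_le_trans d1; rewrite mulr_gt0 ?exprn_gt0.
by apply: le_trans d2 _; rewrite exprS ler_piMr ?exprn_ile1// ltW.
Qed.

Lemma scaled_Z (u Z del : R) : scaled u Z del -> 0 < Z.
Proof.
move=> [u0 _ e _ _]; rewrite -(pmulr_lgt0 _ (exprn_gt0 (m.+1 ^ 2) u0)) e; exact: ltr01.
Qed.

Lemma Lam_bound : exists2 K : R, 0 < K & forall u Z del, scaled u Z del ->
  Lam m A Z (rmin * del) (kapu u) <= K * u `^ (1 - ss / 8).
Proof.
pose N : R := 4 * sepD R m A * m`!%:R.
have N0 : 0 < N.
  have h := sepD_gt0 R m A0.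
  by apply: mulr_gt0; [exact: mulr_gt0|rewrite ltr0n fact_gt0].
pose K := N / (rmin * lam) ^+ m.
have rl0 : 0 < (rmin * lam) ^+ m by rewrite exprn_gt0// mulr_gt0.
exists K; first exact: divr_gt0.
move=> u Z del hs; have Z0 := scaled_Z hs; have [d0 _] := scaled_del hs.
have [u0 u1 eZ hd1 _] := hs.
have q0 : 0 < u `^ (ss / 8) by rewrite powR_gt0.
rewrite /Lam (kapu_expr u0) -/N.
have rd0 : 0 < (rmin * del) ^+ m by rewrite exprn_gt0// mulr_gt0.
rewrite ler_pdivrMr; last by rewrite !mulr_gt0.
have h : (rmin * lam) ^+ m * u ^+ (m.+2 * m) <= (rmin * del) ^+ m.
  have -> : (rmin * lam) ^+ m * u ^+ (m.+2 * m) = (rmin * (lam * u ^+ m.+2)) ^+ m.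
    by rewrite exprM -exprMn mulrA.
  have lu : 0 <= lam * u ^+ m.+2 by rewrite mulr_ge0 ?exprn_ge0// ltW.
  apply: lerXn2r; rewrite ?nnegrE; [by rewrite mulr_ge0// ltW..|].
  by apply: ler_wpM2l => //; exact: ltW.
have e1 : u `^ (1 - ss / 8) * u `^ (ss / 8) = u.
  by rewrite powR_prod// subrK powRr1// ltW.
(* The identity m (m + 2) + 1 = (m + 1)^2 is what makes Z del^m of order 1/u. *)
have e2 : u * u ^+ (m.+2 * m) = u ^+ (m.+1 ^ 2).
  by rewrite -exprS; congr (_ ^+ _); rewrite -mulnn !mulSn mulnS addSn.
have -> : K * u `^ (1 - ss / 8) * (u `^ (ss / 8) * Z * (rmin * del) ^+ m) =
   K * (u `^ (1 - ss / 8) * u `^ (ss / 8)) * Z * (rmin * del) ^+ m by ring.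
rewrite e1.
have KE : K * (rmin * lam) ^+ m = N by rewrite /K mulfVK// gt_eqF.
apply: (@le_trans _ _ (K * u * Z * ((rmin * lam) ^+ m * u ^+ (m.+2 * m)))).
  have -> : K * u * Z * ((rmin * lam) ^+ m * u ^+ (m.+2 * m)) =
    (K * (rmin * lam) ^+ m) * (Z * (u * u ^+ (m.+2 * m))) by ring.
  by rewrite KE e2 eZ mulr1.
apply: ler_wpM2l => //; apply: mulr_ge0; last exact: ltW.
by apply: mulr_ge0; [exact/ltW/divr_gt0|exact: ltW].
Qed.

Lemma ell_bound : exists2 K : R, 0 < K & forall u, 0 < u -> u <= 1 ->
  4 * L / ell m A (kapu u) + 1 <= K * u `^ (- (ss / 8)).
Proof.
pose D : R := 2 * sepD R m A * m%:R * A%:R.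
have D0 : 0 < D by exact: sepDm_gt0.
pose K2 : R := Num.min (2 * A%:R)^-1 D^-1.
have K20 : 0 < K2 by rewrite lt_min !invr_gt0 D0 mulr_gt0// ltr0n.
have L0 : 0 < L by exact: lt_le_trans L1.
exists (4 * L / K2 + 1); first by rewrite addr_gt0// divr_gt0// mulr_gt0.
move=> u u0 u1.
pose q := u `^ (ss / 8).
have q0 : 0 < q by rewrite powR_gt0.
have q1 : q <= 1.
  by rewrite -(powRr0 u) ger_powR ?u0// divr_ge0// ltW.
have qV : u `^ (- (ss / 8)) = q^-1 by rewrite powRN.
have hl : q * K2 <= ell m A (kapu u).
  rewrite /ell (kapu_expr u0) -/q -/D le_min; apply/andP; split.
    apply: (@le_trans _ _ K2); first by rewrite ler_piMl// ltW.
    by rewrite /K2 ge_min lexx.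
  by rewrite ler_wpM2l ?(ltW q0)// /K2 ge_min lexx orbT.
have qK : 0 < q * K2 by rewrite mulr_gt0.
have l0 : 0 < ell m A (kapu u) by exact: lt_le_trans hl.
rewrite qV [leRHS]mulrDl [X in _ <= _ + X]mul1r; apply: lerD; last by rewrite invf_ge1.
have -> : 4 * L / K2 / q = 4 * L / (q * K2).
  by rewrite invfM; ring.
by rewrite ler_wpM2l ?mulr_ge0 ?(ltW L0)// lef_pV2 ?posrE.
Qed.

(** There are O(u^(-ss/8)) clusters, each of mass O(u^((1 - ss/8) ss)), and (1 - ss/8) ss >= 7 ss/8
    because ss <= 1. *)
Lemma Mtot_bound : exists2 K : R, 0 < K & forall u Z del, scaled u Z del ->
  Mtot L ss CF m A Z del (rmin * del) (kapu u) <= K * u `^ (3 * ss / 4).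
Proof.
have [K1 K10 h1] := Lam_bound; have [K2 K20 h2] := ell_bound.
have L0 : 0 < L by exact: lt_le_trans L1.
have KL0 : 0 < K1 + L by exact: addr_gt0.
exists (K2 * (CF * (K1 + L) `^ ss)).
  by apply: mulr_gt0 => //; apply: mulr_gt0 => //; exact: powR_gt0.
move=> u Z del hs; have [d0 du] := scaled_del hs; have [u0 u1 _ _ _] := hs.
have hL := h1 u Z del hs; have hl := h2 u u0 u1.
have Lam0 : 0 < Lam m A Z (rmin * del) (kapu u).
  by apply: Lam_gt0 => //; [exact: scaled_Z hs|exact: mulr_gt0|exact: powR_gt0].
rewrite /Mtot.
have hsum : Lam m A Z (rmin * del) (kapu u) + L * del <= (K1 + L) * u `^ (1 - ss / 8).
  rewrite mulrDl lerD// ler_wpM2l ?(ltW L0)//; apply: le_trans du _.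
  rewrite -[leLHS](powRr1 (ltW u0)); apply: ger_powR; first by rewrite u0.
  have h : 1 - ss / 8 <= 1 by have := ss0; lra.
  exact: h.
have hpow : (Lam m A Z (rmin * del) (kapu u) + L * del) `^ ss <= (K1 + L) `^ ss * u `^ (7 * ss / 8).
  apply: (@le_trans _ _ (((K1 + L) * u `^ (1 - ss / 8)) `^ ss)).
    apply: ge0_ler_powR; rewrite ?nnegrE ?(ltW ss0)//.
      by apply: addr_ge0; [exact: ltW|rewrite mulr_ge0// ltW].
    by rewrite mulr_ge0 ?powR_ge0// ltW.
  rewrite powRM ?powR_ge0 ?(ltW KL0)// ler_wpM2l ?powR_ge0// -powRrM.
  apply: ger_powR; first by rewrite u0.
  have h4 : ss * ss <= ss by rewrite ler_piMl// ltW.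
  have h : 7 * ss / 8 <= (1 - ss / 8) * ss by have := ss0; lra.
  exact: h.
apply: (@le_trans _ _ ((K2 * u `^ (- (ss / 8))) * (CF * ((K1 + L) `^ ss * u `^ (7 * ss / 8))))).
  apply: ler_pM => //.
  - apply: addr_ge0 => //; apply: divr_ge0; first by rewrite mulr_ge0// ltW.
    by apply/ltW/ell_gt0 => //; exact: powR_gt0.
  - by rewrite mulr_ge0 ?powR_ge0// ltW.
  - by rewrite ler_wpM2l// ltW.
have -> : (K2 * u `^ (- (ss / 8))) * (CF * ((K1 + L) `^ ss * u `^ (7 * ss / 8))) =
  (K2 * (CF * (K1 + L) `^ ss)) * (u `^ (- (ss / 8)) * u `^ (7 * ss / 8)) by ring.
rewrite powR_prod//; have -> : - (ss / 8) + 7 * ss / 8 = 3 * ss / 4 by field.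
by [].
Qed.

Variables (p Cp : R).
Hypotheses (p1 : 1 < p) (Cp0 : 0 < Cp).

(** For tau = u^aexp the denominator of [EB], of order tau^(p + m), is of order u^(ss/4). *)
Definition aexp : R := ss / (4 * (p + m%:R)).
(** Makes Z^epsu = u^(-ss/4). It must not involve [p], which the hypothesis returns only once this
    exponent is given. *)
Definition epsu : R := ss / (4 * (m.+1 ^ 2)%:R).

Lemma pm_gt0 : 0 < p + m%:R.
Proof. by rewrite addr_gt0 ?ltr0n// (lt_trans ltr01). Qed.

(** Balance of exponents: 3/4 from [Mtot], minus 1/4 for the growth in the radius, minus 1/4 for the
    threshold, in units of ss. *)
Lemma EB_bound : exists2 K : R, 0 < K & forall u Z del, scaled u Z del ->
  EB L ss CF m A Z del (rmin * del) (kapu u) p (u `^ aexp) (Cp * rad m A Z `^ epsu)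
    <= K * u `^ (ss / 4).
Proof.
have [K3 K30 h3] := Mtot_bound.
have pm := pm_gt0.
have lK0 : 0 < lipK L m by apply: lt_le_trans (lipK_ge1 L1 m).
pose K4 : R := 2 * (m%:R * A%:R) + 1.
have K40 : 0 < K4 by rewrite ltr_wpDl.
pose K5 : R := 2^-1 `^ p * (lipK L m)^-1 ^+ m.
have K50 : 0 < K5 by rewrite mulr_gt0 ?powR_gt0 ?exprn_gt0 ?invr_gt0.
exists (K3 * (Cp * K4 `^ epsu) / K5).
  by rewrite divr_gt0// mulr_gt0// mulr_gt0// powR_gt0.
move=> u Z del hs; have Z0 := scaled_Z hs; have [d0 _] := scaled_del hs.
have [u0 u1 eZ _ _] := hs.
have un0 : 0 < u ^+ (m.+1 ^ 2) by exact: exprn_gt0.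
have Zu : Z = (u ^+ (m.+1 ^ 2))^-1 by apply: (mulIf (lt0r_neq0 un0)); rewrite eZ mulVf ?gt_eqF.
have Z1 : 1 <= Z by rewrite Zu invf_ge1// exprn_ile1// ltW.
have eps0 : 0 <= epsu by rewrite divr_ge0 ?(ltW ss0)// mulr_ge0.
have hrad : rad m A Z `^ epsu <= K4 `^ epsu * u `^ (- (ss / 4)).
  have rK : rad m A Z <= K4 * Z.
    have -> : K4 * Z = 2 * (m%:R * Z * A%:R) + Z by rewrite /K4; ring.
    by rewrite /rad lerD2l.
  apply: (@le_trans _ _ ((K4 * Z) `^ epsu)).
    apply: ge0_ler_powR => //; rewrite nnegrE.
      by rewrite /rad addr_ge0// !mulr_ge0// ltW.
    by rewrite mulr_ge0// ltW.
  rewrite powRM ?(ltW K40) ?(ltW Z0)// ler_wpM2l ?powR_ge0//.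
  rewrite Zu -powR_mulrn ?(ltW u0)// -powRN -powRrM.
  have -> : - (m.+1 ^ 2)%:R * epsu = - (ss / 4); last by [].
  have N0 : (m.+1 ^ 2)%:R != 0 :> R by rewrite pnatr_eq0 expn_eq0.
  by rewrite /epsu; move: ((m.+1 ^ 2)%:R : R) N0 => N N0; field.
have den : (u `^ aexp / 2) `^ p * (2 * (u `^ aexp / (2 * lipK L m))) ^+ m = K5 * u `^ (ss / 4).
  have -> : 2 * (u `^ aexp / (2 * lipK L m)) = u `^ aexp * (lipK L m)^-1.
    by field; rewrite gt_eqF.
  rewrite powRM ?powR_ge0 ?invr_ge0// exprMn -powRrM -powR_mulrn ?powR_ge0// -powRrM.
  have -> : u `^ (ss / 4) = u `^ (aexp * p) * u `^ (aexp * m%:R).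
    rewrite powR_prod//; congr (_ `^ _); rewrite -mulrDr /aexp; field.
    by rewrite gt_eqF.
  by rewrite /K5; ring.
rewrite /EB den.
have den0 : 0 < K5 * u `^ (ss / 4) by rewrite mulr_gt0// powR_gt0.
rewrite ler_pdivrMr//.
have M0 : 0 <= Mtot L ss CF m A Z del (rmin * del) (kapu u).
  by apply/ltW/Mtot_gt0 => //; [exact: mulr_gt0|exact: powR_gt0].
apply: (@le_trans _ _ ((K3 * u `^ (3 * ss / 4)) * (Cp * (K4 `^ epsu * u `^ (- (ss / 4)))))).
  apply: ler_pM => //; first by rewrite mulr_ge0 ?powR_ge0// ltW.
    exact: h3.
  by rewrite ler_wpM2l// ltW.
have -> : (K3 * u `^ (3 * ss / 4)) * (Cp * (K4 `^ epsu * u `^ (- (ss / 4)))) =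
  K3 * (Cp * K4 `^ epsu) * (u `^ (3 * ss / 4) * u `^ (- (ss / 4))) by ring.
have -> : K3 * (Cp * K4 `^ epsu) / K5 * u `^ (ss / 4) * (K5 * u `^ (ss / 4)) =
  K3 * (Cp * K4 `^ epsu) * (u `^ (ss / 4) * u `^ (ss / 4)).
  by field; rewrite gt_eqF.
rewrite !powR_prod//.
have -> : 3 * ss / 4 + - (ss / 4) = ss / 4 + ss / 4 by field.
by [].
Qed.

End parameters.

Lemma geometric_bracket (R : realType) (lam y : R) : 0 < lam -> lam < 1 -> 0 < y -> y <= 1 ->
  exists k, lam * y <= lam ^+ k /\ lam ^+ k <= y.
Proof.
move=> l0 l1 y0 y1.
have ex : exists k, lam ^+ k <= y.
  have [|N hN] := @expr_unbounded R lam^-1 y^-1; first by rewrite invf_gt1.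
  exists N; rewrite -[leLHS]invrK -exprVn -[leRHS]invrK lef_pV2 ?posrE ?invr_gt0 ?exprn_gt0//.
  by rewrite invr_gt0.
exists (ex_minn ex); case: ex_minnP => k hk kmin; split => //.
case: k hk kmin => [|k] hk kmin; first by rewrite expr0 mulr_ile1// ltW.
rewrite exprS ler_wpM2l ?(ltW l0)// leNgt; apply/negP => /ltW/kmin.
by rewrite ltnn.
Qed.

(** Bernoulli gives k + 1 <= c B^k with B = lam^(-b/(n+1)), which is raised to the power n. Dividing
    by n + 1 rather than n allows n = 0. *)
Lemma polynomial_le_exponential (R : realType) (lam b : R) (n : nat) :
  0 < lam -> lam < 1 -> 0 < b ->
  exists2 C : R, 0 < C & forall k, (k.+1 ^ n)%:R <= C * (lam ^+ k) `^ (- b).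
Proof.
move=> l0 l1 b0; pose B := lam `^ (- (b / n.+1%:R)).
have e0 : 0 < b / n.+1%:R by rewrite divr_gt0.
have B1 : 1 < B.
  have h : lam `^ (b / n.+1%:R) < 1 `^ (b / n.+1%:R).
    by apply: gt0_ltr_powR; rewrite ?nnegrE ?(ltW l0).
  by rewrite /B powRN invf_gt1 ?powR_gt0//; rewrite powR1 in h.
have x0 : 0 < B - 1 by rewrite subr_gt0.
have B0 : 0 < B by exact: lt_trans B1.
pose c := 1 + (B - 1)^-1.
have c0 : 0 < c by rewrite addr_gt0// invr_gt0.
exists (c ^+ n); first by rewrite exprn_gt0.
move=> k; have h : k.+1%:R <= c * B ^+ k.
  have := bernoulli_ge k (ltW x0); have -> : 1 + (B - 1) = B by ring.
  move=> hb; apply: (@le_trans _ _ (c * (1 + k%:R * (B - 1)))); last by rewrite ler_wpM2l// ltW.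
  have -> : c * (1 + k%:R * (B - 1)) = 1 + k%:R + (k%:R * (B - 1) + (B - 1)^-1).
    by rewrite /c; field; rewrite gt_eqF.
  by rewrite -natr1 addrC lerDl addr_ge0 ?mulr_ge0 ?invr_ge0 ?(ltW x0).
have -> : (lam ^+ k) `^ (- b) = B ^+ (k * n.+1).
  have N0 : n.+1%:R != 0 :> R by rewrite pnatr_eq0.
  have e1 : B ^+ n.+1 = lam `^ (- b).
    rewrite -[LHS]powR_mulrn ?powR_ge0// -[LHS]powRrM; congr (_ `^ _).
    by move: (n.+1%:R : R) N0 => N N0; field.
  rewrite mulnC exprM e1 -(powR_mulrn k (powR_ge0 lam (- b))) -(powR_mulrn k (ltW l0)).
  by rewrite -[LHS]powRrM -[RHS]powRrM mulrC.
rewrite natrX; apply: (@le_trans _ _ ((c * B ^+ k) ^+ n)).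
  by rewrite lerXn2r ?nnegrE// mulr_ge0 ?exprn_ge0 ?(ltW c0) ?(ltW B0).
rewrite exprMn ler_wpM2l ?exprn_ge0 ?(ltW c0)// -exprM ler_weXn2l ?(ltW B1)//.
by rewrite leq_mul2l leqnSn orbT.
Qed.

Lemma mx_norm_attained (R : realType) m (zeta : 'rV[R]_m) : zeta != 0 ->
  [/\ 0 < `|zeta|, forall i, `|zeta ord0 i| <= `|zeta| &
      exists i, `|zeta ord0 i| = `|zeta|].
Proof.
move=> z0; split; first by rewrite normr_gt0.
  move=> i; rewrite [leRHS]/Num.norm/= mx_normrE.
  exact: (le_bigmax _ (fun ij => `|zeta ij.1 ij.2|) (ord0, i)).
have : mx_norm zeta != 0 by apply: contra z0 => /eqP/mx_norm_eq0 ->.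
move=> /mx_norm_neq0[[i j] /= e]; exists j.
by rewrite [RHS]/Num.norm/= e (ord1 i).
Qed.

(** The null alternative of the cover is excluded because a piece of positive mass sits in the ball
    of radius 1/A around its centre. *)
Lemma words_local (R : realType) (mu : probability (measurableTypeR R) R) (L : R)
    (m : nat) (Q : R -> 'rV[R]_m) (U : set R) A (cs : seq R) W (del rl : R) :
  1 <= L -> mu [set x | `|x| <= L] = 1%E ->
  (forall x, `|x| <= 2 * L -> pr mu (ball x A%:R^-1) = 0 \/
    exists2 y, y \in cs & local_bound U Q A y x) ->
  decomposes mu W -> (forall w, w \in W -> rl <= `|wr w| /\ `|wr w| <= del) ->
  del <= 1 -> L * del < A%:R^-1 ->
  forall w, w \in W -> exists2 y, y \in cs & local_bound U Q A y (wt w).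
Proof.
move=> L1 muL hcov dW Wr del1 hdel w wW.
have [h|//] := hcov _ (word_center L1 muL dW Wr del1 wW).
have := word_ball_gt0 muL dW wW; rewrite ltNge => /negP[].
rewrite -h; apply: le_pr; [exact: measurable_cball|exact: measurable_ball|].
move=> z; rewrite /cball/= => hz; rewrite /ball/= distrC.
have {}hz : `|(z : R) - wt w| <= L * `|wr w| := hz.
apply: le_lt_trans hz _; apply: le_lt_trans hdel.
by rewrite ler_wpM2l ?(le_trans ler01 L1)//; exact: (Wr w wW).2.
Qed.

Lemma measurable_admissible_curve (R : realType) n (U : set R) (Q : R -> 'rV[R]_n) :
  open U -> non_trapped_curve U Q \/ nondegenerate_curve U Q ->
  measurable_fun [set: measurableTypeR R] (Q \_ U).
Proof.
move=> oU hQ; have [h1 _] : curve_Ck U Q n.+1.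
  by case: hQ => -[+ _] //; exact: analytic_Ck.
apply: measurable_curve => // x; rewrite inE => Ux.
by apply: differentiable_continuous; apply/derivable1_diffP; exact: (h1 0%N).
Qed.

(** * Assembling the estimates *)

Section assembly.
Variables (R : realType) (mu : probability (measurableTypeR R) R).
Variables (m : nat) (U : set R) (g : R -> 'rV[R]_m).
Hypothesis m0 : (0 < m)%N.
Let Q := graph_curve g.

Lemma char_le_words L A cs W (rs : seq R) (ss CF p Cp u Z del rmin lam theta : R)
    (zeta : 'rV[R]_m) :
  1 <= L -> mu [set x | `|x| <= L] = 1%E -> 0 < ss -> ss <= 1 -> 0 < CF ->
  (forall x rho : R, 0 < rho -> pr mu (cball x rho) <= CF * rho `^ ss) ->
  (0 < A)%N -> measurable_fun [set: measurableTypeR R] (Q \_ U) ->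
  (forall x, `|x| <= 2 * L -> pr mu (ball x A%:R^-1) = 0 \/
    exists2 y : R, y \in cs & local_bound U Q A y x) ->
  decomposes mu W -> 0 < rmin -> 0 < lam ->
  (forall w, w \in W -> rmin * del <= `|wr w| /\ `|wr w| <= del) ->
  (forall w, w \in W -> wr w \in rs) ->
  scaled lam m u Z del -> L * del < A%:R^-1 -> 1 < p -> 0 < Cp ->
  (forall i, `|zeta ord0 i| <= Z) -> (exists i, `|zeta ord0 i| = Z) ->
  (\int[lebesgue_rV R m]_(xi in ball (0%R : 'rV[R]_m) (rad m A Z))
    ((mfourier mu xi `^ p)%R)%:E <= (Cp * rad m A Z `^ epsu ss m)%:E)%E ->
  char mu (fun x => 2 * pi * dotp (row_mx theta%:M zeta) ((Q \_ U) x)) <=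
  (size cs)%:R * (CF * (kapu ss A u + L * del) `^ ss) +
  (size rs)%:R * Num.sqrt (u `^ aexp ss m p +
     EB L ss CF m A Z del (rmin * del) (kapu ss A u) p (u `^ aexp ss m p)
       (Cp * rad m A Z `^ epsu ss m)) +
  4 * pi * (m%:R * Z * A%:R * (del * L) ^+ (1 + m)).
Proof.
move=> L1 muL ss0 ss1 CF0 hF A0 mQ hcov dW rm0 lam0 Wr Wrs hs hdel p1 Cp0 hZ hZe hB.
have [u0 u1 _ _ _] := hs; have Z0 := scaled_Z hs; have [d0 du] := scaled_del lam0 hs.
have del1 : del <= 1 by exact: le_trans u1.
have L0 : 0 < L by exact: lt_le_trans L1.
have Wloc := words_local L1 muL hcov dW Wr del1 hdel.
have [W0 W1 _] := dW.
pose err : R := 4 * pi * (m%:R * Z * A%:R * (del * L) ^+ (1 + m)).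
have mph : measurable_fun setT (fun x : measurableTypeR R =>
    2 * pi * dotp (row_mx theta%:M zeta) ((Q \_ U) x)).
  apply: measurable_funM; first exact: measurable_cst.
  exact: (measurableT_comp (measurable_dotp _) mQ).
apply: le_trans (char_decomposes dW mph) _.
apply: (@le_trans _ _ (\sum_(w <- W) (wp w * mfourier mu (freq g zeta theta w) + wp w * err))).
  rewrite big_seq [leRHS]big_seq; apply: ler_sum => w wW.
  rewrite -mulrDr; apply: ler_wpM2l; first exact/ltW/W0.
  have [y _ hy] := Wloc w wW; have [wr1 wr2] := Wr w wW.
  have hr : `|wr w| * L < A%:R^-1.
    by apply: le_lt_trans hdel; rewrite mulrC ler_wpM2l// ltW.
  have d z (zs : `|z - wt w| < A%:R^-1) := let: And4 _ d _ _ := hy z zs in d.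
  have b z (zs : `|z - wt w| < A%:R^-1) := let: And4 _ _ b _ := hy z zs in b.
  have hU z (zs : `|z - wt w| < A%:R^-1) := let: And4 h _ _ _ := hy z zs in h.
  apply: le_trans (piece_char m0 d b L1 muL hU mQ theta hZ hr) _.
  rewrite /freq lerD2l /err; apply: ler_wpM2l; first by rewrite mulr_ge0 ?pi_ge0.
  apply: ler_wpM2l; first by rewrite !mulr_ge0// ltW.
  apply: lerXn2r; rewrite ?nnegrE ?mulr_ge0 ?(ltW d0) ?(ltW L0)//.
  by rewrite ler_wpM2r// ltW.
rewrite big_split/= -mulr_suml W1 mul1r lerD2r.
apply: (total_energy L1 muL hF m0 A0 theta hZ hZe Z0 dW _ Wr del1 d0 _ _ _ _ hB CF0 Wrs Wloc).
- exact: mulr_gt0.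
- exact: powR_gt0.
- exact: (ltW (lt_trans ltr01 p1)).
- exact: powR_gt0.
- rewrite -(powRr0 u); apply: ger_powR; first by rewrite u0.
  by apply: divr_ge0; [exact: ltW|rewrite mulr_ge0// addr_ge0// ltW// (lt_trans ltr01)].
Qed.

End assembly.

Lemma mfourier_decay_curve (R : realType) (mu : probability (measurableTypeR R) R)
    (m : nat) (U : set R) (g : R -> 'rV[R]_m) :
  self_similar mu -> non_atomic mu -> (0 < m)%N ->
  (forall eps : R, 0 < eps -> exists p C : R, [/\ 1 < p, 0 < C &
     forall rad : R, 1 < rad ->
       (\int[lebesgue_rV R m]_(xi in ball (0%R : 'rV[R]_m) rad)
          ((mfourier mu xi `^ p)%R)%:E <= (C * rad `^ eps)%:E)%E]) ->
  open U -> msupport mu `<=` U ->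
  non_trapped_curve U (graph_curve g) \/ nondegenerate_curve U (graph_curve g) ->
  exists2 gamma : R, 0 < gamma & exists2 C : R, 1 <= C &
    forall (theta : R) (zeta : 'rV[R]_m), zeta != 0 ->
      char mu (fun x => 2 * pi * dotp (row_mx theta%:M zeta) ((graph_curve g \_ U) x))
        <= C * `|zeta| `^ (- gamma).
Proof.
move=> mu_ss mu_na m0 hdecay oU U_supp hQ.
have [L L1 muL] := self_similar_bounded mu_ss.
have [ss [CF [/andP[ss0 ss1] CF0 hF]]] := frostman L1 muL mu_na mu_ss.
have [n [lam [rmin [/andP[lam0 lam1] /andP[rm0 rm1] hW]]]] := self_similar_decomposes mu_ss.
have [A [cs [A0 hcov]]] := local_bound_cover oU U_supp hQ (2 * L).
have mQ := measurable_admissible_curve oU hQ.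
have L0 : 0 < L by exact: lt_le_trans L1.
have AR0 : 0 < A%:R :> R by rewrite ltr0n.
have A1 : 1 <= A%:R :> R by rewrite ler1n.
have eps0 : 0 < epsu ss m.
  by apply: divr_gt0 => //; apply: mulr_gt0 => //; rewrite ltr0n expn_gt0.
(* [epsu] depends on [ss] and [m] only, so it can be fixed before [p]. *)
have [p [Cp [p1 Cp0 hint]]] := hdecay _ eps0.
have [K6 K60 hEB] := EB_bound L1 ss0 ss1 CF0 rm0 lam0 m0 A0 p1 Cp0.
pose a := aexp ss m p.
have pm0 : 0 < p + m%:R by exact: pm_gt0.
have a0 : 0 < a by apply: divr_gt0 => //; apply: mulr_gt0.
have a_ss : a <= ss / 4.
  rewrite /a /aexp ler_wpM2l ?(ltW ss0)// lef_pV2 ?posrE ?mulr_gt0//.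
  by rewrite ler_peMr// (le_trans (ltW p1))// lerDl.
(* Since del is of order u^(m+2), the number of ratios is O(del^(-b)) = O(u^(-a/4)), less than the
   gain u^(a/2) of the square root. *)
pose b := a / (4 * m.+2%:R).
have b0 : 0 < b by rewrite divr_gt0// mulr_gt0.
have [Cn Cn0 hn] := polynomial_le_exponential n lam0 lam1 b0.
pose beta := ss / (8 * A%:R).
have beta0 : 0 < beta by rewrite divr_gt0// mulr_gt0.
have beta1 : beta <= 1 by rewrite ler_pdivrMr ?mulr_gt0// mul1r; lra.
(* For u below [u1] the pieces have radius at most L u1 = 1/(2A), within the reach of
   [local_bound]. *)
pose u1 : R := (2 * A%:R * L)^-1.
have u10 : 0 < u1 by rewrite invr_gt0 !mulr_gt0.
have u11 : u1 < 1.
  rewrite invf_lt1 ?mulr_gt0//; apply: lt_le_trans (_ : 2 <= _); first by rewrite ltr1n.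
  by rewrite -mulrA ler_peMr// mulr_ege1.
(* The rates of the three terms: discarded words, grouped words, Taylor error. The latter would
   allow more than 1. *)
pose gam0 := Num.min (Num.min (beta * ss) (a / 4)) 1.
have gam00 : 0 < gam0 by rewrite !lt_min ltr01 mulr_gt0//= divr_gt0.
have [g1 g2 g3] : [/\ gam0 <= beta * ss, gam0 <= a / 4 & gam0 <= 1].
  by rewrite /gam0 !ge_min !lexx ?orbT.
pose d2 : R := (m.+1 ^ 2)%:R.
have d20 : 0 < d2 by rewrite ltr0n expn_gt0.
pose C1 := (size cs)%:R * (CF * (1 + L) `^ ss).
pose C2 := Cn * lam `^ (- b) * Num.sqrt (1 + K6).
pose C3 := 4 * pi * (m%:R * A%:R * L ^+ (1 + m)).
have C10 : 0 <= C1 by rewrite mulr_ge0// mulr_ge0 ?powR_ge0// ltW.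
have C20 : 0 <= C2 by rewrite !mulr_ge0 ?powR_ge0 ?sqrtr_ge0// ltW.
have C30 : 0 <= C3 by rewrite !mulr_ge0 ?pi_ge0 ?exprn_ge0// ltW.
have C40 : 0 <= u1 `^ (- gam0) by exact: powR_ge0.
exists (gam0 / d2); first by rewrite divr_gt0.
exists (1 + (C1 + C2 + C3) + u1 `^ (- gam0)); first by rewrite -addrA lerDl !addr_ge0.
move=> theta zeta /mx_norm_attained[]; set Z : R := `|zeta| => Z0 hZ hZe.
pose u := Z `^ (- d2^-1).
have u0 : 0 < u by rewrite powR_gt0.
have uZ e : Z `^ (- (e / d2)) = u `^ e.
  by rewrite /u -powRrM; congr (_ `^ _); rewrite mulNr mulrC.
rewrite uZ.
have ug0 : 0 < u `^ gam0 by rewrite powR_gt0.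
have mph : measurable_fun setT (fun x : measurableTypeR R =>
    2 * pi * dotp (row_mx theta%:M zeta) ((graph_curve g \_ U) x)).
  apply: measurable_funM; first exact: measurable_cst.
  exact: (measurableT_comp (measurable_dotp _) mQ).
(* For [u1 <= u] the norm of zeta is bounded and the trivial bound 1 suffices, at the cost of the
   last summand of the constant. *)
have [u1u|uu1] := leP u1 u.
  apply: le_trans (char_le1 mu mph) _.
  apply: (@le_trans _ _ (u1 `^ (- gam0) * u `^ gam0)); last first.
    by apply: ler_wpM2r; [exact: ltW|rewrite lerDr !addr_ge0].
  rewrite powRN mulrC ler_pdivlMr ?powR_gt0// mul1r.
  by apply: ge0_ler_powR; rewrite ?nnegrE ?(ltW gam00) ?(ltW u10) ?(ltW u0).
have u_le1 : u <= 1 by exact/ltW/(lt_trans uu1).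
have hu : 0 < u <= 1 by rewrite u0.
have un1 : u ^+ m.+2 <= 1 by rewrite exprn_ile1// ltW.
have [k [k1 k2]] := geometric_bracket lam0 lam1 (exprn_gt0 m.+2 u0) un1.
have [W [rs [dW rsn Wr]]] := hW k.
set del := lam ^+ k in k1 k2 Wr.
have hs : scaled lam m u Z del.
  have uV : u ^+ (m.+1 ^ 2) = Z^-1.
    rewrite -(powR_mulrn _ (ltW u0)) -/d2 -uZ (divff (lt0r_neq0 d20)).
    exact: powR_inv1 (ltW Z0).
  by split => //; rewrite uV (divff (lt0r_neq0 Z0)).
have [d0 du] := scaled_del lam0 hs.
have rad1 : 1 < rad m A Z.
  by rewrite /rad ltrDr mulr_gt0// !mulr_gt0// ltr0n.
have hdel : L * del < A%:R^-1.
  apply: (@le_lt_trans _ _ (L * u1)); first by rewrite ler_wpM2l ?(ltW L0)// (le_trans du)// ltW.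
  have -> : L * u1 = 2^-1 * A%:R^-1 by rewrite /u1; field; rewrite !gt_eqF.
  by rewrite gtr_pMl ?invr_gt0// invf_lt1// ltr1n.
apply: le_trans (char_le_words m0 theta L1 muL ss0 ss1 CF0 hF A0 mQ hcov dW rm0 lam0
  (fun w h => let: And3 _ x y := Wr w h in conj x y) (fun w h => let: And3 x _ _ := Wr w h in x)
  hs hdel p1 Cp0 hZ hZe (hint _ rad1)) _.
have pgam e : gam0 <= e -> u `^ e <= u `^ gam0 by move=> ?; exact: ger_powR.
have T1 : (size cs)%:R * (CF * (kapu ss A u + L * del) `^ ss) <= C1 * u `^ gam0.
  rewrite /C1 -[leRHS]mulrA; apply: ler_wpM2l => //.
  rewrite -[leRHS]mulrA; apply: ler_wpM2l; first exact: ltW.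
  have hk : kapu ss A u + L * del <= (1 + L) * u `^ beta.
    rewrite [leRHS]mulrDl mul1r; apply: lerD; first exact: lexx.
    apply: ler_wpM2l; first exact: ltW.
    apply: le_trans du _; rewrite -[leLHS](powRr1 (ltW u0)); exact: ger_powR.
  apply: (@le_trans _ _ (((1 + L) * u `^ beta) `^ ss)).
    apply: ge0_ler_powR; rewrite ?nnegrE ?(ltW ss0)//.
      by apply: addr_ge0; [exact: powR_ge0|rewrite mulr_ge0// ltW].
    by rewrite mulr_ge0 ?powR_ge0// addr_ge0// ltW.
  rewrite (powRM _ (addr_ge0 ler01 (ltW L0)) (powR_ge0 _ _)) -powRrM.
  by apply: ler_wpM2l; [exact: powR_ge0|exact: pgam].
have T3 : 4 * pi * (m%:R * Z * A%:R * (del * L) ^+ (1 + m)) <= C3 * u `^ gam0.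
  have hZd : Z * del ^+ m.+1 <= u `^ gam0.
    apply: (@le_trans _ _ (u `^ 1)); last exact: pgam.
    rewrite powRr1 ?(ltW u0)//.
    apply: (@le_trans _ _ (Z * (u ^+ m.+2) ^+ m.+1)).
      apply: ler_wpM2l; first exact: ltW.
      apply: lerXn2r; [exact: (ltW d0)|exact: (exprn_ge0 _ (ltW u0))|exact: k2].
    have [_ _ eZ _ _] := hs.
    rewrite -exprM mulSn mulnn addnC exprD mulrA eZ mul1r exprS.
    by apply: ler_piMr; [exact: ltW|rewrite exprn_ile1// ltW].
  have -> : 4 * pi * (m%:R * Z * A%:R * (del * L) ^+ (1 + m)) = C3 * (Z * del ^+ m.+1).
    rewrite /C3 exprMn -[(1 + m)%N]/m.+1.
    by move: (del ^+ _) (L ^+ _) (m%:R : R) (A%:R : R) (pi : R) => x1 x2 x3 x4 x5; ring.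
  exact: ler_wpM2l.
have T2 : (size rs)%:R * Num.sqrt (u `^ aexp ss m p +
     EB L ss CF m A Z del (rmin * del) (kapu ss A u) p (u `^ aexp ss m p)
       (Cp * rad m A Z `^ epsu ss m)) <= C2 * u `^ gam0.
  set EBu := EB _ _ _ _ _ _ _ _ _ _ _ _.
  have hE : EBu <= K6 * u `^ (ss / 4) by exact: hEB.
  rewrite -/a; clearbody EBu.
  have hsq : Num.sqrt (u `^ a + EBu) <= Num.sqrt (1 + K6) * u `^ (a / 2).
    have -> : u `^ (a / 2) = Num.sqrt (u `^ a).
      have -> : u `^ a = (u `^ (a / 2)) ^+ 2 by rewrite expr2 powR_prod// -splitr.
      by rewrite sqrtr_sqr ger0_norm// powR_ge0.
    rewrite -sqrtrM; last by rewrite addr_ge0// ltW.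
    apply: ler_wsqrtr; rewrite [leRHS]mulrDl mul1r lerD2l.
    apply: le_trans hE _; apply: ler_wpM2l; first exact: ltW.
    exact: ger_powR.
  have hrs : (size rs)%:R <= Cn * lam `^ (- b) * u `^ (- (a / 4)).
    apply: (@le_trans _ _ (k.+1 ^ n)%:R); first by rewrite ler_nat.
    apply: le_trans (hn k) _; rewrite -[leRHS]mulrA; apply: ler_wpM2l; first exact: ltW.
    have lu0 : 0 < lam * u ^+ m.+2 by rewrite mulr_gt0 ?exprn_gt0.
    apply: (@le_trans _ _ ((lam * u ^+ m.+2) `^ (- b))).
      rewrite !powRN lef_pV2 ?posrE ?powR_gt0//.
      by apply: ge0_ler_powR; rewrite ?nnegrE ?(ltW b0) ?(ltW lu0) ?(ltW d0).
    rewrite (powRM _ (ltW lam0) (exprn_ge0 _ (ltW u0))).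
    rewrite -(powR_mulrn _ (ltW u0)) -powRrM.
    have -> : m.+2%:R * - b = - (a / 4); last exact: lexx.
    have N0 : m.+2%:R != 0 :> R by rewrite pnatr_eq0.
    by rewrite /b; move: (m.+2%:R : R) N0 (a : R) => N N0 a'; field.
  apply: (@le_trans _ _ ((Cn * lam `^ (- b) * u `^ (- (a / 4))) * (Num.sqrt (1 + K6) * u `^ (a / 2)))).
    by apply: ler_pM => //; exact: sqrtr_ge0.
  have -> : (Cn * lam `^ (- b) * u `^ (- (a / 4))) * (Num.sqrt (1 + K6) * u `^ (a / 2)) =
     C2 * (u `^ (- (a / 4)) * u `^ (a / 2)).
    by rewrite /C2 mulrACA.
  apply: ler_wpM2l => //; rewrite powR_prod//.
  have -> : - (a / 4) + a / 2 = a / 4 by field.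
  exact: pgam.
apply: le_trans (lerD (lerD T1 T2) T3) _.
rewrite -!mulrDl; apply: ler_wpM2r; first exact: ltW.
by rewrite -[leRHS]addrA addrCA lerDl addr_ge0.
Qed.

Theorem proposition1p5 (R : realType) (mu : probability (measurableTypeR R) R)
    (mu_ss : self_similar mu) (mu_na : non_atomic mu)
    (d : nat) (d_ge2 : (2 <= d)%N)
    (moment_decay : forall eps : R, 0 < eps ->
      exists p C : R, [/\ 1 < p, 0 < C &
        forall rad : R, 1 < rad ->
          (\int[lebesgue_rV R d.-1]_(xi in ball (0 : 'rV[R]_d.-1)%R rad)
             ((Normc.normc (fourier (pushforward mu (moment_curve d.-1)) xi)
                `^ p)%R)%:E
           <= (C * rad `^ eps)%R%:E)%E])
    (U : set R) (U_open : open U) (U_supp : msupport mu `<=` U)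
    (g : R -> 'rV[R]_d.-1)
    (Q_curve : non_trapped_curve U (graph_curve g) \/
      nondegenerate_curve U (graph_curve g)) :
  exists2 gamma : R, 0 < gamma &
    exists2 C : R, 1 <= C &
      forall (theta : R) (zeta : 'rV[R]_d.-1), zeta != 0 ->
        Normc.normc (fourier (pushforward mu (graph_curve g \_ U))
                 (row_mx theta%:M zeta))
          <= C * `|zeta| `^ (- gamma).
Proof.
have m0 : (0 < d.-1)%N by rewrite -ltnS (prednK (ltnW d_ge2)).
have [gamma gamma0 [C C1 hC]] :=
  mfourier_decay_curve mu_ss mu_na m0 moment_decay U_open U_supp Q_curve.
exists gamma => //; exists C => // theta zeta zeta0.
rewrite normc_fourier_pushforward; first exact: hC.
exact: measurable_admissible_curve.
Qed.
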